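(* Let $0<p<\infty$ and let $\omega$ be an invariant weight such that the polynomials are dense in $A^p_\omega$. Let $f\in A^p_\omega$, and let $0<p_1,p_2<\infty$ be such that $p^{-1}=p_1^{-1}+p_2^{-1}$. Then there exist $f_1\in A^{p_1}_\omega$ and $f_2\in A^{p_2}_\omega$ such that $f=f_1\cdot f_2$ and $$\|f_1\|_{A^{p_1}_\omega}^p\cdot\|f_2\|_{A^{p_2}_\omega}^p\le\frac{p}{p_1}\|f_1\|_{A^{p_1}_\omega}^{p_1}+\frac{p}{p_2}\|f_2\|_{A^{p_2}_\omega}^{p_2}\le C\|f\|_{A^p_\omega}^p$$ for some constant $C=C(p_1,p_2,\omega)>0$.
   Context: $\mathbb{D}$ is the open unit disc and $dA=\frac{dx\,dy}{\pi}$. A weight is a nonnegative integrable function on $\mathbb{D}$ (not necessarily radial or continuous). $A^p_\omega$ is the space of analytic $f$ in $\mathbb{D}$ with $\|f\|_{A^p_\omega}^p=\int_{\mathbb{D}}|f|^p\omega\,dA<\infty$. With $\varphi_a(z)=\frac{a-z}{1-\overline{a}z}$, the pseudohyperbolic disc is $\Delta(a,r)=\{z:|\varphi_a(z)|<r\}$. A weight $\omega$ is invariant if for each $r\in(0,1)$ there is a constant $C=C(r)\ge1$ such that $C^{-1}\omega(a)\le\omega(z)\le C\omega(a)$ for all $a\in\mathbb{D}$ and $z\in\Delta(a,r)$. *)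

(* Defs.v *)
From HB Require Import structures.
From mathcomp Require Import all_boot all_order all_algebra.
From mathcomp Require Import all_classical all_reals all_analysis.
From mathcomp Require Export complex.

Set Implicit Arguments.
Unset Strict Implicit.
Unset Printing Implicit Defensive.

Import Order.TTheory GRing.Theory Num.Theory.
Import numFieldNormedType.Exports.
Import ComplexField.Normc.

Local Open Scope classical_set_scope.
Local Open Scope ring_scope.
Local Open Scope complex_scope.

Section WeightedBergman.
Variable R : realType.

(* [normc z : R] is the real-valued modulus; the library's [`|z|] is
   [(normc z)%:C]. *)
Definition unit_disc : set R[i] := [set z | normc z < 1].

(* Complex differentiability: the scalars of [R[i]^o] are the complex numbers,
   so the difference quotient is taken over complex increments. Functions on
   the disc are total functions of which only the values on the disc matter. *)
Definition analytic_on_disc (f : R[i] -> R[i]) : Prop :=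
  forall z, unit_disc z -> derivable (f : R[i]^o -> R[i]^o) z 1.

(* The plane is [R * R], the point [(x, y)] standing for [x +i* y], since
   [R[i]] carries no measurable structure in the library. *)
Definition cpt (u : measurableTypeR R * measurableTypeR R) : R[i] :=
  u.1 +i* u.2.

Definition plane_measure := (@lebesgue_measure R \x @lebesgue_measure R)%E.

Definition disc_integral (g : R[i] -> R) : \bar R :=
  ((pi^-1)%:E *
   \int[plane_measure]_(u in cpt @^-1` unit_disc) (g (cpt u))%:E)%E.

(* Lebesgue (not just Borel) integrability: [plane_measure] lives on the Borel
   sets, so a weight is required to agree almost everywhere with a Borel
   integrable function. As the library integral of a nonnegative function is a
   supremum over smaller simple functions, it is the Lebesgue integral for such
   functions too. *)
Definition is_weight (w : R[i] -> R) : Prop :=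
  (forall z, unit_disc z -> 0 <= w z) /\
  exists2 v : measurableTypeR R * measurableTypeR R -> R,
    plane_measure.-integrable (cpt @^-1` unit_disc) (EFin \o v) &
    ae_eq plane_measure (cpt @^-1` unit_disc) (w \o cpt) v.

Definition mobius (a z : R[i]) : R[i] := (a - z) / (1 - a^*%C * z).

(* [z] is explicitly kept in the disc because, division being total,
   [mobius a] vanishes at the pole [1 / a^*]. *)
Definition pseudohyperbolic_disc (a : R[i]) (r : R) : set R[i] :=
  [set z | unit_disc z /\ normc (mobius a z) < r].

Definition invariant_weight (w : R[i] -> R) : Prop :=
  is_weight w /\
  forall r : R, 0 < r < 1 -> exists2 C : R, 1 <= C &
    forall a z, unit_disc a -> pseudohyperbolic_disc a r z ->
      C^-1 * w a <= w z <= C * w a.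

Definition bergman_integral (p : R) (w : R[i] -> R) (f : R[i] -> R[i])
    : \bar R :=
  disc_integral (fun z => normc (f z) `^ p * w z).

Definition bergman_norm (p : R) (w : R[i] -> R) (f : R[i] -> R[i]) : \bar R :=
  (bergman_integral p w f `^ p^-1)%E.

Definition bergman_space (p : R) (w : R[i] -> R) : set (R[i] -> R[i]) :=
  [set f | analytic_on_disc f /\ (bergman_integral p w f < +oo)%E].

(* For [p < 1] the metric is [bergman_norm (f - g) ^ p]; it defines the same
   dense sets. *)
Definition polynomials_dense (p : R) (w : R[i] -> R) : Prop :=
  forall f, bergman_space p w f -> forall e : R, 0 < e ->
    exists q : {poly R[i]},
      (bergman_norm p w (fun z => f z - q.[z])%R < e%:E)%E.

End WeightedBergman.

Arguments unit_disc {R}.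

(* Main.v *)
Require Import Defs.
From HB Require Import structures.
From mathcomp Require Import all_boot all_order all_algebra.
From mathcomp Require Import all_classical all_reals all_analysis.
From mathcomp Require Import cyclic separable cyclotomic.
From mathcomp Require Import measurable_realfun ring lra.

Set Implicit Arguments.
Unset Strict Implicit.
Unset Printing Implicit Defensive.

Import Order.TTheory GRing.Theory Num.Theory.
Import numFieldNormedType.Exports.
Import ComplexField.Normc.
Local Open Scope classical_set_scope.
Local Open Scope ring_scope.

(** Why the theorem holds.

    Polynomials first. Let q = c * prod_j (z - w_j). On the disc each factor
    z - w_j has modulus l_j * b_j: if |w_j| < 1 then l_j = |1 - conj(w_j) z| and
    b_j is the modulus of a Blaschke factor, otherwise l_j = |z - w_j| and
    b_j = 1 ([outer_abs], [inner_abs]). A function with modulus l_j has no zeros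
    in the disc, hence has powers of every exponent s in [0, 1] ([root_split]).
    With s = p / p1 and 1 - s = p / p2, give the power s of each l_j to f1 and
    the power 1 - s to f2; each Blaschke factor must go to one of the two as a
    whole. If it goes to f1 with probability s, independently, the expectation
    of s |f1|^p1 + (1 - s) |f2|^p2 at a point is
      s |c|^p prod_j l_j^p (1 - s + s b_j^p1)
        + (1 - s) |c|^p prod_j l_j^p (s + (1 - s) b_j^p2),
    and some choice is as good as the average once this is integrated; the
    choice is found by induction on the zeros ([distribute_zeros]). By
    Bernoulli's inequality both products are at most
      Q(z) = |c|^p prod_j l_j^p exp(- p (1 - b_j^N) / N)
    for any N larger than p1 and p2 ([bernoulli_weight]), so that it remains to
    prove that the integral of Q w is at most C times that of |q|^p w
    ([inner_penalty_bound]).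

    This is where the invariance of the weight enters. Composing with the
    automorphism phi_a of the disc turns the zero w_j into a zero of modulus
    b_j(a), and Jensen's formula on the circle of radius r says that the
    geometric mean of |q o phi_a|^p there is at least
    |c|^p prod_j l_j(a)^p max(b_j(a), r)^p. Averaging in r against
    r^(N - 2) * r dr makes exactly the factors exp(- p (1 - b_j^N) / N) appear,
    and an extra factor (1 - r)^M costs only a constant ([radial_jensen],
    [weighted_mean_lower]). As w(a) (1 - |v|)^M <= C w(phi_a(v)) for an
    invariant weight ([weight_mobius_lower]), Q(a) w(a) is dominated by an
    average over v of (|q|^p w)(phi_a(v)) (1 - |v|)^2. Replacing the value at
    phi_a(v) by a mean over a small disc about that point and integrating in a
    first, one gets the integral of |q|^p w by Tonelli.

    For general f take polynomials q_n converging to f and factor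
    q_n = g_n h_n. The bounds make (g_n) and (h_n) normal families; the limits
    satisfy f = g h and inherit the estimate by Fatou's lemma
    ([limit_factor]).

    Two devices keep the argument elementary. Mean values on circles are
    replaced by geometric means over the n rotations by the n-th roots of unity,
    for which the Jensen formula is an exact finite product, followed by the
    inequality between means, rotation invariance and Fatou's lemma
    ([circular_mean]). Analytic functions are produced as locally uniform
    limits of polynomials ([locpoly]), for which Taylor estimates follow from
    finite sums over roots of unity, and Montel's theorem ([montel]) is
    obtained by passing to the limit along an ultrafilter.

    The weight itself need not be Borel, so it is replaced by the comparable
    lower semicontinuous weight [envelope]. *)

(** * Linear changes of variables in the plane *)

Section AffineLine.
Variable R : realType.
Local Notation leb := (@lebesgue_measure R).

Let aff (a b : R) : measurableTypeR R -> measurableTypeR R := fun x => a * x + b.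

Let measurable_aff a b : measurable_fun [set: measurableTypeR R] (aff a b).
Proof. by apply: measurable_funD => //; exact: measurable_funM. Qed.

(** Both sides are measures in [A], so by uniqueness it is enough to compare them
    on intervals; the two signs of [a] differ by the orientation. *)
Lemma lebesgue_measure_aff (a b : R) (A : set (measurableTypeR R)) : a != 0 -> measurable A ->
  (leb A = `|a|%:E * leb (aff a b @^-1` A))%E.
Proof.
move=> a0 mA.
pose nu' : {measure set (measurableTypeR R) -> \bar R} :=
  mscale (NngNum (normr_ge0 a)) (pushforward leb (aff a b)).
pose nu := nu' (measurable_aff a b).
rewrite (@lebesgue_measure_unique _ nu)//.
move=> _ [[x y]] _ <-.
rewrite -[RHS]/(`|a|%:E * leb (aff a b @^-1` `]x, y]))%E.
have aV (u v : R) : a * u + b = v <-> u = (v - b) / a.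
  by split=> [<-|->]; field.
have [agt|alt] : 0 < a \/ a < 0 by case: (ltgtP a 0) a0 => //; auto.
- rewrite (_ : aff a b @^-1` _ = `](x - b) / a, (y - b) / a]%classic); last first.
    apply/seteqP; split=> z /=; rewrite !in_itv/= /aff ltr_pdivrMr// ler_pdivlMr//;
     rewrite (mulrC z) ltrBlDr lerBrDr//.
  rewrite !lebesgue_measure_itv/= !lte_fin ltr_pM2r ?invr_gt0// ltrBlDr subrK.
  case: ifP => xy; last by rewrite mule0.
  by rewrite gtr0_norm// -!EFinB -EFinM; congr EFin; field.
- rewrite (_ : aff a b @^-1` _ = `[(y - b) / a, (x - b) / a[%classic); last first.
    apply/seteqP; split=> z /=; rewrite !in_itv/= /aff ltr_ndivlMr// ler_ndivrMr//;
     rewrite (mulrC z) ltrBlDr lerBrDr andbC//.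
  rewrite !lebesgue_measure_itv/= !lte_fin ltr_nM2r ?invr_lt0// ltrBlDr subrK.
  case: ifP => xy; last by rewrite mule0.
  by rewrite ltr0_norm// -!EFinB -EFinM; congr EFin; field.
Qed.

Lemma ge0_integral_aff (a b : R) (g : measurableTypeR R -> \bar R) : a != 0 ->
  measurable_fun setT g -> (forall x, 0 <= g x)%E ->
  (\int[leb]_x g (a * x + b)%R = `|a|^-1%:E * \int[leb]_x g x)%E.
Proof.
move=> a0 mg g0.
pose nu' : {measure set (measurableTypeR R) -> \bar R} :=
  mscale (NngNum (normr_ge0 a)) (pushforward leb (aff a b)).
pose nu := nu' (measurable_aff a b).
have -> : (\int[leb]_x g x = \int[nu]_x g x)%E.
  by apply: eq_measure_integral => A mA _; rewrite /nu /nu' /= /mscale/=; exact: lebesgue_measure_aff.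
rewrite ge0_integral_mscale//= ge0_integral_pushforward// muleA -EFinM mulVf ?normr_eq0// mul1e.
by rewrite preimage_setT.
Qed.

End AffineLine.

Section Plane.
Variable R : realType.
Local Notation leb := (@lebesgue_measure R).
Local Notation PT := (measurableTypeR R * measurableTypeR R)%type.
Local Notation mu := (@lebesgue_measure R \x @lebesgue_measure R)%E.
Local Open Scope complex_scope.

(** [R[i]] carries no sigma-algebra, so that measurability is imposed on the
    real and imaginary parts. *)
Definition cmeasurable d (T : measurableType d) (h : T -> R[i]) :=
  measurable_fun setT (fun x => complex.Re (h x)) /\
  measurable_fun setT (fun x => complex.Im (h x)).

Section Closure.
Context d (T : measurableType d).
Implicit Types h k : T -> R[i].

Lemma cmeasurable_cst (c : R[i]) : cmeasurable (fun _ : T => c).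
Proof. by split; exact: measurable_cst. Qed.

Lemma cmeasurableD h k : cmeasurable h -> cmeasurable k ->
  cmeasurable (fun x => h x + k x).
Proof.
move=> [h1 h2] [k1 k2]; split.
  have := measurable_funD h1 k1; congr measurable_fun; apply/funext => x /=.
  by case: (h x) (k x) => ? ? [].
have := measurable_funD h2 k2; congr measurable_fun; apply/funext => x /=.
by case: (h x) (k x) => ? ? [].
Qed.

Lemma cmeasurableN h : cmeasurable h -> cmeasurable (fun x => - h x).
Proof.
move=> [h1 h2]; split.
  have := measurable_funN h1; congr measurable_fun; apply/funext => x /=.
  by case: (h x).
have := measurable_funN h2; congr measurable_fun; apply/funext => x /=.
by case: (h x).
Qed.

Lemma cmeasurableB h k : cmeasurable h -> cmeasurable k ->
  cmeasurable (fun x => h x - k x).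
Proof. by move=> mh mk; apply: cmeasurableD => //; exact: cmeasurableN. Qed.

Lemma cmeasurableM h k : cmeasurable h -> cmeasurable k ->
  cmeasurable (fun x => h x * k x).
Proof.
move=> [h1 h2] [k1 k2]; split.
  have := measurable_funB (measurable_funM h1 k1) (measurable_funM h2 k2).
  congr measurable_fun; apply/funext => x /=.
  by case: (h x) (k x) => ? ? [].
have := measurable_funD (measurable_funM h1 k2) (measurable_funM h2 k1).
congr measurable_fun; apply/funext => x /=.
by case: (h x) (k x) => ? ? [].
Qed.

Lemma cmeasurable_conj h : cmeasurable h -> cmeasurable (fun x => (h x)^*%C).
Proof.
move=> [h1 h2]; split.
  by move: h1; congr measurable_fun; apply/funext => x /=; case: (h x).
have := measurable_funN h2; congr measurable_fun; apply/funext => x /=.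
by case: (h x).
Qed.

Lemma measurable_normc h : cmeasurable h -> measurable_fun setT (fun x => normc (h x)).
Proof.
move=> [h1 h2].
rewrite [X in measurable_fun _ X](_ : _ = fun x => (complex.Re (h x) ^+ 2 + complex.Im (h x) ^+ 2) `^ 2^-1).
  apply: (@measurableT_comp _ _ _ _ _ _ (@powR R ^~ 2^-1)); first exact: measurable_powR.
  by apply: measurable_funD; exact: measurable_funX.
apply/funext => x; case: (h x) => a b /=.
by rewrite powR12_sqrt// addr_ge0 ?sqr_ge0.
Qed.

Lemma cmeasurable_real (h : T -> R) : measurable_fun setT h ->
  cmeasurable (fun x => (h x)%:C).
Proof. by move=> mh; split=> //=; exact: measurable_cst. Qed.

Lemma measurable_inv_ge0 (f : T -> R) : (forall x, 0 <= f x) ->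
  measurable_fun setT f -> measurable_fun setT (fun x => (f x)^-1).
Proof.
move=> f0 mf.
rewrite [X in measurable_fun _ X](_ : _ = fun x => f x `^ (-1)).
  apply: (@measurableT_comp _ _ _ _ _ _ (@powR R ^~ (-1))) => //.
by apply/funext => x; rewrite powR_inv1.
Qed.

Lemma measurable_powR_comp (f : T -> R) p : measurable_fun setT f ->
  measurable_fun setT (fun x => f x `^ p).
Proof.
move=> mf; apply: (@measurableT_comp _ _ _ _ _ _ (@powR R ^~ p)) => //.
Qed.

Lemma cmeasurableV h : cmeasurable h -> cmeasurable (fun x => (h x)^-1).
Proof.
move=> mh.
rewrite [X in cmeasurable X](_ : _ = fun x => (h x)^*%C * (((normc (h x)) ^+ 2)^-1)%:C).
  apply: cmeasurableM; first exact: cmeasurable_conj.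
  apply: cmeasurable_real; apply: measurable_inv_ge0 => [x|]; first exact: sqr_ge0.
  by apply: measurable_funX; exact: measurable_normc.
apply/funext => x; case: (h x) => a b /=.
rewrite sqr_sqrtr ?addr_ge0 ?sqr_ge0//.
by simpc; congr (_ +i* _).
Qed.

Lemma cmeasurable_comp (d' : measure_display) (Y : measurableType d') (g : R[i] -> Y) h : measurable_fun setT (g \o @cpt R) ->
  cmeasurable h -> measurable_fun setT (fun x => g (h x)).
Proof.
move=> mg [h1 h2].
rewrite [X in measurable_fun _ X](_ : _ = (g \o @cpt R) \o (fun x => (complex.Re (h x), complex.Im (h x)))).
  by apply: measurableT_comp => //; exact/measurable_fun_pairP.
by apply/funext => x /=; rewrite /cpt/=; case: (h x).
Qed.

End Closure.

Lemma cmeasurable_cpt : cmeasurable (@cpt R).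
Proof. by split; [exact: measurable_fst|exact: measurable_snd]. Qed.

Lemma cmeasurable_compT d d' (S : measurableType d) (T : measurableType d')
  (h : T -> R[i]) (k : S -> T) : cmeasurable h -> measurable_fun setT k ->
  cmeasurable (fun x => h (k x)).
Proof. by move=> [h1 h2] mk; split; [exact: (measurableT_comp h1 mk)|exact: (measurableT_comp h2 mk)]. Qed.

(** In coordinates [z = c + i s] acts as a rotation-dilation of the plane. It
    factors into shears and one-dimensional affine maps, to which
    [ge0_integral_aff] and Tonelli's theorem apply; when [c = 0] the coordinates
    are exchanged instead. *)
Lemma ge0_integral_plane_aff (z b : R[i]) (g : R[i] -> \bar R) : z != 0 ->
  measurable_fun setT (g \o @cpt R) -> (forall x, 0 <= g x)%E ->
  (\int[mu]_u g (z * cpt u + b)%R = ((normc z) ^- 2)%:E * \int[mu]_u g (cpt u))%E.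
Proof.
case: z => c s z0 mg g0; case: b => b1 b2.
pose G (x y : measurableTypeR R) := g (x +i* y).
have G0 x y : (0 <= G x y)%E by exact: g0.
have mG1 y : measurable_fun setT (G ^~ y).
  by apply: cmeasurable_comp mg _; split => //=; exact: measurable_cst.
have mG2 x : measurable_fun setT (G x).
  by apply: cmeasurable_comp mg _; split => //=; exact: measurable_cst.
have nE : normc (c +i* s) ^- 2 = (c ^+ 2 + s ^+ 2)^-1.
  by rewrite /= sqr_sqrtr ?addr_ge0 ?sqr_ge0.
have n0 : c ^+ 2 + s ^+ 2 != 0.
  move: z0; apply: contra; rewrite paddr_eq0 ?sqr_ge0// !sqrf_eq0.
  by case/andP => /eqP -> /eqP ->.
have mzb : measurable_fun setT (fun u => g ((c +i* s) * cpt u + (b1 +i* b2))).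
  apply: cmeasurable_comp mg _; apply: cmeasurableD; last exact: cmeasurable_cst.
  apply: cmeasurableM; [exact: cmeasurable_cst|exact: cmeasurable_cpt].
have gE x y : g ((c +i* s) * cpt (x, y) + (b1 +i* b2)) =
    G (c * x + (- s * y + b1)) (s * x + (c * y + b2)).
  by rewrite /G /cpt /=; simpc; congr (g (_ +i* _)); ring.
have -> : (\int[mu]_u g (cpt u) = \int[leb]_y \int[leb]_x G x y)%E.
  by rewrite (fubini_tonelli2 (g \o @cpt R))// => u; exact: g0.
rewrite nE fubini_tonelli2//= /fubini_G.
under eq_integral => y _ do under eq_integral => x _ do rewrite gE.
have mG : measurable_fun setT (fun u : PT => G u.1 u.2).
  by apply: cmeasurable_comp mg _; split; [exact: measurable_fst|exact: measurable_snd].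
have GT0 (u : PT) : (0 <= G u.1 u.2)%E by exact: g0.
have mGc d (T : measurableType d) (h1 h2 : T -> R) : measurable_fun setT h1 ->
    measurable_fun setT h2 -> measurable_fun setT (fun x => G (h1 x) (h2 x)).
  by move=> m1 m2; apply: cmeasurable_comp mg _.
clearbody G; clear mzb gE mg g0 nE z0.
have maff (a1 a2 : R) : measurable_fun [set: measurableTypeR R] (fun x : R => a1 * x + a2).
  by apply: measurable_funD => //; exact: measurable_funM.
have mI1 : measurable_fun [set: measurableTypeR R] (fun x => \int[leb]_y G x y)%E.
  exact: (measurable_fun_fubini_tonelli_F (fun u : PT => G u.1 u.2)).
have mI2 : measurable_fun [set: measurableTypeR R] (fun y => \int[leb]_x G x y)%E.
  exact: (measurable_fun_fubini_tonelli_G (fun u : PT => G u.1 u.2)).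
(* Shears with quotient s / c need c != 0; for c = 0 the map is a rotation by a right angle. *)
have [c0|c0] := eqVneq c 0.
- have s0 : s != 0 by apply: contra n0 => /eqP ->; rewrite c0 expr0n addr0.
  have inner (y : R) : (\int[leb]_x G (c * x + (- s * y + b1))%R (s * x + (c * y + b2))%R =
    `|s|^-1%:E * \int[leb]_x G (- s * y + b1)%R x)%E.
    rewrite -(@ge0_integral_aff _ s b2 (G (- s * y + b1)))//.
    by apply: eq_integral => x _; rewrite c0; congr G; ring.
  under eq_integral do rewrite inner.
  rewrite (@ge0_integralZl _ _ _ leb _ measurableT (fun y => \int[leb]_x G (- s * y + b1)%R x)%E); last 3 first.
  + exact: (measurableT_comp mI1 (maff _ _)).
  + by move=> ? _; apply: integral_ge0.
  + by rewrite lee_fin invr_ge0.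
  rewrite (@ge0_integral_aff _ (- s) b1 (fun y => \int[leb]_x G y x)%E) ?oppr_eq0//; last first.
    by move=> x; apply: integral_ge0.
  rewrite -(fubini_tonelli (fun u : PT => G u.1 u.2))//= muleA.
  by congr (_ * _)%E; rewrite -EFinM c0 normrN expr0n add0r -invfM -normrM -expr2 ger0_norm ?sqr_ge0.
- pose k := (s ^+ 2 + c ^+ 2) / c; pose l x := s / c * (x - b1) + b2.
  have k0 : k != 0 by rewrite mulf_neq0 ?invr_eq0// addrC.
  have ml : measurable_fun [set: PT] (fun u : PT => k * u.2 + l u.1).
    apply: measurable_funD => //; first by apply: measurable_funM => //; exact: measurable_snd.
    apply: measurable_funD => //; apply: measurable_funM => //.
    by apply: measurable_funD => //; exact: measurable_fst.
  have mH : measurable_fun [set: PT] (fun u : PT => G u.1 (k * u.2 + l u.1)).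
    by apply: mGc => //; exact: measurable_fst.
  have inner (y : R) : (\int[leb]_x G (c * x + (- s * y + b1))%R (s * x + (c * y + b2))%R =
    `|c|^-1%:E * \int[leb]_x G x (k * y + l x)%R)%E.
    rewrite -(@ge0_integral_aff _ c (- s * y + b1) (fun x => G x (k * y + l x)%R))//; first last.
    + apply: mGc => //; apply: measurable_funD => //; apply: measurable_funD => //.
      by apply: measurable_funM => //; exact: measurable_funD.
    by apply: eq_integral => x _; rewrite /k /l; congr G; field.
  under eq_integral do rewrite inner.
  rewrite (@ge0_integralZl _ _ _ leb _ measurableT (fun y => \int[leb]_x G x (k * y + l x)%R)%E); last 3 first.
  + exact: (measurable_fun_fubini_tonelli_G (fun u : PT => G u.1 (k * u.2 + l u.1)%R)).
  + by move=> ? _; apply: integral_ge0.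
  + by rewrite lee_fin invr_ge0.
  have <- := fubini_tonelli (fun u : PT => G u.1 (k * u.2 + l u.1)%R) mH (fun u => G0 _ _).
  rewrite /=.
  under eq_integral.
    move=> x _; rewrite (@ge0_integral_aff _ k (l x) (G x))//.
    over.
  rewrite ge0_integralZl//; last by move=> ? _; apply: integral_ge0.
  rewrite -(fubini_tonelli (fun u : PT => G u.1 u.2))//= ?muleA.
  congr (_ * _)%E; rewrite -EFinM -invfM -normrM /k mulrC divfK// addrC ger0_norm//.
  by rewrite addr_ge0 ?sqr_ge0.
Qed.
End Plane.

(** * Integration over the disc *)

Section DiscIntegral.
Variable R : realType.
Local Notation leb := (@lebesgue_measure R).
Local Notation PT := (measurableTypeR R * measurableTypeR R)%type.
Local Notation mu := (@lebesgue_measure R \x @lebesgue_measure R)%E.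
Local Notation Dp := (@cpt R @^-1` unit_disc).
Local Open Scope complex_scope.
Local Open Scope ereal_scope.

(** The integral of a nonnegative function is a supremum over smaller simple
    functions, hence monotone even among functions that are not measurable.
    Weights that are not Borel are compared in this way. *)
Lemma le_ge0_integral d (T : measurableType d) (nu : {measure set T -> \bar R})
    (D : set T) (f g : T -> \bar R) :
  (forall x, D x -> 0 <= f x) -> (forall x, D x -> f x <= g x) ->
  \int[nu]_(x in D) f x <= \int[nu]_(x in D) g x.
Proof.
move=> f0 fg; rewrite (integral_mkcond D f) (integral_mkcond D g).
have f0' x : 0 <= (f \_ D) x by apply: erestrict_ge0.
have fg' x : (f \_ D) x <= (g \_ D) x by apply: lee_restrict.
have g0' x : 0 <= (g \_ D) x by exact: le_trans (fg' x).
rewrite !ge0_integralTE//; apply: ereal_sup_le => _ /= [h hf <-].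
by exists h => // x; exact: le_trans (fg' x).
Qed.

Lemma measurable_lt_normc d (T : measurableType d) (h : T -> R[i]) (f : T -> R) :
  cmeasurable h -> measurable_fun setT f ->
  measurable [set x | (normc (h x) < f x)%R].
Proof.
move=> mh mf.
have mb := measurable_fun_ltr (measurable_normc mh) mf.
by rewrite -[X in measurable X]setTI; apply: (mb measurableT [set true]).
Qed.

Lemma measurable_disc : measurable Dp.
Proof. exact: measurable_lt_normc (@cmeasurable_cpt R) (measurable_cst _). Qed.

Definition dint (f : R[i] -> \bar R) := \int[mu]_(u in Dp) f (cpt u).
Definition dmeas (f : R[i] -> \bar R) := measurable_fun Dp (f \o @cpt R).

Lemma unit_discE (z : R[i]) : unit_disc z = (normc z < 1)%R. Proof. by []. Qed.

Lemma dmeasT f : measurable_fun setT (f \o @cpt R) -> dmeas f.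
Proof. exact: measurable_funTS. Qed.

Lemma dint_ge0 f : (forall z, unit_disc z -> 0 <= f z) -> 0 <= dint f.
Proof. by move=> f0; apply: integral_ge0 => u; exact: f0. Qed.

Lemma eq_dint f g : (forall z, unit_disc z -> f z = g z) -> dint f = dint g.
Proof. by move=> fg; apply: eq_integral => u; rewrite inE => Du; exact: fg. Qed.

Lemma le_dint f g : (forall z, unit_disc z -> 0 <= f z) ->
  (forall z, unit_disc z -> f z <= g z) -> dint f <= dint g.
Proof. by move=> f0 fg; apply: le_ge0_integral => u; [exact: f0|exact: fg]. Qed.

Lemma dintD f g : dmeas f -> dmeas g ->
  (forall z, unit_disc z -> 0 <= f z) -> (forall z, unit_disc z -> 0 <= g z) ->
  dint (fun z => f z + g z) = dint f + dint g.
Proof.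
move=> mf mg f0 g0; rewrite /dint ge0_integralD//; first exact: measurable_disc.
- by move=> u; exact: f0.
- by move=> u; exact: g0.
Qed.

Lemma dintZl (k : R) f : dmeas f -> (forall z, unit_disc z -> 0 <= f z) ->
  (0 <= k)%R -> dint (fun z => k%:E * f z) = k%:E * dint f.
Proof.
move=> mf f0 k0; rewrite /dint ge0_integralZl//; first exact: measurable_disc.
by move=> u; exact: f0.
Qed.

(** Turns an integral over the disc into one over the plane, where Tonelli's
    theorem and changes of variables are available. *)
Lemma dint_patch f : dint f = \int[mu]_u (if (normc (cpt u) < 1)%R then f (cpt u) else 0).
Proof.
rewrite /dint integral_mkcond; apply: eq_integral => u _.
by rewrite patchE mem_setE /= unfold_in.
Qed.

Lemma dmeas_patch f : dmeas f -> measurable_fun setT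
  ((fun z : R[i] => if (normc z < 1)%R then f z else 0) \o @cpt R).
Proof.
move=> /(measurable_restrictT _ measurable_disc).1.
congr measurable_fun; apply/funext => u; rewrite patchE /=.
by rewrite mem_setE unfold_in.
Qed.

Lemma dint_rot (z : R[i]) f : normc z = 1%R -> dmeas f ->
  (forall z, unit_disc z -> 0 <= f z) -> dint (fun v => f (z * v)%R) = dint f.
Proof.
move=> z1 mf f0; rewrite !dint_patch.
pose F (v : R[i]) := if (normc v < 1)%R then f v else 0.
have z0 : z != 0%R by apply/eqP => ze; move: z1; rewrite ze normc0 => /esym/eqP; rewrite oner_eq0.
have := @ge0_integral_plane_aff R z 0%R F z0 (dmeas_patch mf).
rewrite z1 expr1n invr1 mul1e /F => <-; last first.
  by move=> x; case: ifPn => // /f0.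
by apply: eq_integral => u _; rewrite addr0 normcM z1 mul1r.
Qed.

(** The change of variables [u = b + r v], for a disc contained in the unit
    disc. *)
Lemma dint_affine (b : R[i]) (r : R) f : (0 < r)%R ->
  (forall v, (normc v < 1)%R -> unit_disc (b + r%:C * v)%R) ->
  dmeas f -> (forall z, unit_disc z -> 0 <= f z) ->
  dint (fun u => if (normc (u - b) < r)%R then f u else 0) =
  (r ^+ 2)%:E * dint (fun v => f (b + r%:C * v)%R).
Proof.
move=> r0 bD mf f0; rewrite [in RHS]dint_patch.
have nr : normc (r%:C) = r by rewrite /= expr0n addr0 sqrtr_sqr gtr0_norm.
have rC0 : r%:C != 0%R by apply/eqP => -[/eqP]; rewrite gt_eqF.
pose F (v : R[i]) := if (normc (v - b) < r)%R then f v else 0.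
have FD v : (normc (v - b) < r)%R -> unit_disc v.
  move=> vb; have := bD ((v - b) / r%:C)%R; rewrite mulrCA divff// mulr1 addrCA subrr addr0; apply.
  by rewrite normcM normcV nr ltr_pdivrMr// mul1r.
have F0 v : 0 <= F v by rewrite /F; case: ifPn => // /FD; exact: f0.
have mF : measurable_fun setT (F \o @cpt R).
  have -> : F \o @cpt R = (fun u : PT => if (normc (cpt u - b) < r)%R then
     (if (normc (cpt u) < 1)%R then f (cpt u) else 0) else 0).
    apply/funext => u /=; rewrite /F; case: ifPn => // /FD.
    by rewrite unit_discE => ->.
  apply: measurable_fun_ifT => //; last exact: dmeas_patch.
  apply: measurable_fun_ltr; last exact: measurable_cst.
  apply: measurable_normc; apply: cmeasurableB (@cmeasurable_cpt _) (cmeasurable_cst _ _).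
transitivity (\int[mu]_u F (cpt u)).
  rewrite dint_patch; apply: eq_integral => u _; rewrite /F.
  by case: ifPn => // /negP uD; case: ifPn => // /FD.
have := @ge0_integral_plane_aff R r%:C b F rC0 mF F0; rewrite nr => e.
have -> : \int[mu]_u F (cpt u) = (r ^+ 2)%:E * ((r ^- 2)%:E * \int[mu]_u F (cpt u)).
  by rewrite muleA -EFinM mulfV ?mul1e// sqrf_eq0 gt_eqF.
rewrite -e; congr (_ * _); apply: eq_integral => u _; rewrite /F addrK normcM nr.
by rewrite -[X in (_ < X)%R]mulr1 ltr_pM2l// addrC.
Qed.

(** The area pi, kept symbolic: it enters through its positivity and
    finiteness. *)
Definition disc_area := dint (fun=> 1).

Lemma disc_areaE : disc_area = mu Dp.
Proof. by rewrite /disc_area /dint integral_cst ?mul1e//; exact: measurable_disc. Qed.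

Lemma disc_area_lty : disc_area < +oo.
Proof.
rewrite disc_areaE (@le_lt_trans _ _ (mu (`[(-1)%R, 1%R] `*` `[(-1)%R, 1%R])))//.
  apply: le_measure; rewrite ?inE//; first exact: measurable_disc.
  - exact: measurableX.
  - move=> [x y]; rewrite /= unit_discE /= => xy.
    have {}xy : (x ^+ 2 + y ^+ 2 < 1)%R.
      by rewrite -[ltRHS]sqrtr1 ltr_sqrt in xy.
    by rewrite !in_itv /=; nra.
rewrite product_measure1E//= [X in X * _](_ : _ = leb `[(-1)%R, 1%R])// [X in _ * X](_ : _ = leb `[(-1)%R, 1%R])// !lebesgue_measure_itv/= lte_fin; case: ifP => _.
  by rewrite -!EFinB -EFinM ltry.
by rewrite mule0.
Qed.

Lemma disc_area_gt0 : 0 < disc_area.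
Proof.
rewrite disc_areaE (@lt_le_trans _ _ (mu (`[0%R, 2^-1%R] `*` `[0%R, 2^-1%R])))//.
  rewrite product_measure1E//= [X in X * _](_ : _ = leb `[0%R, 2^-1%R])// [X in _ * X](_ : _ = leb `[0%R, 2^-1%R])// !lebesgue_measure_itv/= lte_fin invr_gt0 ltr0n.
  by rewrite -!EFinB -EFinM lte_fin subr0 mulr_gt0.
apply: le_measure; rewrite ?inE//; first exact: measurableX.
  exact: measurable_disc.
move=> [x y]; rewrite /= !in_itv/= unit_discE /= => -[/andP[x0 x1] /andP[y0 y1]].
by rewrite -[ltRHS]sqrtr1 ltr_sqrt//; nra.
Qed.

Lemma dint_cst (k : R) : (0 <= k)%R -> dint (fun=> k%:E) = k%:E * disc_area.
Proof. by move=> k0; rewrite /dint integral_cst ?disc_areaE//; exact: measurable_disc. Qed.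

Lemma disc_area_fine : disc_area = (fine disc_area)%:E.
Proof. by rewrite fineK// ge0_fin_numE ?disc_area_lty// ltW// disc_area_gt0. Qed.

Lemma fine_disc_area_gt0 : (0 < fine disc_area)%R.
Proof. by rewrite -lte_fin -disc_area_fine disc_area_gt0. Qed.

End DiscIntegral.

(** This integral carries no factor [pi^-1]; it is an abbreviation rather than
    a definition so that the lemmas on [dint] apply to it directly. *)
Notation wint q W g := (dint (fun z => (normc (g z) `^ q * W z)%:E)).

(** * Moduli, roots of unity and geometric means *)

Section Roots.
Variable R : realType.
Local Open Scope complex_scope.

(** [X^n - 1] is separable in characteristic zero, so that its [n] roots in the
    algebraically closed field are distinct. *)
Lemma prim_root_exists n : (n > 0)%N -> exists z : R[i], n.-primitive_root z.
Proof.
move=> n_gt0; pose p : {poly R[i]} := 'X^n - 1.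
have [r Dp] := closed_field_poly_normal p.
rewrite (monicP _) ?monicXnsubC // scale1r in Dp.
have rn1 : all n.-unity_root r.
  by apply/allP => z; rewrite -root_prod_XsubC -Dp.
have sz_r : (n < (size r).+1)%N.
  by rewrite -(size_prod_XsubC r id) -Dp size_XnsubC.
have [|z] := hasP (has_prim_root n_gt0 rn1 _ sz_r); last by exists z.
by rewrite -separable_prod_XsubC -Dp separable_Xn_sub_1 // pnatr_eq0 -lt0n.
Qed.

Lemma normcX (z : R[i]) n : normc (z ^+ n) = normc z ^+ n.
Proof. by elim: n => [|n IH]; rewrite ?expr0 ?normc1// !exprS normcM IH. Qed.

Lemma normc_ge0 (z : R[i]) : 0 <= normc z.
Proof. by case: z => a b; rewrite sqrtr_ge0. Qed.

Lemma normc_eq0 (z : R[i]) : (normc z == 0) = (z == 0).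
Proof. by apply/eqP/eqP => [/eq0_normc//|->]; rewrite normc0. Qed.

Lemma normc_gt0 (z : R[i]) : (0 < normc z) = (z != 0).
Proof. by rewrite lt_def normc_ge0 andbT normc_eq0. Qed.

Lemma normc_real (r : R) : normc r%:C = `|r|.
Proof. by rewrite /= expr0n addr0 sqrtr_sqr. Qed.

Lemma normc_conj (z : R[i]) : normc z^*%C = normc z.
Proof. by case: z => a b /=; rewrite sqrrN. Qed.

Lemma normcB (x y : R[i]) : normc (x - y) = normc (y - x).
Proof. by rewrite -normcN opprB. Qed.

Lemma ler_normcB (x y : R[i]) : normc x - normc y <= normc (x - y).
Proof. by rewrite lerBlDr -{1}(subrK y x) le_normcD. Qed.

Lemma ler_normcBD (x y : R[i]) : normc (x - y) <= normc x + normc y.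
Proof. by rewrite -(normcN y) le_normcD. Qed.

Lemma normc_prod (I : Type) (s : seq I) (P : pred I) (F : I -> R[i]) :
  normc (\prod_(i <- s | P i) F i) = \prod_(i <- s | P i) normc (F i).
Proof. by apply: (big_morph _ (@normcM R) (@normc1 R)). Qed.

Lemma normc_prim_root n (z : R[i]) : n.-primitive_root z -> normc z = 1.
Proof.
move=> pz; have := prim_expr_order pz => /(congr1 (@normc R)).
rewrite normcX normc1 => /eqP.
by rewrite pexpr_eq1 ?normc_ge0 ?(prim_order_gt0 pz)// => /eqP.
Qed.

(** The finite form of Jensen's formula: for large [n] the [n]-th root of
    [|a^n - b^n|] tends to [max(|a|, |b|)] when the moduli differ. *)
Lemma prod_prim_root n (z a b : R[i]) : n.-primitive_root z ->
  \prod_(k < n) (a - b * z ^+ k) = a ^+ n - b ^+ n.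
Proof.
move=> pz; have n0 := prim_order_gt0 pz.
have [->|b0] := eqVneq b 0.
  under eq_bigr do rewrite mul0r subr0.
  by rewrite prodr_const card_ord expr0n eqn0Ngt n0 subr0.
have aE : a = b * (a / b) by rewrite mulrC divfK.
rewrite [in LHS]aE; under eq_bigr do rewrite -mulrBr.
rewrite big_split /= prodr_const card_ord.
have := factor_Xn_sub_1 pz => /(congr1 (fun p => p.[a / b])).
rewrite horner_prod big_mkord (eq_bigr (fun i : 'I_n => a / b - z ^+ i)); last first.
  by move=> i _; rewrite hornerXsubC.
move=> ->; rewrite hornerD hornerN hornerXn hornerC mulrBr mulr1 expr_div_n.
by rewrite mulrC divfK // expf_neq0.
Qed.

(** Orthogonality of characters: it isolates one coefficient of a polynomial. *)
Lemma sum_prim_root n (z : R[i]) j : n.-primitive_root z -> (0 < j < n)%N ->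
  \sum_(k < n) (z ^+ k) ^+ j = 0.
Proof.
move=> pz /andP[j0 jn].
have zj1 : z ^+ j - 1 != 0.
  by rewrite subr_eq0 -(prim_order_dvd pz) gtnNdvd.
apply: (mulfI zj1); rewrite mulr0.
under eq_bigr do rewrite -exprM mulnC exprM.
rewrite -subrX1 -exprM mulnC exprM (prim_expr_order pz) expr1n subrr//.
Qed.

Lemma powR_prod (I : Type) (s : seq I) (F : I -> R) p : (forall i, 0 <= F i) ->
  (\prod_(i <- s) F i) `^ p = \prod_(i <- s) F i `^ p.
Proof.
move=> F0; elim: s => [|i s IH]; first by rewrite !big_nil powR1.
by rewrite !big_cons powRM ?IH// prodr_ge0.
Qed.

Lemma geo_mean_le n (F : 'I_n -> R) : (0 < n)%N -> (forall i, 0 <= F i) ->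
  (\prod_(i < n) F i) `^ n%:R^-1 <= n%:R^-1 * \sum_(i < n) F i.
Proof.
move=> n0 F0; have nR : (n%:R : R) != 0 by rewrite pnatr_eq0 -lt0n.
have S0 : 0 <= \sum_(i < n) F i by apply: sumr_ge0.
have := leif_AGM (A := predT) (fun i _ => F0 i); rewrite card_ord => -[+ _].
move=> /(ge0_ler_powR (r := n%:R^-1)); rewrite !nnegrE invr_ge0 ler0n.
rewrite prodr_ge0// exprn_ge0 ?divr_ge0// -powR_mulrn ?divr_ge0//.
by rewrite -powRrM divff// powRr1 ?divr_ge0// mulrC; apply.
Qed.

End Roots.

(** * Circular means as limits of geometric means *)

Section CircularMean.
Variable R : realType.
Local Notation PT := (measurableTypeR R * measurableTypeR R)%type.
Local Notation mu := (@lebesgue_measure R \x @lebesgue_measure R)%E.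
Local Open Scope complex_scope.

Lemma measurable_circle (r : R) : measurable [set u : PT | normc (cpt u) = r].
Proof.
have := measurable_fun_eqr (measurable_normc (@cmeasurable_cpt R)) (measurable_cst r).
move=> m; rewrite [X in measurable X](_ : _ = [set: PT] `&` (fun u => normc (cpt u) == r) @^-1` [set true]).
  exact: m.
by rewrite setTI; apply/seteqP; split => u /= => [->|/eqP//]; rewrite eqxx.
Qed.

(** Each vertical line meets the circle in at most two points. *)
Lemma circle_null (r : R) : mu [set u : PT | normc (cpt u) = r] = 0%E.
Proof.
rewrite /product_measure1; apply: integral0_eq => x _ /=.
set S := xsection _ _.
have S_sub : S `<=` [set Num.sqrt (r ^+ 2 - x ^+ 2); - Num.sqrt (r ^+ 2 - x ^+ 2)].
  move=> y; rewrite /S /xsection /= inE /= => e.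
  have r2 : r ^+ 2 = x ^+ 2 + y ^+ 2 by rewrite -e sqr_sqrtr ?addr_ge0 ?sqr_ge0.
  rewrite r2 addrAC subrr add0r sqrtr_sqr.
  by case: (lerP 0 (y : R)) => y0; [left; rewrite ger0_norm|right; rewrite ltr0_norm// opprK].
apply: countable_lebesgue_measure0; apply: finite_set_countable.
by apply: sub_finite_set S_sub _; exact: finite_set2.
Qed.

Lemma circles_negligible (rs : seq R) :
  mu.-negligible [set u : PT | normc (cpt u) \in rs].
Proof.
elim: rs => [|r rs IH].
  by rewrite [X in _.-negligible X](_ : _ = set0) ?predeqE//; exact: negligible_set0.
rewrite [X in _.-negligible X](_ : _ = [set u : PT | normc (cpt u) = r] `|` [set u : PT | normc (cpt u) \in rs]).
  apply: negligibleU => //; apply/negligibleP; [exact: measurable_circle|exact: circle_null].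
apply/seteqP; split => u /=; rewrite inE => /predU1P.
  by move=> [?|?]; [left|right].
by [].
Qed.

Lemma dint_le_circles (rs : seq R) (f g : R[i] -> \bar R) : dmeas f -> dmeas g ->
  (forall z, unit_disc z -> 0 <= f z)%E -> (forall z, unit_disc z -> 0 <= g z)%E ->
  (forall z, unit_disc z -> normc z \notin rs -> f z <= g z)%E -> (dint f <= dint g)%E.
Proof.
move=> mf mg f0 g0 fg; apply: ae_ge0_le_integral => //.
- exact: measurable_disc.
- by move=> u; exact: f0.
- by move=> u; exact: g0.
apply: (negligibleS _ (circles_negligible rs)) => u /= /not_implyP[Du nfg].
by apply/negPn/negP => urs; apply: nfg; exact: fg.
Qed.

(** The inequality between the geometric and the arithmetic mean, pointwise;
    the arithmetic mean of the rotated functions has the integral of [Y] because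
    the disc and the area are invariant under rotation. *)
Lemma dint_geo_mean (Y : R[i] -> R) n (z : R[i]) : n.-primitive_root z ->
  measurable_fun setT (Y \o @cpt R) -> (forall v, 0 <= Y v) ->
  (dint (fun v => ((\prod_(k < n) Y (z ^+ k * v)) `^ n%:R^-1)%:E) <=
   dint (fun v => (Y v)%:E))%E.
Proof.
move=> pz mY Y0; have n0 := prim_order_gt0 pz.
have zk k : normc (z ^+ k) = 1 by rewrite normcX (normc_prim_root pz) expr1n.
have mYk k : dmeas (fun v => (Y (z ^+ k * v))%:E).
  apply: dmeasT; apply/measurable_EFinP; apply: cmeasurable_comp mY _.
  by apply: cmeasurableM; [exact: cmeasurable_cst|exact: cmeasurable_cpt].
apply: (@le_trans _ _ (dint (fun v => n%:R^-1%:E * \sum_(k < n) (Y (z ^+ k * v))%:E)%E)).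
  apply: le_dint => v _; first by rewrite lee_fin powR_ge0.
  by rewrite sumEFin -EFinM lee_fin geo_mean_le.
rewrite dintZl ?invr_ge0//; last first.
- by move=> v _; apply: sume_ge0 => k _; rewrite lee_fin.
- apply: emeasurable_sum => k; exact: mYk.
rewrite /dint ge0_integral_sum//; last 3 first.
- exact: measurable_disc.
- by move=> k; exact: mYk.
- by move=> k u _; rewrite lee_fin.
rewrite (eq_bigr (fun=> dint (fun v => (Y v)%:E))); last first.
  move=> k _; rewrite -[RHS](@dint_rot _ (z ^+ k))//.
  - by apply: dmeasT; apply/measurable_EFinP.
  - by move=> v _; rewrite lee_fin.
under eq_bigr do rewrite -[dint _]mul1e.
rewrite -ge0_sume_distrl// sumEFin sumr_const card_ord muleA -EFinM.
by rewrite mulVf ?mul1e// pnatr_eq0 -lt0n.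
Qed.

End CircularMean.

Section CircularMeanLimit.
Variable R : realType.
Local Notation PT := (measurableTypeR R * measurableTypeR R)%type.
Local Notation mu := (@lebesgue_measure R \x @lebesgue_measure R)%E.
Local Notation Dp := (@cpt R @^-1` unit_disc).
Local Open Scope complex_scope.

Lemma limn_einf_ge (u v : nat -> \bar R) l : (forall n, v n <= u n)%E ->
  v n @[n --> \oo] --> l -> (l <= limn_einf u)%E.
Proof.
move=> vu vl; have <- := (cvg_limn_einf_sup vl).1.
rewrite !limn_einf_lim; apply: lee_lim; [exact: is_cvg_einfs|exact: is_cvg_einfs|].
apply: nearW => n; apply: le_ereal_inf_tmp => _ [m /= nm <-].
by apply: le_trans (vu m); apply: ereal_inf_lbound; exists m.
Qed.

(** Fatou's lemma in the form used below. The points on finitely many circles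
    are left out because geometric means of a factor vanishing at a point of a
    circle need not converge on that circle; pointwise minorants [v] suffice
    since only a lower bound for the limit is wanted. *)
Lemma dint_fatou (rs : seq R) (G : nat -> R[i] -> \bar R) (f : R[i] -> \bar R) K :
  (forall n, dmeas (G n)) -> (forall n z, unit_disc z -> 0 <= G n z)%E ->
  dmeas f -> (forall z, unit_disc z -> 0 <= f z)%E ->
  (forall z, unit_disc z -> normc z \notin rs ->
     exists2 v : nat -> \bar R, (forall n, v n <= G n z)%E & v n @[n --> \oo] --> f z) ->
  (forall n, dint (G n) <= K)%E -> (dint f <= K)%E.
Proof.
move=> mG G0 mf f0 fG GK.
apply: (@le_trans _ _ (dint (fun z => limn_einf (G ^~ z)))).
  apply: (dint_le_circles (rs := rs)) => //.
  - apply: measurableT_comp => //; apply: measurable_fun_limn_esup => n.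
    by apply: measurableT_comp => //; exact: mG.
  - move=> z Dz; apply: (@limn_einf_ge _ (fun=> 0%E)); last exact: cvg_cst.
    by move=> n; exact: G0.
  - by move=> z Dz zrs; have [v vG vf] := fG z Dz zrs; exact: limn_einf_ge vf.
have := @fatou _ _ _ mu Dp (@measurable_disc R) (fun n u => G n (cpt u)) mG (fun n u => G0 n _).
move/le_trans; apply.
rewrite limn_einf_lim; apply: lime_le; first exact: is_cvg_einfs.
apply: nearW => n; apply: le_trans (GK n); apply: ereal_inf_lbound.
by exists n => /=.
Qed.

(** Modulus of a linear factor after composition with [mobius a], whose
    denominator remains: [mobius a v - w] is
    [((a - w) - (1 - w conj(a)) v) / (1 - conj(a) v)]. *)
Definition mobius_fac (a : R[i]) (x : R[i] * R[i]) (v : R[i]) : R :=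
  normc (x.1 - x.2 * v) / normc (1 - a^*%C * v).

(** The geometric mean over the circle of radius [r] of the numerator of
    [mobius_fac]; its denominator has mean one. *)
Definition circ_max (x : R[i] * R[i]) (r : R) : R :=
  Num.max (normc x.1) (normc x.2 * r).

Lemma mobius_fac_ge0 a x v : 0 <= mobius_fac a x v.
Proof. by rewrite divr_ge0 ?normc_ge0. Qed.

Lemma circ_max_ge0 x r : 0 <= circ_max x r.
Proof. by rewrite le_max normc_ge0. Qed.

(** [prod_prim_root] in the numerator and in the denominator. *)
Lemma prod_mobius_fac n (z : R[i]) a x v : n.-primitive_root z ->
  \prod_(k < n) mobius_fac a x (z ^+ k * v) =
  normc (x.1 ^+ n - (x.2 * v) ^+ n) / normc (1 - (a^*%C * v) ^+ n).
Proof.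
move=> pz; have E (b c : R[i]) : \prod_(k < n) (b - c * (z ^+ k * v)) = b ^+ n - (c * v) ^+ n.
  by rewrite -(prod_prim_root _ _ pz); apply: eq_bigr => k _; congr (_ - _); ring.
by rewrite prodf_div -!normc_prod !E expr1n.
Qed.

(** The larger of two moduli governs a difference of high powers, up to a
    factor that does not depend on the exponent. *)
Lemma normc_sub_exp_lower (P Q : R[i]) : normc Q < normc P -> forall n, (0 < n)%N ->
  normc P ^+ n * (1 - normc Q / normc P) <= normc (P ^+ n - Q ^+ n).
Proof.
move=> QP n n0; have P0 : 0 < normc P by apply: le_lt_trans QP; exact: normc_ge0.
apply: le_trans (ler_normcB _ _); rewrite !normcX mulrBr mulr1 lerD2l lerN2.
have -> : normc Q ^+ n = normc P ^+ n * (normc Q / normc P) ^+ n.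
  by rewrite -exprMn mulrC divfK// gt_eqF.
rewrite ler_pM2l ?exprn_gt0//.
have t0 : 0 <= normc Q / normc P by rewrite divr_ge0 ?normc_ge0.
by rewrite -[leRHS]expr1 ler_wiXn2l// ler_pdivrMr ?mul1r ?ltW.
Qed.

(** The constant [c] disappears in the limit, [c^(1/n)] tending to one. The
    excluded case, where the two terms of the numerator have equal nonzero
    modulus, occurs on a single circle. *)
Lemma mobius_fac_lower (a v : R[i]) (x : R[i] * R[i]) (p : R) :
  0 < p -> normc (a^*%C * v) < 1 ->
  circ_max x (normc v) = 0 \/ normc x.1 != normc x.2 * normc v ->
  exists2 c : R, 0 < c & forall n, (0 < n)%N ->
    circ_max x (normc v) `^ p * c `^ n%:R^-1 <=
    ((normc (x.1 ^+ n - (x.2 * v) ^+ n) / normc (1 - (a^*%C * v) ^+ n)) `^ p) `^ n%:R^-1.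
Proof.
move=> p0 av1 [->|ne].
  by exists 1 => // n n0; rewrite powR0 ?gt_eqF// mul0r powR_ge0.
set m := circ_max _ _.
have [t t1 tm] : exists2 t : R, 0 < t & forall n, (0 < n)%N ->
    m ^+ n * t <= normc (x.1 ^+ n - (x.2 * v) ^+ n).
  rewrite /m /circ_max -normcM; move: ne; rewrite -normcM neq_lt => /orP[lt|lt].
    rewrite max_r ?(ltW lt)//; exists (1 - normc x.1 / normc (x.2 * v)).
      by rewrite subr_gt0 ltr_pdivrMr ?mul1r// (le_lt_trans _ lt)// normc_ge0.
    by move=> n n0; rewrite normcB; exact: normc_sub_exp_lower.
  rewrite max_l ?(ltW lt)//; exists (1 - normc (x.2 * v) / normc x.1).
    by rewrite subr_gt0 ltr_pdivrMr ?mul1r// (le_lt_trans _ lt)// normc_ge0.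
  by move=> n n0; exact: normc_sub_exp_lower.
exists ((t / 2) `^ p); first by apply: powR_gt0; rewrite divr_gt0.
move=> n n0; have m0 : 0 <= m by exact: circ_max_ge0.
clearbody m.
have nR : (n%:R : R) != 0 by rewrite pnatr_eq0 -lt0n.
have -> : m `^ p = ((m ^+ n) `^ p) `^ n%:R^-1.
  by rewrite -powR_mulrn// -!powRrM mulrCA mulfV// mulr1.
have t2 : 0 <= t / 2 by rewrite divr_ge0 ?(ltW t1).
have mn0 : 0 <= m ^+ n by exact: exprn_ge0.
rewrite -(powRM _ (powR_ge0 _ _) (powR_ge0 _ _)) -(powRM _ mn0 t2).
apply: ge0_ler_powR; rewrite ?invr_ge0 ?nnegrE ?powR_ge0//.
have d0 : 0 < normc (1 - (a^*%C * v) ^+ n).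
  apply: lt_le_trans (ler_normcB _ _); rewrite normc1 subr_gt0 normcX.
  by rewrite exprn_ilt1 ?normc_ge0// -lt0n.
apply: ge0_ler_powR; rewrite ?nnegrE ?(ltW p0) ?divr_ge0 ?normc_ge0// ?(mulr_ge0 mn0 t2)//.
have tn0 : 0 <= m ^+ n * t by rewrite mulr_ge0// ltW.
rewrite mulrA; apply: (ler_pM tn0 _ (tm n n0)); first by rewrite invr_ge0.
rewrite lef_pV2 ?posrE// (le_trans (ler_normcBD _ _))// normc1 -[leRHS]/(1 + 1) lerD2l normcX.
by rewrite exprn_ile1 ?normc_ge0// ltW.
Qed.

Lemma cvg_powR_inv (c : R) : 0 < c -> c `^ n.+1%:R^-1 @[n --> \oo] --> (1 : R).
Proof.
move=> c0; have -> : (fun n : nat => c `^ n.+1%:R^-1) = (fun n => expR (n.+1%:R^-1 * ln c)).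
  by apply/funext => n; rewrite /powR gt_eqF.
have h : n.+1%:R^-1 * ln c @[n --> \oo] --> (0 : R).
  by have := cvgM (@cvg_harmonic R) (cvg_cst (ln c)); rewrite mul0r; apply.
by have := cvg_comp _ _ h (@continuous_expR R 0); rewrite expR0; apply.
Qed.

Lemma measurable_mobius_fac a x : measurable_fun setT (mobius_fac a x \o @cpt R).
Proof.
apply: measurable_funM.
  apply: measurable_normc; apply: cmeasurableB; first exact: cmeasurable_cst.
  by apply: cmeasurableM; [exact: cmeasurable_cst|exact: cmeasurable_cpt].
apply: measurable_inv_ge0 => [u|]; first exact: normc_ge0.
apply: measurable_normc; apply: cmeasurableB; first exact: cmeasurable_cst.
by apply: cmeasurableM; [exact: cmeasurable_cst|exact: cmeasurable_cpt].
Qed.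

Lemma measurable_prodR d (T : measurableType d) (I : Type) (s : seq I) (f : I -> T -> R) :
  (forall i, measurable_fun setT (f i)) ->
  measurable_fun setT (fun x => \prod_(i <- s) f i x).
Proof.
move=> mf; elim: s => [|i s IH].
  rewrite [X in measurable_fun _ X](_ : _ = cst 1); first exact: measurable_cst.
  by apply/funext => x; rewrite big_nil.
rewrite [X in measurable_fun _ X](_ : _ = (fun x => f i x * \prod_(j <- s) f j x)).
  exact: measurable_funM.
by apply/funext => x; rewrite big_cons.
Qed.

Lemma measurable_circ_max x : measurable_fun [set: PT] (fun u => circ_max x (normc (cpt u))).
Proof.
apply: measurable_maxr; first exact: measurable_cst.
apply: measurable_funM; first exact: measurable_cst.
exact: measurable_normc (@cmeasurable_cpt _).
Qed.

(** Jensen's inequality, integrated over circles with an arbitrary radial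
    weight. The geometric mean over [n] rotations of the integrand on the right
    is explicit by [prod_mobius_fac], is no larger in integral by
    [dint_geo_mean], and converges to the integrand on the left off finitely
    many circles. *)
Theorem circular_mean (s : seq (R[i] * R[i])) (a : R[i]) (p : R) (rho : R -> R) :
  0 < p -> normc a <= 1 -> (forall r, 0 <= rho r) -> measurable_fun setT rho ->
  (dint (fun v => (rho (normc v) * \prod_(x <- s) circ_max x (normc v) `^ p)%:E) <=
   dint (fun v => (rho (normc v) * \prod_(x <- s) mobius_fac a x v `^ p)%:E))%E.
Proof.
move=> p0 a1 rho0 mrho.
have mrhoc : measurable_fun [set: PT] (fun u => rho (normc (cpt u))).
  by apply: (measurableT_comp mrho); exact: measurable_normc (@cmeasurable_cpt _).
pose Y v := rho (normc v) * \prod_(x <- s) mobius_fac a x v `^ p.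
have Y0 v : 0 <= Y v by rewrite mulr_ge0// prodr_ge0// => x _; exact: powR_ge0.
have mY : measurable_fun setT (Y \o @cpt R).
  apply: measurable_funM => //; apply: measurable_prodR => x.
  by apply: measurable_powR_comp; exact: measurable_mobius_fac.
have [z pz] : exists z : nat -> R[i], forall n, n.+1.-primitive_root (z n).
  by have [z pz] := choice (fun n => @prim_root_exists R _ (ltn0Sn n)); exists z.
pose G n v := (\prod_(k < n.+1) Y (z n ^+ k * v)) `^ n.+1%:R^-1.
pose rs := [seq normc x.1 / normc x.2 | x <- s].
apply: (dint_fatou (rs := rs) (G := fun n v => (G n v)%:E)).
- move=> n; apply: dmeasT; apply/measurable_EFinP; apply: measurable_powR_comp.
  apply: measurable_prodR => k; apply: cmeasurable_comp mY _.
  by apply: cmeasurableM; [exact: cmeasurable_cst|exact: cmeasurable_cpt].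
- by move=> n v _; rewrite lee_fin powR_ge0.
- apply: dmeasT; apply/measurable_EFinP; apply: measurable_funM => //.
  by apply: measurable_prodR => x; apply: measurable_powR_comp; exact: measurable_circ_max.
- by move=> v _; rewrite lee_fin mulr_ge0// prodr_ge0// => x _; exact: powR_ge0.
- move=> v Dv vrs.
  have GE n : G n v = rho (normc v) * \prod_(x <- s)
      ((normc (x.1 ^+ n.+1 - (x.2 * v) ^+ n.+1) / normc (1 - (a^*%C * v) ^+ n.+1)) `^ p) `^ n.+1%:R^-1.
    have nz k : normc (z n ^+ k * v) = normc v.
      by rewrite normcM normcX (normc_prim_root (pz n)) expr1n mul1r.
    rewrite /G (eq_bigr (fun k : 'I_n.+1 => rho (normc v) *
        \prod_(x <- s) mobius_fac a x (z n ^+ k * v) `^ p)); last by move=> k _; rewrite /Y nz.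
    rewrite big_split /= prodr_const card_ord powRM ?exprn_ge0//; last first.
      by apply: prodr_ge0 => k _; apply: prodr_ge0 => x _; exact: powR_ge0.
    rewrite -powR_mulrn// -powRrM mulfV ?pnatr_eq0// powRr1//; congr (_ * _).
    rewrite exchange_big /= powR_prod; last first.
      by move=> x; apply: prodr_ge0 => k _; exact: powR_ge0.
    apply: eq_bigr => x _; rewrite -powR_prod; last by move=> k; exact: mobius_fac_ge0.
    by rewrite (prod_mobius_fac _ _ _ (pz n)).
  have av : normc (a^*%C * v) < 1.
    rewrite normcM normc_conj; apply: le_lt_trans Dv.
    by rewrite ler_piMl ?normc_ge0.
  have [c c0 cl] : exists2 c : R, 0 < c & forall n,
     (\prod_(x <- s) circ_max x (normc v) `^ p) * c `^ n.+1%:R^-1 <=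
      \prod_(x <- s) ((normc (x.1 ^+ n.+1 - (x.2 * v) ^+ n.+1) / normc (1 - (a^*%C * v) ^+ n.+1)) `^ p) `^ n.+1%:R^-1.
    have : forall x, x \in s -> circ_max x (normc v) = 0 \/ normc x.1 != normc x.2 * normc v.
      move=> x xs; have [e|] := eqVneq (normc x.1) (normc x.2 * normc v); last by right.
      left; rewrite /circ_max -e maxxx; move: vrs; apply: contraNeq => x10.
      apply/mapP; exists x => //; rewrite e mulrC mulKf//.
      by apply: contraNneq x10 => x20; rewrite e x20 mul0r.
    elim: {vrs rs Y mY Y0 G GE} s => [|x s IH] hs.
      by exists 1 => // n; rewrite !big_nil powR1 mulr1.
    have [|c c0 cl] := IH; first by move=> y ys; apply: hs; rewrite inE ys orbT.
    have [c' c'0 cl'] := mobius_fac_lower p0 av (hs x (mem_head _ _)).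
    exists (c' * c); first exact: mulr_gt0.
    move=> n; rewrite !big_cons powRM ?(ltW c0) ?(ltW c'0)// mulrACA.
    apply: ler_pM; rewrite ?mulr_ge0 ?powR_ge0 ?prodr_ge0//.
    - by move=> y _; exact: powR_ge0.
    - exact: cl'.
  exists (fun n => (rho (normc v) * (\prod_(x <- s) circ_max x (normc v) `^ p) * c `^ n.+1%:R^-1)%:E).
    by move=> n; rewrite lee_fin GE -mulrA ler_wpM2l.
  apply: cvg_EFin; first by apply: nearW.
  rewrite -[X in _ --> X]mulr1 /=; apply: cvgM; first exact: cvg_cst.
  exact: cvg_powR_inv.
- by move=> n; apply: dint_geo_mean (pz n) _ _.
Qed.

End CircularMeanLimit.

(** * The Jensen inequality, integrated over the radius *)

Section Radial.
Variable R : realType.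
Local Open Scope complex_scope.

Lemma ln_le_sub1 (y : R) : 0 < y -> ln y <= y - 1.
Proof. by move=> y0; rewrite lerBrDl -{2}(lnK y0) expR_ge1Dx. Qed.

Lemma measurable_radial (f : R -> R) : measurable_fun setT f ->
  dmeas (fun v : R[i] => (f (normc v))%:E).
Proof.
move=> mf; apply: dmeasT; apply/measurable_EFinP; apply: (measurableT_comp mf).
exact: measurable_normc (@cmeasurable_cpt _).
Qed.

Lemma dint_scale (f : R[i] -> \bar R) (x : R) : 0 < x <= 1 -> dmeas f ->
  (forall z, unit_disc z -> 0 <= f z)%E ->
  (dint (fun v => if (normc v < x)%R then f v else 0) =
   (x ^+ 2)%:E * dint (fun v => f (x%:C * v)%R))%E.
Proof.
move=> /andP[x0 x1] mf f0.
have := @dint_affine R 0%R x f x0 _ mf f0; under eq_dint do rewrite subr0.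
move=> ->; first by congr (_ * _)%E; apply: eq_dint => v _; rewrite add0r.
move=> v v1; rewrite add0r unit_discE normcM normc_real gtr0_norm//.
by rewrite (le_lt_trans _ v1)// ler_piMl ?normc_ge0.
Qed.

Lemma dint_EFin_fin (f : R[i] -> R) (K : R) : (forall z, unit_disc z -> 0 <= f z <= K) ->
  dint (fun z => (f z)%:E) = (fine (dint (fun z => (f z)%:E)))%:E /\
  0 <= fine (dint (fun z => (f z)%:E)).
Proof.
move=> fK.
have K0 : 0 <= K.
  have D0 : unit_disc (0 : R[i]) by rewrite unit_discE normc0 ltr01.
  by have /andP [a b] := fK 0 D0; apply: le_trans a b.
have I0 : (0 <= dint (fun z => (f z)%:E))%E.
  by apply: dint_ge0 => z Dz; rewrite lee_fin; have /andP[] := fK z Dz.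
split; last exact: fine_ge0.
rewrite fineK// ge0_fin_numE//; apply: (@le_lt_trans _ _ (dint (fun=> K%:E : \bar R))).
  by apply: le_dint => z Dz; rewrite lee_fin; have /andP[] := fK z Dz.
rewrite dint_cst// lte_mul_pinfty//; exact: disc_area_lty.
Qed.

Variables (k : nat) (k2 : (1 < k)%N).
Let n := k.+2.
Let w (v : R[i]) : R := normc v ^+ k.
(** The total mass of the radial weight [|v|^k], which in polar coordinates is
    a multiple of [r^(k+1) dr]; this is where the exponent [k+2] comes from. *)
Definition radial_mass : R := fine (dint (fun v : R[i] => (normc v ^+ k)%:E)).
Local Notation Z := radial_mass.

Let w01 v : unit_disc v -> 0 <= w v <= 1.
Proof.
by move=> /ltW v1; rewrite exprn_ge0 ?normc_ge0//= exprn_ile1 ?normc_ge0.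
Qed.

Lemma radial_massE : dint (fun v : R[i] => (normc v ^+ k)%:E) = Z%:E.
Proof. exact: (dint_EFin_fin w01).1. Qed.

Let mX j : measurable_fun [set: R] (fun r : R => r ^+ j).
Proof. exact: measurable_funX. Qed.

Let mw : dmeas (fun v => (w v)%:E).
Proof. exact: (measurable_radial (mX k)). Qed.

Lemma dint_disc_radius (x : R) : 0 < x <= 1 ->
  (dint (fun v : R[i] => if (normc v < x)%R then 1 else 0) = (x ^+ 2)%:E * disc_area R)%E.
Proof.
move=> x01; rewrite (dint_scale x01 (f := fun=> 1%E))//.
by apply: dmeasT; exact: measurable_cst.
Qed.

Lemma dmeas_if_lt (x : R) (a b : \bar R) : dmeas (fun v : R[i] => if (normc v < x)%R then a else b).
Proof.
apply: dmeasT; apply: measurable_fun_ifT => //=.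
by apply: measurable_fun_ltr; [exact: measurable_normc (@cmeasurable_cpt _)|exact: measurable_cst].
Qed.

(** [1 <= 1_(|v| < 1/2) + 2^k |v|^k], and the small disc has only a quarter of
    the area. *)
Lemma radial_mass_gt0 : 0 < Z.
Proof.
have K0 := fine_disc_area_gt0 R; have kE := disc_area_fine R.
set K := fine _ in K0 kE *.
(* For h = 1/2, K <= h^2 K + h^-k Z forces Z > 0. *)
pose h : R := 2^-1.
have h01 : 0 < h <= 1 by rewrite /h; lra.
have h0 : 0 < h by rewrite /h.
have /= := @le_dint R (fun=> 1%E) (fun v => (if (normc v < h)%R then 1 else 0) + (h ^- k)%:E * (w v)%:E)%E.
rewrite dintD//; last first.
- by move=> v Dv; rewrite lee_fin mulr_ge0 ?invr_ge0 ?exprn_ge0 ?normc_ge0 ?ltW.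
- by move=> v _; case: ifP => _; rewrite ?lee_fin.
- by apply: measurable_funeM.
- exact: dmeas_if_lt.
rewrite dintZl ?invr_ge0 ?exprn_ge0 ?(ltW h0)//; last first.
  by move=> v Dv; rewrite lee_fin; have /andP [] := w01 Dv.
rewrite radial_massE dint_disc_radius// -/(disc_area R) kE -!EFinM -EFinD lee_fin => H.
have {}H : K <= h ^+ 2 * K + h ^- k * Z.
  apply: H => [v _|v _]; rewrite ?lee_fin//.
  case: ifPn => [_|]; first by rewrite leeDl// lee_fin mulr_ge0 ?invr_ge0 ?exprn_ge0 ?normc_ge0 ?ltW.
  rewrite add0e -leNgt -EFinM lee_fin => hv.
  rewrite mulrC ler_pdivlMr ?exprn_gt0// mul1r /w.
  by rewrite lerXn2r ?nnegrE ?normc_ge0// ltW.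
rewrite ltNge; apply/negP => Z0.
have : h ^- k * Z <= 0 by rewrite mulr_ge0_le0 ?invr_ge0 ?exprn_ge0 ?(ltW h0).
by move: H; rewrite /h; nra.
Qed.

Let psi (v : R[i]) : R := - ln (normc v) * normc v ^+ k.

Let psi01 v : unit_disc v -> 0 <= psi v <= 1.
Proof.
move=> v1; rewrite /psi; have [v0|v0] := ltrP 0 (normc v); last first.
  by rewrite (_ : normc v = 0) ?ln0// ?oppr0 ?mul0r ?lexx ?ler01//; apply/eqP; rewrite eq_le v0 normc_ge0.
have l0 : ln (normc v) <= 0 by rewrite ln_le0// ltW.
rewrite mulr_ge0 ?exprn_ge0 ?oppr_ge0 ?normc_ge0//=.
have lv : - ln (normc v) <= (normc v)^-1.
  rewrite -lnV ?posrE//; apply: le_trans (ln_le_sub1 _) _; rewrite ?invr_gt0//.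
  by rewrite gerBl.
apply: (@le_trans _ _ ((normc v)^-1 * normc v)); last by rewrite mulVf ?gt_eqF.
apply: ler_pM => //; rewrite ?oppr_ge0 ?exprn_ge0 ?(ltW v0)//.
by rewrite -[leRHS]expr1 ler_wiXn2l ?(ltW v0) ?(ltW v1)// ltnW.
Qed.

Let m_psi : dmeas (fun v => (psi v)%:E).
Proof.
apply: (@measurable_radial (fun r => - ln r * r ^+ k)).
by apply: measurable_funM => //; apply: measurable_funN; exact: measurable_ln.
Qed.

Let Sp : R := fine (dint (fun v => (psi v)%:E)).
Let SE : dint (fun v => (psi v)%:E) = Sp%:E.
Proof. exact: (dint_EFin_fin psi01).1. Qed.
Let S0 : 0 <= Sp. Proof. exact: (dint_EFin_fin psi01).2. Qed.

(** Scaling: with [v = x u] the logarithm splits into [ln x] and [ln |u|]. *)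
Lemma dint_log_lt (x : R) : 0 < x < 1 ->
  dint (fun v => if normc v < x then (psi v)%:E else 0%E) =
  (x ^+ n * (- ln x * Z + Sp))%:E.
Proof.
move=> /andP[x0 x1]; rewrite dint_scale ?x0 ?ltW//; last first.
  by move=> v Dv; rewrite lee_fin; have /andP [] := psi01 Dv.
rewrite (eq_dint (g := fun v => ((x ^+ k * - ln x)%:E * (w v)%:E + (x ^+ k)%:E * (psi v)%:E)%E)); last first.
  move=> v Dv; rewrite -!EFinM -EFinD /psi /w normcM normc_real gtr0_norm//; congr EFin.
  have [v0|v0] := ltrP 0 (normc v).
    by rewrite lnM ?posrE// exprMn; ring.
  have -> : normc v = 0 by apply/eqP; rewrite eq_le v0 normc_ge0.
  by rewrite mulr0 ln0// oppr0 !mul0r; case: (k) k2 => // j _; rewrite expr0n /= !mulr0 addr0.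
have lx : 0 <= x ^+ k * - ln x by rewrite mulr_ge0 ?exprn_ge0 ?oppr_ge0 ?ln_le0 ?ltW.
have xk : 0 <= x ^+ k by rewrite exprn_ge0 ?ltW.
have w0 v : unit_disc v -> (0 <= (w v)%:E)%E by move=> Dv; rewrite lee_fin; have /andP [] := w01 Dv.
have p0 v : unit_disc v -> (0 <= (psi v)%:E)%E by move=> Dv; rewrite lee_fin; have /andP [] := psi01 Dv.
rewrite dintD; last 4 first.
- by apply: measurable_funeM.
- by apply: measurable_funeM.
- by move=> v Dv; rewrite mule_ge0 ?lee_fin//; exact: w0.
- by move=> v Dv; rewrite mule_ge0 ?lee_fin//; exact: p0.
rewrite !dintZl// radial_massE SE.
transitivity ((x ^+ 2 * (x ^+ k * - ln x * Z + x ^+ k * Sp))%:E) => //.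
by congr EFin; have -> : x ^+ n = x ^+ 2 * x ^+ k by [rewrite -exprD]; ring.
Qed.

Lemma dint_pow_lt (x : R) : 0 < x < 1 ->
  dint (fun v => if normc v < x then (w v)%:E else 0%E) = (x ^+ n * Z)%:E.
Proof.
move=> /andP[x0 x1]; rewrite dint_scale ?x0 ?ltW//; last first.
  by move=> v Dv; rewrite lee_fin; have /andP [] := w01 Dv.
rewrite (eq_dint (g := fun v => ((x ^+ k)%:E * (w v)%:E)%E)); last first.
  by move=> v Dv; rewrite -EFinM /w normcM normc_real gtr0_norm// exprMn.
rewrite dintZl//; last 2 first.
- by move=> v Dv; rewrite lee_fin; have /andP [] := w01 Dv.
- by rewrite exprn_ge0// ltW.
by rewrite radial_massE -!EFinM; congr EFin; have -> : x ^+ n = x ^+ 2 * x ^+ k by [rewrite -exprD]; ring.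
Qed.

Let J (x : R) := dint (fun v => (- ln (Num.max x (normc v)) * normc v ^+ k)%:E).

Let mJ (x : R) : dmeas (fun v : R[i] => (- ln (Num.max x (normc v)) * normc v ^+ k)%:E).
Proof.
apply: (@measurable_radial (fun r => - ln (Num.max x r) * r ^+ k)).
apply: measurable_funM => //; apply: measurable_funN; apply: measurableT_comp => //.
by apply: measurable_maxr.
Qed.

Let max01 (x : R) (v : R[i]) : 0 <= x < 1 -> unit_disc v -> 0 <= - ln (Num.max x (normc v)).
Proof. by move=> /andP[x0 x1] v1; rewrite oppr_ge0 ln_le0// ge_max !ltW. Qed.

Let JE (x : R) : 0 < x < 1 -> J x = (Sp * (1 - x ^+ n))%:E.
Proof.
move=> /andP[x0 x1].
have lx : 0 <= - ln x by rewrite oppr_ge0 ln_le0// ltW.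
have x01 : 0 <= x < 1 by rewrite ltW.
have p0 v : unit_disc v -> (0 <= (psi v)%:E)%E by move=> Dv; rewrite lee_fin; have /andP [] := psi01 Dv.
have w0 v : unit_disc v -> (0 <= (w v)%:E)%E by move=> Dv; rewrite lee_fin; have /andP [] := w01 Dv.
have mif (f : R[i] -> \bar R) : dmeas f -> dmeas (fun v : R[i] => if (normc v < x)%R then f v else 0%E).
  move=> mf; apply: measurable_fun_if => //; first exact: measurable_disc.
    apply: measurable_funTS; apply: measurable_fun_ltr; [exact: measurable_normc (@cmeasurable_cpt _)|exact: measurable_cst].
  by apply: measurable_funS mf; [exact: measurable_disc|exact: subIsetl].
have : (J x + dint (fun v : R[i] => if (normc v < x)%R then (psi v)%:E else 0) =
  dint (fun v => (psi v)%:E) + (- ln x)%:E * dint (fun v : R[i] => if (normc v < x)%R then (w v)%:E else 0))%E.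
  rewrite -dintZl//; [|exact: mif|by move=> v Dv; case: ifP => // _; exact: w0].
  rewrite -!dintD//.
  - apply: eq_dint => v Dv; rewrite /psi /w; have [vx|xv] := ltrP (normc v) x.
      by rewrite addeC -EFinM.
    by rewrite mule0.
  - exact: mif.
  - by move=> v Dv; rewrite lee_fin mulr_ge0 ?exprn_ge0 ?normc_ge0// max01.
  - by move=> v Dv; case: ifP => // _; exact: p0.
  - by apply: measurable_funeM; exact: (mif _ mw).
  - by move=> v Dv; rewrite mule_ge0 ?lee_fin//; case: ifP => // _; exact: w0.
rewrite dint_log_lt ?x0// dint_pow_lt ?x0// SE.
case: (J x) => [j||//]; last by [].
  move=> [e]; congr EFin; apply: (addIr (x ^+ n * (- ln x * Z + Sp))).
  by rewrite e; ring.
Qed.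

(** In polar coordinates this is the value of an elementary integral, with
    equality. Without them: [JE] gives [Sp (1 - x^n) <= - ln x * Z] for every
    [x < 1], and letting [x] tend to one yields [Sp n <= Z]. *)
Let log_mass_le : Sp * n%:R <= Z.
Proof.
have Z0 := radial_mass_gt0.
(* Divide by 1 - x, using - ln x <= (1 - x) / x on one side and the geometric sum on the other. *)
have key x : 0 < x < 1 -> Sp * (n%:R * x ^+ n.+1) <= Z.
  move=> /andP[x0 x1].
  have h : Sp * (1 - x ^+ n) <= - ln x * Z.
    rewrite -lee_fin -JE ?x0// EFinM -radial_massE -dintZl//; last 2 first.
    - by move=> v Dv; rewrite lee_fin exprn_ge0 ?normc_ge0.
    - by rewrite oppr_ge0 ln_le0// ltW.
    apply: le_dint => v Dv; rewrite ?lee_fin ?mulr_ge0 ?exprn_ge0 ?normc_ge0 ?max01 ?(ltW x0)//.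
    rewrite ler_wpM2r ?exprn_ge0 ?normc_ge0// lerN2 ler_ln ?posrE//.
      by rewrite le_max lexx.
    by rewrite lt_max x0.
  have lx : - ln x <= x^-1 - 1 by rewrite -lnV ?posrE// ln_le_sub1// invr_gt0.
  have h2 : Sp * (1 - x ^+ n) <= (x^-1 - 1) * Z.
    by apply: le_trans h _; rewrite ler_wpM2r// ltW.
  have h3 : (1 - x) * (n%:R * x ^+ n) <= 1 - x ^+ n.
    rewrite -[X in _ <= X - _](expr1n _ n) subrXX ler_wpM2l ?subr_ge0 ?(ltW x1)//.
    rewrite mulr_natl -[X in _ *+ X](card_ord n) -sumr_const ler_sum// => i _.
    by rewrite expr1n mul1r ler_wiXn2l ?(ltW x0) ?(ltW x1)// ltnW.
  have h4 : Sp * ((1 - x) * (n%:R * x ^+ n)) <= (x^-1 - 1) * Z.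
    by apply: le_trans h2; rewrite ler_wpM2l.
  have h5 : (x^-1 - 1) * x = 1 - x by field; rewrite gt_eqF.
  have : (1 - x) * (Sp * (n%:R * x ^+ n.+1)) <= (1 - x) * Z.
    have := ler_wpM2r (ltW x0) h4; rewrite [leRHS]mulrAC h5 exprS.
    by apply: le_trans; rewrite le_eqVlt; apply/orP; left; apply/eqP; ring.
  by rewrite ler_pM2l// subr_gt0.
apply/ler_addgt0Pl => e e0.
(* Let x = 1 - t tend to one; the loss is linear in t by Bernoulli. *)
pose d := Sp * n%:R * n.+1%:R + 1.
have d0 : 0 < d by rewrite /d ltr_pwDr// !mulr_ge0.
pose t := Num.min (2^-1) (e / d).
have t0 : 0 < t by rewrite lt_min invr_gt0 ltr0n divr_gt0.
have t1 : t < 1 by rewrite gt_min; apply/orP; left; rewrite invf_lt1// ltr1n.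
have := key (1 - t); rewrite subr_gt0 t1 gtrBl t0 => /(_ isT) h.
have B : 1 - n.+1%:R * t <= (1 - t) ^+ n.+1.
  elim: (n.+1) => [|j IH]; first by rewrite mul0r subr0 expr0.
  rewrite exprS; apply: le_trans (ler_wpM2l _ IH); last by rewrite subr_ge0 ltW.
  rewrite -natr1; have : 0 <= j%:R * t ^+ 2 by rewrite mulr_ge0 ?sqr_ge0.
  by rewrite -subr_ge0; lra.
have h2 : Sp * n%:R * (1 - n.+1%:R * t) <= Z.
  by apply: le_trans h; rewrite mulrA ler_wpM2l ?mulr_ge0.
have h3 : t * d <= e by rewrite -ler_pdivlMr// ge_min lexx orbT.
by move: h2 h3; rewrite /d; lra.
Qed.

(** The radial average of [- ln max(x, r)], which after exponentiation becomes
    the penalty [exp(- p (1 - x^N) / N)], [N = k + 2], of a zero of modulus [x]. *)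
Lemma dint_ln_max (x : R) : 0 <= x < 1 ->
  (dint (fun v : R[i] => (- ln (Num.max x (normc v)) * normc v ^+ k)%:E) <=
   (Z * (1 - x ^+ k.+2) / k.+2%:R)%:E)%E.
Proof.
move=> /andP[x0 x1].
have Sn : Sp <= Z / n%:R by rewrite ler_pdivlMr ?ltr0n.
move: x0; rewrite le_eqVlt => /predU1P[<-|x0].
  rewrite expr0n subr0 mulr1 (eq_dint (g := fun v => (psi v)%:E)) ?SE ?lee_fin//.
  by move=> v _; rewrite max_r ?normc_ge0.
rewrite [X in (X <= _)%E](JE (x := x)) ?x0// lee_fin mulrAC ler_wpM2r//.
by rewrite subr_ge0 exprn_ile1 ?ltW.
Qed.

End Radial.

Section BoundaryPenalty.
Variable R : realType.
Local Open Scope complex_scope.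
Local Notation K := (fine (disc_area R)).

(** The annulus has area proportional to [1 - (1 - s)^2 <= 2 s]. *)
Lemma dint_annulus (s : R) : 0 < s <= 1 ->
  (dint (fun v : R[i] => if (normc v < 1 - s)%R then 0 else 1) <= (2 * s * K)%:E)%E.
Proof.
move=> /andP[s0]; have K0 := fine_disc_area_gt0 R; rewrite le_eqVlt => /predU1P[->|s1].
  apply: (@le_trans _ _ (dint (fun=> 1%:E : \bar R))).
    by apply: le_dint => v _; case: ifP => _; rewrite ?lee_fin.
  by rewrite -/(disc_area R) disc_area_fine lee_fin; lra.
have e : (dint (fun v : R[i] => if (normc v < 1 - s)%R then 1 else 0) +
   dint (fun v : R[i] => if (normc v < 1 - s)%R then 0 else 1) = K%:E)%E.
  rewrite -dintD; [|exact: dmeas_if_lt|exact: dmeas_if_lt|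
    by move=> v _; case: ifP => _; rewrite ?lee_fin..].
  by rewrite -disc_area_fine; apply: eq_dint => v _; case: ifP => _; rewrite ?adde0 ?add0e.
move: e; rewrite dint_disc_radius; last by lra.
rewrite disc_area_fine; case: (dint _) => [j [e]|//|//].
by rewrite lee_fin; nra.
Qed.

(** The logarithm is bounded by [ln 2] times the number of dyadic annuli
    [1 - 2^-j <= |v|] containing [v], and their areas form a geometric series. *)
Lemma dint_boundary_log : exists2 L : R, 0 <= L &
  (dint (fun v : R[i] => (- ln (1 - normc v))%:E) <= L%:E)%E.
Proof.
have K0 := fine_disc_area_gt0 R; have l2 : 0 < ln (2 : R) by rewrite ln_gt0// ltr1n.
exists (4 * K * ln 2); first by rewrite !mulr_ge0// ltW.
(* Indicator of the j-th dyadic annulus. *)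
pose c j (v : R[i]) : R := if normc v < 1 - 2^-1 ^+ j then 0 else 1.
have h01 j : 0 < (2^-1 : R) ^+ j <= 1.
  by rewrite exprn_gt0//= exprn_ile1// invf_le1// ler1n.
have c0 j v : 0 <= c j v by rewrite /c; case: ifP.
have mc j : dmeas (fun v => (c j v)%:E).
  have := @dmeas_if_lt R (1 - 2^-1 ^+ j) 0%:E 1%:E.
  by congr dmeas; apply/funext => v; rewrite /c; case: ifP.
have cE n t v : 2^-1 ^+ n < t -> t <= 1 -> normc v = 1 - t ->
    - ln t <= ln 2 * \sum_(j < n) c j v.
  elim: n t => [|n IH] t; first by rewrite expr0 => /lt_le_trans h/h; rewrite ltxx.
  move=> nt t1 vt; rewrite big_ord_recr /=.
  have t0 : 0 < t by apply: le_lt_trans nt; rewrite exprn_ge0.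
  have [lt|lt] := ltrP (2^-1 ^+ n) t.
    by apply: le_trans (IH t lt t1 vt) _; rewrite ler_wpM2l ?(ltW l2)// lerDl.
  have ci (j : 'I_n.+1) : c j v = 1.
    rewrite /c vt ifF//; apply/negbTE; rewrite -leNgt lerD2l lerN2.
    by apply: le_trans lt _; rewrite ler_wiXn2l ?invf_le1 ?ler1n// -ltnS.
  have -> : \sum_(j < n) c j v + c n v = n.+1%:R.
    rewrite (ci ord_max) (eq_bigr (fun=> 1)) => [|j _]; last exact: (ci (widen_ord (leqnSn n) j)).
    by rewrite sumr_const card_ord natr1.
  rewrite -lnV ?posrE// mulrC mulr_natl -lnXn//.
  rewrite ler_ln ?posrE ?invr_gt0 ?exprn_gt0// ltW//.
  by rewrite -[X in _ < X]invrK -exprVn ltf_pV2 ?posrE ?exprn_gt0.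
pose G n v := (ln 2 * \sum_(j < n) c j v)%:E.
have mG n : dmeas (G n).
  rewrite /G; apply/measurable_EFinP; apply: measurable_funM => //.
  by apply: measurable_sum => j; apply/measurable_EFinP; exact: mc.
apply: (dint_fatou (rs := [::]) (G := G)) => //.
- by move=> n v _; rewrite lee_fin mulr_ge0 ?(ltW l2) ?sumr_ge0.
- apply: (@measurable_radial _ (fun r => - ln (1 - r))); apply: measurable_funN.
  by apply: (measurableT_comp (@measurable_ln R)); exact: measurable_funB.
- move=> v v1; rewrite lee_fin oppr_ge0 ln_le0// gerBl normc_ge0//.
- move=> v v1 _.
  exists (fun n => if 2^-1 ^+ n < 1 - normc v then (- ln (1 - normc v))%:E else 0%E).
    move=> n; case: ifPn => [lt|_]; rewrite /G lee_fin.
      by apply: cE => //; rewrite ?gerBl ?normc_ge0//; lra.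
    by rewrite mulr_ge0 ?(ltW l2) ?sumr_ge0.
  apply: cvg_near_cst.
  have t0 : 0 < 1 - normc v by rewrite subr_gt0.
  have := @cvg_expr R 2^-1; rewrite ger0_norm// invf_lt1// ltr1n => /(_ isT).
  move=> /cvgrPdist_lt /(_ _ t0); apply: filterS => n.
  by rewrite sub0r normrN ger0_norm ?exprn_ge0// => ->.
- move=> n; rewrite /G.
  under eq_dint do rewrite EFinM -sumEFin.
  rewrite dintZl; last 3 first.
  + by apply: emeasurable_sum => j; exact: mc.
  + by move=> v _; apply: sume_ge0 => j _; rewrite lee_fin.
  + exact: ltW.
  rewrite mulrC EFinM lee_wpmul2l ?lee_fin ?(ltW l2)//.
  rewrite /dint ge0_integral_sum//; last 3 first.
  + exact: measurable_disc.
  + by move=> j; exact: mc.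
  + by move=> j u _; rewrite lee_fin.
  apply: (@le_trans _ _ (\sum_(j < n) (2 * 2^-1 ^+ j * K)%:E)%E).
    apply: lee_sum => j _; apply: le_trans (dint_annulus (h01 j)).
    rewrite -[X in (X <= _)%E]/(dint (fun v => (c j v)%:E)).
    by apply: le_dint => v _; rewrite ?lee_fin// /c; case: ifP.
  rewrite sumEFin lee_fin -mulr_suml ler_wpM2r ?(ltW K0)// -mulr_sumr.
  rewrite -ler_pdivlMl//.
  have : (1 - 2^-1) * \sum_(j < n) (2^-1 : R) ^+ j = 1 - 2^-1 ^+ n.
    by rewrite -[X in _ = X - _](expr1n _ n) subrXX; congr (_ * _); apply: eq_bigr => j _; rewrite expr1n mul1r.
  have := h01 n; lra.
Qed.

(** Jensen's inequality for the exponential: if [X] has mean at most [T] for a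
    mass [Z], then [exp(-X)] has integral at least [Z exp(-T)]. Here [X] is the
    sum of the logarithms of the factors, and the factor [(1 - |v|)^M]
    contributes a constant to [T] by [dint_boundary_log]. *)
Theorem radial_jensen (k M : nat) (p : R) : (1 < k)%N -> 0 < p ->
  exists2 c : R, 0 < c & forall s : seq R, all (fun x => 0 <= x < 1) s ->
  ((c * \prod_(x <- s) expR (- (p * (1 - x ^+ k.+2) / k.+2%:R)))%:E <=
   dint (fun v : R[i] => ((`|1 - normc v| ^+ M * `|normc v| ^+ k) * \prod_(x <- s) Num.max x (normc v) `^ p)%:E))%E.
Proof.
move=> k2 p0; have [L L0 pen] := dint_boundary_log.
have Z0 := @radial_mass_gt0 R k; set Z := radial_mass R k in Z0 *.
exists (Z * expR (- (M%:R * L / Z))); first by rewrite mulr_gt0 ?expR_gt0.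
move=> s s01.
pose q (v : R[i]) : R := normc v ^+ k.
pose X v := \sum_(x <- s) p * - ln (Num.max x (normc v)) + M%:R * - ln (1 - normc v).
pose T := \sum_(x <- s) p * (1 - x ^+ k.+2) / k.+2%:R + M%:R * L / Z.
have T0 : 0 <= T.
  rewrite addr_ge0//; last by rewrite divr_ge0 ?mulr_ge0 ?(ltW Z0).
  rewrite big_seq sumr_ge0// => x /(allP s01)/andP[x0 x1].
  by rewrite divr_ge0// mulr_ge0 ?(ltW p0)// subr_ge0 exprn_ile1 ?(ltW x1)//.
have q0 v : 0 <= q v by rewrite exprn_ge0 ?normc_ge0.
have lnm0 v x : unit_disc v -> x \in s -> 0 <= - ln (Num.max x (normc v)).
  move=> v1 /(allP s01)/andP[x0 x1].
  by rewrite oppr_ge0 ln_le0// ge_max !ltW.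
have ln10 (v : R[i]) : unit_disc v -> 0 <= - ln (1 - normc v).
  by move=> v1; rewrite oppr_ge0 ln_le0// gerBl normc_ge0.
have X0 v : unit_disc v -> 0 <= X v.
  move=> v1; rewrite addr_ge0 ?mulr_ge0 ?ln10//.
  by rewrite big_seq sumr_ge0// => x xs; rewrite mulr_ge0 ?(ltW p0) ?lnm0.
have expT : Z * expR (- T) = Z * expR (- (M%:R * L / Z)) * \prod_(x <- s) expR (- (p * (1 - x ^+ k.+2) / k.+2%:R)).
  by rewrite -mulrA; congr (_ * _); rewrite -expR_sum -expRD sumrN /T opprD addrC.
rewrite -expT.
have mq : dmeas (fun v => (q v)%:E) by apply: (@measurable_radial _ (fun r => r ^+ k)); exact: measurable_funX.
have mmax x : measurable_fun setT (fun r : R => - ln (Num.max x r)).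
  by apply: measurable_funN; apply: (measurableT_comp (@measurable_ln R)); exact: measurable_maxr.
have mln : measurable_fun setT (fun r : R => - ln (1 - r)).
  by apply: measurable_funN; apply: (measurableT_comp (@measurable_ln R)); exact: measurable_funB.
pose Xr (r : R) := \sum_(x <- s) p * - ln (Num.max x r) + M%:R * - ln (1 - r).
have mXr : measurable_fun setT Xr.
  apply: measurable_funD; last by apply: measurable_funM.
  by apply: measurable_sum => x; exact: measurable_funM.
have mX : dmeas (fun v => (X v * q v)%:E).
  by apply: (@measurable_radial _ (fun r => Xr r * r ^+ k)); apply: measurable_funM => //; exact: measurable_funX.
have B : (dint (fun v => (X v * q v)%:E) <= (T * Z)%:E)%E.
  rewrite (eq_dint (g := fun v => ((\sum_(x <- s) p * - ln (Num.max x (normc v))) * q v)%:E + (M%:R * (- ln (1 - normc v) * q v))%:E)%E); last first.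
    by move=> v _; rewrite -EFinD [in RHS]mulrA -mulrDl.
  rewrite dintD; last 4 first.
  - apply: (@measurable_radial _ (fun r => (\sum_(x <- s) p * - ln (Num.max x r)) * r ^+ k)).
    apply: measurable_funM; last exact: measurable_funX.
    by apply: measurable_sum => x; exact: measurable_funM.
  - apply: (@measurable_radial _ (fun r => M%:R * (- ln (1 - r) * r ^+ k))).
    by apply: measurable_funM => //; apply: measurable_funM => //; exact: measurable_funX.
  - move=> v v1; rewrite lee_fin mulr_ge0// big_seq sumr_ge0// => x xs.
    by rewrite mulr_ge0 ?(ltW p0) ?lnm0.
  - by move=> v v1; rewrite lee_fin !mulr_ge0 ?ln10.
  have -> : T * Z = (\sum_(x <- s) p * (1 - x ^+ k.+2) / k.+2%:R) * Z + M%:R * L.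
    by rewrite /T mulrDl divfK ?gt_eqF.
  rewrite EFinD; apply: leeD; last first.
    under eq_dint do rewrite EFinM.
    rewrite dintZl//; last 2 first.
    - apply: (@measurable_radial _ (fun r => - ln (1 - r) * r ^+ k)).
      by apply: measurable_funM => //; exact: measurable_funX.
    - by move=> v v1; rewrite lee_fin mulr_ge0 ?ln10.
    rewrite EFinM lee_wpmul2l ?lee_fin//; apply: le_trans pen; apply: le_dint => v v1.
      by rewrite lee_fin mulr_ge0 ?ln10.
    by rewrite lee_fin ler_piMr ?ln10// exprn_ile1 ?normc_ge0// ltW.
  elim: s s01 lnm0 {X T T0 X0 expT Xr mXr mX} => [_ _|x s IH /= /andP[x01 s01] lnm0].
    rewrite big_nil mul0r (eq_dint (g := fun=> 0%:E)) ?dint_cst ?mul0e//.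
    by move=> v _; rewrite big_nil mul0r.
  have lnm v : unit_disc v -> 0 <= - ln (Num.max x (normc v)).
    by move=> v1; apply: lnm0; rewrite ?mem_head.
  have lnms v y : unit_disc v -> y \in s -> 0 <= - ln (Num.max y (normc v)).
    by move=> v1 ys; apply: lnm0; rewrite // inE ys orbT.
  rewrite (eq_dint (g := fun v => (p%:E * (- ln (Num.max x (normc v)) * q v)%:E + ((\sum_(x <- s) p * - ln (Num.max x (normc v))) * q v)%:E)%E)); last first.
    by move=> v _; rewrite big_cons -EFinM -EFinD mulrDl mulrA.
  rewrite dintD; last 4 first.
  - apply: measurable_funeM; apply: (@measurable_radial _ (fun r => - ln (Num.max x r) * r ^+ k)).
    by apply: measurable_funM => //; exact: measurable_funX.
  - apply: (@measurable_radial _ (fun r => (\sum_(x <- s) p * - ln (Num.max x r)) * r ^+ k)).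
    apply: measurable_funM; last exact: measurable_funX.
    by apply: measurable_sum => y; exact: measurable_funM.
  - by move=> v v1; rewrite mule_ge0 ?lee_fin ?(ltW p0)// mulr_ge0// lnm.
  - move=> v v1; rewrite lee_fin mulr_ge0// big_seq sumr_ge0// => y ys.
    by rewrite mulr_ge0 ?(ltW p0) ?lnms.
  rewrite big_cons mulrDl EFinD; apply: leeD; last exact: IH.
  rewrite dintZl ?(ltW p0)//; last 2 first.
  - apply: (@measurable_radial _ (fun r => - ln (Num.max x r) * r ^+ k)).
    by apply: measurable_funM => //; exact: measurable_funX.
  - by move=> v v1; rewrite lee_fin mulr_ge0 ?lnm.
  have -> : p * (1 - x ^+ k.+2) / k.+2%:R * Z = p * (Z * (1 - x ^+ k.+2) / k.+2%:R) by ring.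
  by rewrite EFinM lee_wpmul2l ?lee_fin ?(ltW p0)//; exact: dint_ln_max.
set A := dint _.
have AE : A = dint (fun v => (expR (- X v) * q v)%:E).
  apply: eq_dint => v v1; congr EFin; have [v0|v0] := ltrP 0 (normc v); last first.
    have v00 : normc v = 0 by apply/eqP; rewrite eq_le v0 normc_ge0.
    by rewrite /q v00 normr0; case: (k) k2 => // j _; rewrite !expr0n/= !mulr0 mul0r.
  rewrite /q (ger0_norm (normc_ge0 v)) mulrAC; congr (_ * _).
  rewrite ger0_norm ?subr_ge0 ?(ltW v1)// /X opprD expRD mulrC; congr (_ * _).
    rewrite -sumrN expR_sum; apply: eq_bigr => x _.
    by rewrite mulrN opprK /powR ifF//; apply/negbTE; rewrite gt_eqF// lt_max v0 orbT.
  by rewrite mulrN opprK mulr_natl -lnXn ?subr_gt0// lnK// posrE exprn_gt0 ?subr_gt0.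
have mA : dmeas (fun v => (expR (- X v) * q v)%:E).
  apply: (@measurable_radial _ (fun r => expR (- Xr r) * r ^+ k)).
  apply: measurable_funM; last exact: measurable_funX.
  by apply: measurableT_comp => //; exact: measurable_funN.
(* Integrate the tangent inequality exp(- X) >= exp(- T) (1 + T - X). *)
have C : ((expR (- T) * (1 + T) * Z)%:E <= A + (expR (- T))%:E * dint (fun v => (X v * q v)%:E))%E.
  rewrite AE -dintZl ?expR_ge0//; last by move=> v v1; rewrite lee_fin mulr_ge0 ?X0.
  rewrite -dintD//; last 3 first.
  - exact: measurable_funeM.
  - by move=> v v1; rewrite lee_fin mulr_ge0 ?expR_ge0.
  - by move=> v v1; rewrite mule_ge0 ?lee_fin ?expR_ge0 ?mulr_ge0 ?X0.
  have eT0 : 0 <= expR (- T) * (1 + T) by exact: mulr_ge0 (expR_ge0 _) (addr_ge0 ler01 T0).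
  rewrite EFinM -radial_massE -dintZl//; last first.
    by move=> v v1; rewrite lee_fin; exact: q0.
  apply: le_dint => v v1; first by rewrite lee_fin (mulr_ge0 eT0)//; exact: q0.
  rewrite -/(q v) lee_fin mulrA -mulrDl ler_wpM2r//.
  have := expR_ge1Dx (T - X v) => h.
  have := ler_wpM2l (expR_ge0 (- T)) h; rewrite -expRD addKr.
  by rewrite -subr_ge0 => h'; rewrite -subr_ge0; move: h'; lra.
have A0 : (0 <= A)%E by rewrite AE; apply: dint_ge0 => v _; rewrite lee_fin mulr_ge0 ?expR_ge0.
have B0 : (0 <= dint (fun v => (X v * q v)%:E))%E.
  by apply: dint_ge0 => v v1; rewrite lee_fin mulr_ge0 ?X0.
move: A0 B0 B C; case: A {AE} => [A||] // A0; last by rewrite leey.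
case: (dint _) => [B||] // B0; rewrite ?leNgt ?ltry// -?leNgt !lee_fin => BT C.
have := ler_wpM2l (expR_ge0 (- T)) BT; lra.
Qed.

End BoundaryPenalty.

(** * Automorphisms of the disc and invariant weights *)

Section MobiusAlgebra.
Variable R : realType.
Local Open Scope complex_scope.
Implicit Types a b x y z v w : R[i].

Lemma sqr_normcE z : ((normc z) ^+ 2)%:C = z * z^*%C.
Proof.
case: z => p q; rewrite /= sqr_sqrtr ?addr_ge0 ?sqr_ge0//.
by simpc; congr (_ +i* _); ring.
Qed.

Lemma conjcB x y : (x - y)^*%C = x^*%C - y^*%C. Proof. exact: rmorphB. Qed.
Lemma conjcM x y : (x * y)^*%C = x^*%C * y^*%C. Proof. exact: rmorphM. Qed.
Lemma realcB (r s : R) : (r - s)%:C = r%:C - s%:C. Proof. exact: rmorphB. Qed.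
Lemma realcM (r s : R) : (r * s)%:C = r%:C * s%:C. Proof. exact: rmorphM. Qed.

(** The identity behind all facts on automorphisms of the disc. *)
Lemma mobius_norm_identity a z :
  normc (1 - a^*%C * z) ^+ 2 - normc (a - z) ^+ 2 = (1 - normc a ^+ 2) * (1 - normc z ^+ 2).
Proof.
have nE (p q : R) : normc (p +i* q) ^+ 2 = p ^+ 2 + q ^+ 2.
  by rewrite /= sqr_sqrtr ?addr_ge0 ?sqr_ge0.
case: a z => a1 a2 [z1 z2].
have -> : 1 - (a1 +i* a2)^*%C * (z1 +i* z2) =
    (1 - (a1 * z1 + a2 * z2)) +i* (- (a1 * z2 - a2 * z1)).
  by apply/eqP; rewrite eq_complex /=; apply/andP; split; apply/eqP; ring.
have -> : (a1 +i* a2) - (z1 +i* z2) = (a1 - z1) +i* (a2 - z2) by [].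
by rewrite !nE; ring.
Qed.

Lemma mobius_den_gt0 a z : normc a <= 1 -> unit_disc z -> 0 < normc (1 - a^*%C * z).
Proof.
move=> a1 z1; apply: lt_le_trans (ler_normcB _ _); rewrite normc1 subr_gt0 normcM normc_conj.
by apply: le_lt_trans z1; rewrite ler_piMl ?normc_ge0.
Qed.

Lemma mobius_den_neq0 a z : normc a <= 1 -> unit_disc z -> 1 - a^*%C * z != 0.
Proof. by move=> a1 z1; rewrite -normc_gt0 mobius_den_gt0. Qed.

Lemma normc_mobius a z : normc (mobius a z) = normc (a - z) / normc (1 - a^*%C * z).
Proof. by rewrite /mobius normcM normcV. Qed.

Lemma mobius_num_lt_den a z : unit_disc a -> unit_disc z ->
  normc (a - z) < normc (1 - a^*%C * z).
Proof.
rewrite !unit_discE => a1 z1.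
rewrite -(@ltr_pXn2r _ 2) ?nnegrE ?normc_ge0// -subr_gt0 mobius_norm_identity.
by rewrite mulr_gt0// subr_gt0 expr_lt1 ?normc_ge0.
Qed.

Lemma mobius_disc a z : unit_disc a -> unit_disc z -> unit_disc (mobius a z).
Proof.
move=> a1 z1; rewrite unit_discE normc_mobius ltr_pdivrMr ?mul1r ?mobius_num_lt_den//.
by apply: mobius_den_gt0 => //; exact: ltW.
Qed.

Lemma one_sub_sqr_mobius a z : unit_disc a -> unit_disc z ->
  1 - normc (mobius a z) ^+ 2 = (1 - normc a ^+ 2) * (1 - normc z ^+ 2) / normc (1 - a^*%C * z) ^+ 2.
Proof.
move=> a1 z1; rewrite -mobius_norm_identity normc_mobius expr_div_n mulrBl divff//.
by rewrite expf_neq0// gt_eqF// mobius_den_gt0// ltW.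
Qed.

(** The pseudohyperbolic distance is invariant under automorphisms. *)
Lemma mobius_invariant a x y : unit_disc a -> unit_disc x -> unit_disc y ->
  normc (mobius (mobius a x) (mobius a y)) = normc (mobius x y).
Proof.
move=> a1 x1 y1.
have dx := mobius_den_neq0 (ltW a1) x1; have dy := mobius_den_neq0 (ltW a1) y1.
have dxc : 1 - a * x^*%C != 0.
  by rewrite -conjc_eq0 conjcB conjcM conjc1 conjcK.
have dxy := mobius_den_neq0 (ltW x1) y1.
have daa : 1 - a * a^*%C != 0.
  rewrite -sqr_normcE -[1]/(1%:C) -realcB.
  apply/eqP => -[/eqP]; rewrite subr_eq0 eq_sym => /eqP e.
  by have := expr_lt1 (ltn0Sn 1) (normc_ge0 a); rewrite e a1 ltxx.
have num : mobius a x - mobius a y = (y - x) * (1 - a * a^*%C) / ((1 - a^*%C * x) * (1 - a^*%C * y)).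
  by rewrite /mobius; field; rewrite dx dy.
have den : 1 - (mobius a x)^*%C * mobius a y = (1 - x^*%C * y) * (1 - a * a^*%C) / ((1 - a * x^*%C) * (1 - a^*%C * y)).
  rewrite /mobius conjcM conjc_inv !conjcB conjcM conjc1 conjcK.
  by field; rewrite dxc dy.
rewrite !normc_mobius num den !(normcM, normcV) (normcB x y).
have -> : normc (1 - a * x^*%C) = normc (1 - a^*%C * x).
  by rewrite -normc_conj conjcB conjcM conjc1 conjcK.
field; rewrite !normc_eq0 dx dy dxy daa//.
Qed.

Lemma mobius0 a : mobius a 0 = a.
Proof. by rewrite /mobius mulr0 !subr0 divr1. Qed.

End MobiusAlgebra.

Section InvariantWeights.
Variable R : realType.
Local Open Scope complex_scope.
Variables (W : R[i] -> R) (Kw : R).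
Hypothesis W_gt0 : forall z, unit_disc z -> 0 < W z.
Hypothesis Kw1 : 1 <= Kw.
Hypothesis W_inv : forall a z, unit_disc a -> unit_disc z ->
  normc (mobius a z) < 2^-1 -> W a <= Kw * W z.

(** Harnack chain: [v] is joined to [0] by points at which [1 - |v|] grows by the
    factor 3/2, consecutive points being at pseudohyperbolic distance less than
    1/2; [mobius a] preserves these distances, so each step costs one factor
    [Kw]. *)
Let harnack_chain a n v : unit_disc a -> unit_disc v -> (2 / 3) ^+ n <= 1 - normc v ->
  W a <= Kw ^+ n * W (mobius a v).
Proof.
move=> a1; have K0 : 0 <= Kw by apply: le_trans Kw1.
elim: n v => [|n IH] v v1 nv.
  rewrite expr0 in nv; have v0 : v = 0.
    by apply/eqP; rewrite -normc_eq0 eq_le normc_ge0 andbT; lra.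
  by rewrite v0 mobius0 expr0 mul1r.
have step v' : unit_disc v' -> (2 / 3) ^+ n <= 1 - normc v' -> normc (mobius v' v) < 2^-1 ->
    W a <= Kw ^+ n.+1 * W (mobius a v).
  move=> v'1 nv' d; apply: le_trans (IH v' v'1 nv') _.
  rewrite exprSr -mulrA ler_wpM2l ?exprn_ge0//.
  by apply: W_inv; [exact: mobius_disc|exact: mobius_disc|rewrite mobius_invariant].
have v1' := v1; rewrite unit_discE in v1'; have v0 := normc_ge0 v.
have [lt|ge] := ltrP (normc v) (1 / 3).
  apply: (step 0); first by rewrite unit_discE normc0.
    by rewrite normc0 subr0 exprn_ile1//; lra.
  by rewrite normc_mobius conjc0 mul0r subr0 normc1 divr1 sub0r normcN; lra.
(* The next point of the chain on the segment from 0 to v. *)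
pose x' := 1 - (3 / 2) * (1 - normc v); pose t := x' / normc v.
have vn0 : normc v != 0 by rewrite gt_eqF//; lra.
have t0 : 0 <= t by rewrite divr_ge0// /x'; lra.
have nt : normc (t%:C * v) = x'.
  by rewrite normcM normc_real ger0_norm// /t divfK.
have x'0 : 0 <= x' by rewrite -nt normc_ge0.
apply: (step (t%:C * v)).
- by rewrite unit_discE nt /x'; lra.
- by rewrite nt /x'; move: nv; rewrite exprS; lra.
rewrite normc_mobius conjcM conjc_real -mulrA.
have -> : t%:C * v - v = (t - 1)%:C * v by rewrite realcB mulrBl mul1r.
have -> : 1 - t%:C * (v^*%C * v) = (1 - x' * normc v)%:C.
  by rewrite (mulrC v^*%C) -sqr_normcE -realcM -[1]/(1%:C) -realcB; congr (_%:C); rewrite /t; field.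
rewrite normcM !normc_real.
have p1 : 0 < 1 - x' * normc v by rewrite /x'; nra.
rewrite (gtr0_norm p1) ltr_pdivrMr//.
have -> : `|t - 1| * normc v = normc v - x'.
  rewrite ler0_norm; first by rewrite opprB mulrBl mul1r /t divfK.
  by rewrite /t subr_le0 ler_pdivrMr ?lt_def ?vn0// mul1r /x'; lra.
by rewrite /x'; nra.
Qed.

(** An invariant weight decreases at most like a power of the distance to the
    boundary; the number of steps in the chain is logarithmic in
    [1 / (1 - |v|)]. *)
Lemma weight_mobius_lower : exists (M : nat) (C : R), 0 < C /\
  forall a v, unit_disc a -> unit_disc v ->
    W a * (1 - normc v) ^+ M <= C * W (mobius a v).
Proof.
have K0 : 0 <= Kw by apply: le_trans Kw1.
have [M KM] : exists M, Kw <= (3 / 2) ^+ M.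
  have B j : 1 + j%:R / 2 <= (3 / 2 : R) ^+ j.
    elim: j => [|j IH]; first by rewrite mul0r addr0 expr0.
    by rewrite exprS -natr1; have : (0:R) <= j%:R by []; lra.
  exists (Num.truncn (2 * Kw)).+1; apply: le_trans (B _).
  have := truncnS_gt (2 * Kw); lra.
exists M, ((3 / 2) ^+ M); split; first by rewrite exprn_gt0//; lra.
move=> a v a1 v1.
have v1' := v1; rewrite unit_discE in v1'; have v0 := normc_ge0 v.
have ex : exists n, (2 / 3) ^+ n <= 1 - normc v.
  have t0 : 0 < 1 - normc v by rewrite subr_gt0.
  have := @cvg_expr R (2 / 3); rewrite ger0_norm; last by lra.
  have h23 : (2 / 3 : R) < 1 by lra.
  move=> /(_ h23) /cvgrPdist_lt /(_ _ t0) [n _ /(_ n (leqnn n))] /=.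
  rewrite sub0r normrN ger0_norm; last by rewrite exprn_ge0//; lra.
  by move=> /ltW; exists n.
case: (ex_minnP ex) => n nv nmin.
have Wm := W_gt0 (mobius_disc a1 v1).
have h : Kw ^+ n * (1 - normc v) ^+ M <= (3 / 2) ^+ M.
  case: n nv nmin => [|n] nv nmin.
    rewrite expr0 mul1r; apply: (@le_trans _ _ 1); first by rewrite exprn_ile1//; lra.
    by rewrite exprn_ege1//; lra.
  have lt : 1 - normc v <= (2 / 3) ^+ n.
    by rewrite ltW// ltNge; apply/negP => /nmin; rewrite ltnn.
  apply: (@le_trans _ _ (((3 / 2) ^+ M) ^+ n.+1 * ((2 / 3) ^+ n) ^+ M)).
    apply: ler_pM; rewrite ?exprn_ge0//; try lra.
      by rewrite lerXn2r ?nnegrE ?exprn_ge0//; lra.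
    by rewrite lerXn2r ?nnegrE ?exprn_ge0//; lra.
  rewrite exprS -mulrA -(exprM (2/3)) mulnC exprM -exprMn -exprMn.
  by rewrite (_ : 3 / 2 * (2 / 3) = 1) ?expr1n ?mulr1//; lra.
apply: le_trans (ler_wpM2r _ (harnack_chain a1 v1 nv)) _; first by rewrite exprn_ge0//; lra.
by rewrite mulrAC ler_wpM2r// ltW.
Qed.

End InvariantWeights.

(** * Mean value inequalities for polynomials *)

Section Submean.
Variable R : realType.
Local Notation PT := (measurableTypeR R * measurableTypeR R)%type.
Local Notation K := (fine (disc_area R)).
Implicit Types (a b z v w : R[i]) (ws : seq R[i]).

Definition root_prod (c : R[i]) ws z := c * \prod_(w <- ws) (z - w).

Lemma poly_root_prod (q : {poly R[i]}) : exists c ws, forall z, q.[z] = root_prod c ws z.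
Proof.
have [ws qE] := closed_field_poly_normal q; exists (lead_coef q), ws => z.
rewrite {1}qE hornerZ horner_prod /root_prod; congr (_ * _).
by apply: eq_bigr => w _; rewrite hornerXsubC.
Qed.

Lemma cmeasurable_root_prod c ws : cmeasurable (fun u : PT => root_prod c ws (cpt u)).
Proof.
apply: cmeasurableM; first exact: cmeasurable_cst.
elim: ws => [|w ws IH].
  rewrite [X in cmeasurable X](_ : _ = fun=> 1); first exact: cmeasurable_cst.
  by apply/funext => u; rewrite big_nil.
rewrite [X in cmeasurable X](_ : _ = fun u => (cpt u - w) * \prod_(w <- ws) (cpt u - w)).
  apply: cmeasurableM => //; apply: cmeasurableB; [exact: cmeasurable_cpt|exact: cmeasurable_cst].
by apply/funext => u; rewrite big_cons.
Qed.

Lemma normc_root_prod c ws z : normc (root_prod c ws z) = normc c * \prod_(w <- ws) normc (z - w).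
Proof. by rewrite /root_prod normcM normc_prod. Qed.

Lemma measurable_root_prod_powR c ws s :
  measurable_fun setT (fun u : PT => normc (root_prod c ws (cpt u)) `^ s).
Proof. by apply: measurable_powR_comp; apply: measurable_normc; exact: cmeasurable_root_prod. Qed.

(** Subharmonicity of [|q|^s]: [circular_mean] with [a = 0] and a constant radial
    weight, each [circ_max] being at least its value at the centre. *)
Lemma submean (c : R[i]) ws b (r s : R) : 0 < s -> 0 < r ->
  (forall v, normc v < 1 -> unit_disc (b + r%:C%C * v)) ->
  ((r ^+ 2 * K * normc (root_prod c ws b) `^ s)%:E <=
   dint (fun u => if (normc (u - b) < r)%R then (normc (root_prod c ws u) `^ s)%:E else 0%E))%E.
Proof.
move=> s0 r0 bD; rewrite dint_affine//; last first.
- by move=> v _; rewrite lee_fin powR_ge0.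
- by apply: dmeasT; apply/measurable_EFinP; exact: measurable_root_prod_powR.
rewrite -mulrA EFinM lee_wpmul2l ?lee_fin ?sqr_ge0//.
pose ps := [seq (b - w, - r%:C%C) | w <- ws].
have E v : normc (root_prod c ws (b + r%:C%C * v)) `^ s =
    normc c `^ s * \prod_(x <- ps) mobius_fac 0 x v `^ s.
  rewrite normc_root_prod powRM ?normc_ge0 ?prodr_ge0//; last by move=> ? _; exact: normc_ge0.
  congr (_ * _); rewrite powR_prod => [|w]; last exact: normc_ge0.
  have den : normc (1 - (0 : R[i])^*%C * v) = 1 by rewrite conjc0 mul0r subr0 normc1.
  rewrite big_map; apply: eq_bigr => w _; rewrite /mobius_fac den divr1.
  by rewrite [_.1]/= [_.2]/= mulNr opprK addrAC.
rewrite (eq_dint (g := fun v => (normc c `^ s * \prod_(x <- ps) mobius_fac 0 x v `^ s)%:E)); last first.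
  by move=> v _; rewrite E.
have := @circular_mean R ps 0 s (fun=> normc c `^ s) s0.
rewrite normc0 => /(_ (ltW ltr01) (fun _ => powR_ge0 _ _) (measurable_cst _)).
apply: le_trans.
rewrite mulrC EFinM -disc_area_fine -dint_cst ?powR_ge0//.
apply: le_dint => v _; rewrite lee_fin ?powR_ge0//.
rewrite normc_root_prod powRM ?normc_ge0 ?prodr_ge0//; last by move=> ? _; exact: normc_ge0.
rewrite ler_wpM2l ?powR_ge0// powR_prod => [|w]; last exact: normc_ge0.
rewrite big_map; apply: ler_prod => w _; rewrite powR_ge0/=.
by apply: ge0_ler_powR; rewrite ?nnegrE ?normc_ge0 ?circ_max_ge0 ?(ltW s0)// /circ_max /= le_max lexx.
Qed.

(** Modulus of the zero-free part of [z - w] on the disc. *)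
Definition outer_abs w z := if normc w < 1 then normc (1 - w^*%C * z) else normc (z - w).
(** Modulus of the Blaschke factor of [w], or 1 when [w] is not in the disc. *)
Definition inner_abs w z := if normc w < 1 then normc (z - w) / normc (1 - w^*%C * z) else 1.

Lemma outer_abs_ge0 w z : 0 <= outer_abs w z. Proof. by rewrite /outer_abs; case: ifP => _; exact: normc_ge0. Qed.
Lemma inner_abs_ge0 w z : 0 <= inner_abs w z.
Proof. by rewrite /inner_abs; case: ifP => _//; rewrite divr_ge0 ?normc_ge0. Qed.

Lemma inner_abs_lt1 w z : normc w < 1 -> unit_disc z -> inner_abs w z < 1.
Proof.
move=> w1 z1; rewrite /inner_abs w1 ltr_pdivrMr ?mul1r; last by apply: mobius_den_gt0 => //; exact: ltW.
by rewrite normcB mobius_num_lt_den.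
Qed.

Lemma inner_abs_le1 w z : unit_disc z -> inner_abs w z <= 1.
Proof.
move=> z1; have [w1|w1] := ltrP (normc w) 1; first by rewrite ltW// inner_abs_lt1.
by rewrite /inner_abs ltNge w1.
Qed.

Lemma outer_inner_abs w z : unit_disc z -> outer_abs w z * inner_abs w z = normc (z - w).
Proof.
move=> z1; rewrite /outer_abs /inner_abs; case: ifPn => w1; last by rewrite mulr1.
by rewrite mulrC divfK// gt_eqF// mobius_den_gt0// ltW.
Qed.

(** [circular_mean] moves the zeros by [mobius a], [radial_jensen] averages over
    the radius; zeros outside the disc have [inner_abs] equal to 1 and carry no
    penalty. *)
Theorem weighted_mean_lower (k M : nat) (p : R) : (1 < k)%N -> 0 < p ->
  exists2 c0 : R, 0 < c0 & forall c ws a, unit_disc a ->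
    ((c0 * (normc c `^ p * \prod_(w <- ws) (outer_abs w a `^ p *
          expR (- (p * (1 - inner_abs w a ^+ k.+2) / k.+2%:R)))))%:E <=
     dint (fun v => (`|1 - normc v| ^+ M * `|normc v| ^+ k * normc (root_prod c ws (mobius a v)) `^ p)%:E))%E.
Proof.
move=> k2 p0; have [c0 c00 J] := @radial_jensen R k M p k2 p0.
exists c0 => // c ws a a1.
pose ps := [seq (a - w, 1 - w * a^*%C) | w <- ws].
pose rho0 (r : R) := `|1 - r| ^+ M * `|r| ^+ k.
pose rho r := normc c `^ p * rho0 r.
have rho00 r : 0 <= rho0 r by rewrite mulr_ge0// exprn_ge0.
have mrho0 : measurable_fun setT rho0.
  apply: measurable_funM; apply: measurable_funX; last exact: normr_measurable.
  by apply: (measurableT_comp (@normr_measurable R setT)); exact: measurable_funB.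
rewrite (eq_dint (g := fun v => (rho (normc v) * \prod_(x <- ps) mobius_fac a x v `^ p)%:E)); last first.
  move=> v v1; congr EFin; rewrite /rho /rho0 -[RHS]mulrA [RHS]mulrCA; congr (_ * _).
  rewrite normc_root_prod powRM ?normc_ge0 ?prodr_ge0//; last by move=> ? _; exact: normc_ge0.
  congr (_ * _); rewrite powR_prod => [|w]; last exact: normc_ge0.
  rewrite big_map; apply: eq_bigr => w _; congr (_ `^ _).
  rewrite /mobius_fac /= -normcV -normcM; congr normc.
  by rewrite /mobius; field; exact: mobius_den_neq0 (ltW a1) v1.
have := @circular_mean R ps a p rho p0 (ltW a1).
have rho_ge0 r : 0 <= rho r by rewrite mulr_ge0 ?powR_ge0.
move=> /(_ rho_ge0); have mrho : measurable_fun setT rho by exact: measurable_funM.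
move=> /(_ mrho); apply: le_trans.
pose S := [seq inner_abs w a | w <- ws & normc w < 1].
have S01 : all (fun x => 0 <= x < 1) S.
  apply/allP => x /mapP[w]; rewrite mem_filter => /andP[w1 _] ->.
  by rewrite inner_abs_ge0 inner_abs_lt1.
have P0 : 0 <= normc c `^ p * \prod_(w <- ws) outer_abs w a `^ p.
  by rewrite mulr_ge0 ?powR_ge0// prodr_ge0// => w _; exact: powR_ge0.
apply: (@le_trans _ _ (dint (fun v => (normc c `^ p * \prod_(w <- ws) outer_abs w a `^ p)%:E *
    (rho0 (normc v) * \prod_(x <- S) Num.max x (normc v) `^ p)%:E)%E)); last first.
  apply: le_dint => v v1.
    rewrite -EFinM lee_fin mulr_ge0// mulr_ge0//.
    by rewrite prodr_ge0// => x _; exact: powR_ge0.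
  rewrite -EFinM lee_fin mulrACA -/(rho (normc v)) ler_wpM2l//.
  rewrite /S /ps !big_map big_filter [X in _ * X]big_mkcond -big_split /=.
  apply: ler_prod => w _; apply/andP; split.
    by rewrite mulr_ge0 ?powR_ge0//; case: ifP => _//; exact: powR_ge0.
  rewrite /circ_max /=; case: ifPn => w1; last first.
    rewrite mulr1; apply: ge0_ler_powR; rewrite ?nnegrE ?outer_abs_ge0 ?(ltW p0)//.
      by rewrite le_max normc_ge0.
    by rewrite /outer_abs (negbTE w1) le_max lexx.
  have e : normc (1 - w * a^*%C) = outer_abs w a.
    by rewrite /outer_abs w1 -normc_conj conjcB conjcM conjc1 conjcK.
  rewrite e -(outer_inner_abs w a1) -maxr_pMr ?outer_abs_ge0// powRM ?outer_abs_ge0//.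
  by rewrite le_max inner_abs_ge0.
rewrite dintZl//; last 2 first.
- apply: (@measurable_radial _ (fun r => rho0 r * \prod_(x <- S) Num.max x r `^ p)).
  apply: measurable_funM => //; apply: measurable_prodR => x; apply: measurable_powR_comp.
  exact: measurable_maxr.
- by move=> v v1; rewrite lee_fin mulr_ge0// prodr_ge0// => x _; exact: powR_ge0.
apply: (le_trans _ (lee_wpmul2l _ (J S S01))); last by rewrite lee_fin.
rewrite -EFinM lee_fin [leRHS]mulrCA ler_wpM2l ?(ltW c00)//.
rewrite big_split /= mulrA ler_wpM2l//.
rewrite /S big_map big_filter [X in _ <= X]big_mkcond /=; apply: ler_prod => w _.
rewrite expR_ge0 /=; case: ifPn => // w1.
by rewrite /inner_abs (negbTE w1) expr1n subrr mulr0 mul0r oppr0 expR0.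
Qed.

End Submean.

(** * The integral bound for the penalized product *)

Section PlaneSigmaFinite.
Variable R : realType.
Local Notation PT := (measurableTypeR R * measurableTypeR R)%type.
Local Notation mu := (@lebesgue_measure R \x @lebesgue_measure R)%E.
Lemma plane_sigma_finite : sigma_finite [set: PT] mu.
Proof.
have /sigma_finiteP [F [TF ndF Foo]] := @sigma_finiteT _ _ _ (@lebesgue_measure R).
exists (fun n => F n `*` F n).
  rewrite -setXTT TF predeqE => -[x y]; split.
    move=> [/= [n _ Fnx] [k _ Gky]]; exists (maxn n k) => //; split.
    - by move: x Fnx; exact/subsetPset/ndF/leq_maxl.
    - by move: y Gky; exact/subsetPset/ndF/leq_maxr.
  by move=> [n _ []/= ? ?]; split; exists n.
move=> k; have [mF Fk] := Foo k; split; first exact: measurableX.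
by rewrite product_measure1E// lte_mul_pinfty// ge0_fin_numE.
Qed.

(** A name for the product measure on which sigma-finiteness can be declared as
    an instance, as Tonelli's theorem on [plane * plane] requires. *)
Definition plane_mu : set PT -> \bar R := mu.
HB.instance Definition _ := Measure.copy plane_mu (product_measure1 (@lebesgue_measure R) (@lebesgue_measure R)).
HB.instance Definition _ := Measure_isSigmaFinite.Build _ _ _ plane_mu plane_sigma_finite.
End PlaneSigmaFinite.

Section Tonelli.
Variable R : realType.
Local Notation PT := (measurableTypeR R * measurableTypeR R)%type.
Local Notation mu := (@lebesgue_measure R \x @lebesgue_measure R)%E.
Local Notation K := (fine (disc_area R)).
Local Open Scope ereal_scope.

Let measurable_patch_snd d (T : measurableType d) (f : T -> R[i] -> \bar R) :
  measurable_fun setT (fun x : T * PT => f x.1 (cpt x.2)) ->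
  measurable_fun setT (fun x : T * PT => if (normc (cpt x.2) < 1)%R then f x.1 (cpt x.2) else 0).
Proof.
move=> mf; apply: measurable_fun_ifT => //.
apply: measurable_fun_ltr; last exact: measurable_cst.
apply: measurable_normc; apply: (cmeasurable_compT (@cmeasurable_cpt _)).
exact: measurable_snd.
Qed.

Lemma measurable_dint d (T : measurableType d) (f : T -> R[i] -> \bar R) :
  (forall t v, 0 <= f t v) -> measurable_fun setT (fun x : T * PT => f x.1 (cpt x.2)) ->
  measurable_fun setT (fun t => dint (f t)).
Proof.
move=> f0 mf.
have -> : (fun t => dint (f t)) = (fun t => \int[@plane_mu R]_u (if (normc (cpt u) < 1)%R then f t (cpt u) else 0)).
  by apply/funext => t; exact: dint_patch.
have h0 (x : T * PT) : 0 <= (if (normc (cpt x.2) < 1)%R then f x.1 (cpt x.2) else 0) by case: ifP.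
exact: (@measurable_fun_fubini_tonelli_F _ _ T PT R (@plane_mu R) _ (measurable_patch_snd mf) h0).
Qed.

Lemma dint_swap (f : R[i] -> R[i] -> \bar R) : (forall a v, 0 <= f a v) ->
  measurable_fun setT (fun x : PT * PT => f (cpt x.1) (cpt x.2)) ->
  dint (fun a => dint (f a)) = dint (fun v => dint (f ^~ v)).
Proof.
move=> f0 mf.
pose h (x : PT * PT) := if (normc (cpt x.1) < 1)%R then (if (normc (cpt x.2) < 1)%R then f (cpt x.1) (cpt x.2) else 0) else 0.
have mh : measurable_fun setT h.
  apply: measurable_fun_ifT => //; last exact: (@measurable_patch_snd _ PT (fun x => f (cpt x))).
  apply: measurable_fun_ltr; last exact: measurable_cst.
  apply: measurable_normc; apply: (cmeasurable_compT (@cmeasurable_cpt _)).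
  exact: measurable_fst.
have h0 x : 0 <= h x by rewrite /h; do 2 case: ifP => // _.
have e := @fubini_tonelli _ _ _ _ _ (@plane_mu R) (@plane_mu R) h mh h0.
rewrite [LHS]dint_patch [RHS]dint_patch; transitivity (\int[@plane_mu R]_x \int[@plane_mu R]_y h (x, y)).
  apply: eq_integral => x _; rewrite /h /=; case: ifP => _; first by rewrite dint_patch.
  by rewrite integral0.
rewrite e; apply: eq_integral => y _; rewrite /h /=; case: ifPn => y1.
  by rewrite dint_patch; apply: eq_integral => x _; case: ifP.
by under eq_integral do rewrite if_same; rewrite integral0.
Qed.

Lemma dint_ball_le (b : R[i]) (r : R) : (0 < r)%R ->
  dint (fun a => if (normc (a - b) < r)%R then 1 else 0) <= (r ^+ 2 * K)%:E.
Proof.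
move=> r0; have nr : normc (r%:C)%C = r by rewrite normc_real gtr0_norm.
have rC0 : (r%:C)%C != 0%R by rewrite -normc_eq0 nr gt_eqF.
pose g (v : R[i]) : \bar R := if (normc (v - b) < r)%R then 1 else 0.
have g0 v : 0 <= g v by rewrite /g; case: ifP.
have mg : measurable_fun setT (g \o @cpt R).
  apply: measurable_fun_ifT => //; apply: measurable_fun_ltr; last exact: measurable_cst.
  by apply: measurable_normc; apply: cmeasurableB; [exact: cmeasurable_cpt|exact: cmeasurable_cst].
have := @ge0_integral_plane_aff R (r%:C)%C b g rC0 mg g0; rewrite nr => e.
apply: (@le_trans _ _ (\int[mu]_u g (cpt u))).
  by rewrite dint_patch; apply: le_ge0_integral => u _; case: ifP => // _; rewrite g0.
have -> : \int[mu]_u g (cpt u) = (r ^+ 2)%:E * ((r ^- 2)%:E * \int[mu]_u g (cpt u)).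
  by rewrite muleA -EFinM mulfV ?mul1e// sqrf_eq0 gt_eqF.
rewrite -e (EFinM (r ^+ 2)) lee_wpmul2l ?lee_fin ?sqr_ge0// -disc_area_fine /disc_area dint_patch.
apply: le_ge0_integral => u _ //; rewrite /g addrK normcM nr -[X in (_ < X)%R]mulr1 ltr_pM2l//.
Qed.

End Tonelli.

Section InnerPenalty.
Variable R : realType.
Local Notation PT := (measurableTypeR R * measurableTypeR R)%type.
Local Notation K := (fine (disc_area R)).
Variables (W : R[i] -> R) (Kw : R).
Hypothesis W_gt0 : forall z, unit_disc z -> 0 < W z.
Hypothesis W_ge0 : forall z, 0 <= W z.
Hypothesis mW : measurable_fun setT (W \o @cpt R).
Hypothesis Kw1 : 1 <= Kw.
Hypothesis W_inv : forall a z, unit_disc a -> unit_disc z ->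
  normc (mobius a z) < 2^-1 -> W a <= Kw * W z.
Implicit Types (a b u v : R[i]).

(** The last bound controls, for given [v] and [u], the set of points [a]
    involved. It comes from [|a - b| (1 - |v|) <= 4 (1 - |b|)], itself a
    consequence of [one_sub_sqr_mobius]. *)
Lemma near_mobius_bounds a v u : unit_disc a -> unit_disc v ->
  let b := mobius a v in
  normc (u - b) < (1 - normc b) / 2 ->
  [/\ unit_disc u, 1 - normc u <= 3 / 2 * (1 - normc b), normc (mobius b u) < 2^-1 &
      normc (a - u) * (1 - normc v) < 11 * (1 - normc u)].
Proof.
move=> a1 v1 b ub.
have b1 : unit_disc b by exact: mobius_disc.
have b1' := b1; rewrite unit_discE in b1'.
have t0 : 0 < 1 - normc b by rewrite subr_gt0.
have bu := ler_normcB u b; have ub' := ler_normcB b u; rewrite (normcB b u) in ub'.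
have u1 : normc u < 1 by lra.
have B0 := normc_ge0 b; have U0 := normc_ge0 u.
split => //; first lra.
  rewrite normc_mobius ltr_pdivrMr; last by apply: mobius_den_gt0 => //; exact: ltW.
  rewrite normcB; apply: lt_le_trans ub _; rewrite mulrC ler_wpM2l//.
  apply: le_trans (ler_normcB _ _); rewrite normc1 (normcM b^*%C) normc_conj lerD2l lerN2.
  by rewrite ler_piMr// ltW.
have v1' := v1; rewrite unit_discE in v1'; have V0 := normc_ge0 v.
have d0 := mobius_den_gt0 (ltW a1) v1; set d := normc (1 - _) in d0.
have d2 : d <= 2.
  apply: le_trans (ler_normcBD _ _) _; rewrite normc1 normcM normc_conj.
  by rewrite -[leRHS]/(1 + 1) lerD2l mulr_ile1 ?normc_ge0// ltW.
pose A := 1 - normc a ^+ 2.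
have A0 : 0 < A by rewrite subr_gt0 expr_lt1 ?normc_ge0.
have ab : normc (a - b) = normc v * A / d.
  rewrite /b /d -normcV.
  have -> : A = normc (A%:C%C) by rewrite normc_real gtr0_norm.
  rewrite -!normcM; congr normc; rewrite /mobius /A realcB sqr_normcE.
  by field; exact: mobius_den_neq0 (ltW a1) v1.
have tE : A * (1 - normc v ^+ 2) / d ^+ 2 <= 2 * (1 - normc b).
  by rewrite -one_sub_sqr_mobius// -/b; nra.
have abt : normc (a - b) * (1 - normc v) <= 4 * (1 - normc b).
  apply: (@le_trans _ _ (2 * (A * (1 - normc v ^+ 2) / d ^+ 2))); last by lra.
  rewrite ab; have -> : 2 * (A * (1 - normc v ^+ 2) / d ^+ 2) = A / d * (1 - normc v) * ((1 + normc v) * (2 / d)).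
    by field; rewrite gt_eqF.
  have -> : normc v * A / d * (1 - normc v) = A / d * (1 - normc v) * normc v by ring.
  have P0 : 0 <= A / d * (1 - normc v).
    by apply: mulr_ge0; [rewrite divr_ge0 ?(ltW A0) ?(ltW d0)|rewrite subr_ge0 ltW].
  rewrite ler_wpM2l//.
  have h2 : 1 <= 2 / d by rewrite ler_pdivlMr ?mul1r.
  by nra.
have au : normc (a - u) <= normc (a - b) + normc (u - b).
  by rewrite (normcB u b) -[a - u](subrKA b) le_normcD.
have := ler_wpM2r (ltW (_ : 0 < 1 - normc v)) au; rewrite subr_gt0 => /(_ v1').
rewrite mulrDl => h.
have : normc (u - b) * (1 - normc v) <= (1 - normc b) / 2.
  by apply: le_trans (ltW ub); rewrite ler_piMr ?normc_ge0// gerBl.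
by lra.
Qed.

Let F (p : R) c ws u : R := normc (root_prod c ws u) `^ p * W u.
(** Kernel bounding the mean value over the Euclidean disc about [mobius a v]; the
    indicator keeps only the relation between [a], [v] and [u] that survives
    integration in [a]. *)
Let T p c ws a v u : R :=
  if normc (a - u) * (1 - normc v) < 11 * (1 - normc u) then ((1 - normc u) ^+ 2)^-1 * F p c ws u else 0.

Let F0 p c ws u : 0 <= F p c ws u. Proof. by rewrite mulr_ge0 ?powR_ge0. Qed.
Let T0 p c ws a v u : 0 <= T p c ws a v u.
Proof. by rewrite /T; case: ifP => // _; rewrite mulr_ge0 ?invr_ge0 ?sqr_ge0. Qed.

Let mF p c ws : measurable_fun setT (fun u : PT => F p c ws (cpt u)).
Proof. by apply: measurable_funM => //; exact: measurable_root_prod_powR. Qed.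

Let mT p c ws : measurable_fun setT (fun x : (PT * PT) * PT => T p c ws (cpt x.1.1) (cpt x.1.2) (cpt x.2)).
Proof.
have m1 : cmeasurable (fun x : (PT * PT) * PT => cpt x.1.1).
  apply: (cmeasurable_compT (k := fun x : (PT * PT) * PT => x.1.1) (@cmeasurable_cpt _)).
  by apply: (measurableT_comp (@measurable_fst _ _ PT PT)); exact: measurable_fst.
have m2 : cmeasurable (fun x : (PT * PT) * PT => cpt x.1.2).
  apply: (cmeasurable_compT (k := fun x : (PT * PT) * PT => x.1.2) (@cmeasurable_cpt _)).
  by apply: (measurableT_comp (@measurable_snd _ _ PT PT)); exact: measurable_fst.
have m3 : cmeasurable (fun x : (PT * PT) * PT => cpt x.2).
  by apply: (cmeasurable_compT (k := fun x : (PT * PT) * PT => x.2) (@cmeasurable_cpt _)); exact: measurable_snd.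
have n1 (h : (PT * PT) * PT -> R[i]) : cmeasurable h -> measurable_fun setT (fun x => 1 - normc (h x)).
  by move=> mh; apply: measurable_funB => //; exact: measurable_normc.
apply: measurable_fun_ifT.
- apply: measurable_fun_ltr; apply: measurable_funM => //; [|exact: n1|exact: n1].
  by apply: measurable_normc; exact: cmeasurableB.
- apply: measurable_funM; last by apply: (measurableT_comp (mF p c ws)); exact: measurable_snd.
  apply: measurable_inv_ge0 => [x|]; first exact: sqr_ge0.
  by apply: measurable_funX; exact: n1.
- exact: measurable_cst.
Qed.

(** [weight_mobius_lower] moves the weight from [a] to [mobius a v], [submean]
    replaces the value of the polynomial there by a mean over a disc in which
    the weight is comparable, and the disc is enlarged to the region defining
    [T], whose section in the variable [a] is again a disc. *)
Lemma weighted_submean (p : R) : 0 < p -> exists (M : nat) (C : R), 0 < C /\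
  forall c ws a v, unit_disc a -> unit_disc v ->
  ((W a * (1 - normc v) ^+ M * normc (root_prod c ws (mobius a v)) `^ p)%:E <=
   C%:E * dint (fun u => (T p c ws a v u)%:E))%E.
Proof.
move=> p0; have [M [C1 [C10 chain]]] := weight_mobius_lower W_gt0 Kw1 W_inv.
have K0 := fine_disc_area_gt0 R.
have Kw0 : 0 < Kw by apply: lt_le_trans Kw1.
exists M, (C1 * (9 / K * Kw)); split; first by rewrite !mulr_gt0 ?invr_gt0.
move=> c ws a v a1 v1; set b := mobius a v.
have b1 : unit_disc b := mobius_disc a1 v1.
have t0 : 0 < 1 - normc b by rewrite subr_gt0.
pose r := (1 - normc b) / 2.
have r0 : 0 < r by rewrite divr_gt0.
have near u : normc (u - b) < r -> _ := @near_mobius_bounds a v u a1 v1.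
have sm := @submean R c ws b r p p0 r0.
have {}sm := sm _; move: (sm) => /= {}sm.
have bD (x : R[i]) : normc x < 1 -> unit_disc (b + r%:C%C * x).
  move=> x1; rewrite unit_discE; apply: le_lt_trans (le_normcD _ _) _.
  rewrite normcM normc_real gtr0_norm//.
  have : r * normc x <= r by rewrite ler_piMr ?ltW.
  by rewrite /r; lra.
have {}sm := sm bD.
have Wb := W_gt0 b1.
set Q := normc (root_prod c ws b) `^ p in sm *.
have Q0 : 0 <= Q by exact: powR_ge0.
apply: (@le_trans _ _ ((C1 * W b * Q)%:E)).
  by rewrite lee_fin ler_wpM2r//; exact: chain.
have -> : C1 * W b * Q = (C1 * W b / (r ^+ 2 * K)) * (r ^+ 2 * K * Q).
  by field; rewrite !gt_eqF.
have cc0 : 0 <= C1 * W b / (r ^+ 2 * K).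
  by apply/ltW/divr_gt0; apply: mulr_gt0 => //; exact: exprn_gt0.
rewrite EFinM; apply: le_trans (lee_wpmul2l _ sm) _; first by rewrite lee_fin.
have mTav : dmeas (fun u => (T p c ws a v u)%:E).
  apply: dmeasT; apply/measurable_EFinP.
  have cE (z : R[i]) : cpt (complex.Re z, complex.Im z) = z by case: z.
  pose x0 : PT * PT := ((complex.Re a, complex.Im a), (complex.Re v, complex.Im v)).
  have := measurableT_comp (mT p c ws) (measurable_pair1 x0).
  by congr measurable_fun; apply/funext => u /=; rewrite !cE.
have mq : dmeas (fun u => if normc (u - b) < r then (normc (root_prod c ws u) `^ p)%:E else 0%E).
  apply: dmeasT; apply: measurable_fun_ifT; last exact: measurable_cst.
    apply: measurable_fun_ltr; last exact: measurable_cst.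
    by apply: measurable_normc; apply: cmeasurableB; [exact: cmeasurable_cpt|exact: cmeasurable_cst].
  by apply/measurable_EFinP; exact: measurable_root_prod_powR.
have CC0 : 0 <= C1 * (9 / K * Kw) by rewrite ltW// !mulr_gt0 ?invr_gt0.
have q0' (u : R[i]) : unit_disc u -> (0 <= if (normc (u - b) < r)%R then (normc (root_prod c ws u) `^ p)%:E else 0%E)%E.
  by move=> _; case: ifP => // _; rewrite lee_fin powR_ge0.
have T0' (u : R[i]) : unit_disc u -> (0 <= (T p c ws a v u)%:E)%E by move=> _; rewrite lee_fin.
rewrite -(dintZl mq q0' cc0) -(dintZl mTav T0' CC0).
apply: le_dint => u u1.
  by rewrite mule_ge0 ?lee_fin//; case: ifP => // _; rewrite lee_fin powR_ge0.
case: ifPn => ub; last by rewrite mule0 -EFinM lee_fin mulr_ge0.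
have [_ tu bu au] := near_mobius_bounds a1 v1 ub.
rewrite -!EFinM lee_fin /T au /F.
set q := normc (root_prod c ws u) `^ p.
have q0 : 0 <= q by exact: powR_ge0.
have Wbu : W b <= Kw * W u by exact: W_inv.
have s0 : 0 < 1 - normc u by rewrite subr_gt0.
have h : ((r ^+ 2)^-1 : R) <= 9 * ((1 - normc u) ^+ 2)^-1.
  rewrite -[leRHS]invrK lef_pV2 ?posrE ?invr_gt0 ?exprn_gt0//; last by rewrite mulr_gt0// invr_gt0 exprn_gt0.
  rewrite invfM invrK -ler_pdivlMl// invrK.
  have : 1 - normc u <= 3 * r by rewrite /r; lra.
  by move=> h; have := ler_pM (ltW s0) (ltW s0) h h; lra.
have -> : C1 * W b / (r ^+ 2 * K) * q = C1 / K * q * ((r ^+ 2)^-1 * W b).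
  by field; rewrite !gt_eqF.
have -> : C1 * (9 / K * Kw) * (((1 - normc u) ^+ 2)^-1 * (q * W u)) = C1 / K * q * ((9 * ((1 - normc u) ^+ 2)^-1) * (Kw * W u)).
  by field; rewrite !gt_eqF.
apply: ler_wpM2l; first by rewrite mulr_ge0// divr_ge0 ?ltW.
by apply: ler_pM => //; rewrite invr_ge0 sqr_ge0.
Qed.

(** [weighted_mean_lower] and [weighted_submean] bound the integrand at [a] by a
    double integral in [v] and [u] of the kernel [T]. In [a] the kernel is
    supported in a disc of radius [11 (1 - |u|) / (1 - |v|)]; the square of this
    radius cancels the factor [(1 - |u|)^-2] of [T] against [(1 - |v|)^2]. *)
Theorem inner_penalty_bound (k : nat) (p : R) : (1 < k)%N -> 0 < p ->
  exists2 C : R, 0 < C & forall c ws,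
  (dint (fun a => (W a * (normc c `^ p * \prod_(w <- ws) (outer_abs w a `^ p *
          expR (- (p * (1 - inner_abs w a ^+ k.+2) / k.+2%:R)))))%:E) <=
   C%:E * dint (fun u => (normc (root_prod c ws u) `^ p * W u)%:E))%E.
Proof.
move=> k2 p0; have [M [C1 [C10 ws1]]] := weighted_submean p0.
have [c0 c00 ml] := @weighted_mean_lower R k M.+2 p k2 p0.
have K0 := fine_disc_area_gt0 R.
(* 121 is the square of the radius 11 of the kernel; one K comes from the disc of
   centres a, the other from the integration in v. *)
exists (c0^-1 * (C1 * (121 * K * K))); first by rewrite !mulr_gt0 ?invr_gt0.
move=> c ws.
(* Only two of the M + 2 factors 1 - |v| remain; the others are used up by the weight. *)
pose S a v u : \bar R := (C1 * ((1 - normc v) ^+ 2 * T p c ws a v u))%:E.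
have S0 a v u : (0 <= S a v u)%E by rewrite lee_fin mulr_ge0 ?(ltW C10)// mulr_ge0 ?sqr_ge0.
have mS : measurable_fun setT (fun x : (PT * PT) * PT => S (cpt x.1.1) (cpt x.1.2) (cpt x.2)).
  apply/measurable_EFinP; apply: measurable_funM => //; apply: measurable_funM => //.
  apply: measurable_funX; apply: measurable_funB => //; apply: measurable_normc.
  apply: (cmeasurable_compT (k := fun x : (PT * PT) * PT => x.1.2) (@cmeasurable_cpt _)).
  by apply: (measurableT_comp (@measurable_snd _ _ PT PT)); exact: measurable_fst.
have mTav a v : dmeas (fun u => (T p c ws a v u)%:E).
  apply: dmeasT; apply/measurable_EFinP.
  have cE (z : R[i]) : cpt (complex.Re z, complex.Im z) = z by case: z.
  pose x0 : PT * PT := ((complex.Re a, complex.Im a), (complex.Re v, complex.Im v)).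
  have := measurableT_comp (mT p c ws) (measurable_pair1 x0).
  by congr measurable_fun; apply/funext => u /=; rewrite !cE.
have mSd : measurable_fun setT (fun x : PT * PT => dint (S (cpt x.1) (cpt x.2))).
  by apply: (measurable_dint (f := fun x : PT * PT => S (cpt x.1) (cpt x.2))).
apply: (@le_trans _ _ (dint (fun a => (c0^-1)%:E * dint (fun v => dint (S a v)))%E)).
  apply: le_dint => a a1.
    rewrite lee_fin mulr_ge0// mulr_ge0 ?powR_ge0// prodr_ge0// => w _.
    by rewrite mulr_ge0 ?powR_ge0 ?expR_ge0.
  have := ml c ws a a1; set N := normc c `^ p * _ => mla.
  pose q v := normc (root_prod c ws (mobius a v)) `^ p.
  have q0 v : 0 <= q v by exact: powR_ge0.
  pose I v : \bar R := (`|1 - normc v| ^+ M.+2 * `|normc v| ^+ k * q v)%:E.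
  have I0 (v : R[i]) : unit_disc v -> (0 <= I v)%E by move=> _; rewrite lee_fin mulr_ge0// mulr_ge0 ?exprn_ge0.
  have mn : measurable_fun setT (fun v : PT => normc (cpt v)).
    by apply: measurable_normc; exact: cmeasurable_cpt.
  have mI : dmeas I.
    apply: dmeasT; apply/measurable_EFinP; apply: measurable_funM.
      by apply: measurable_funM; apply: measurable_funX; apply: measurableT_comp => //; apply: measurable_funB.
    apply: (cmeasurable_comp (g := fun z => normc (root_prod c ws z) `^ p) (h := fun v : PT => mobius a (cpt v))); first exact: measurable_root_prod_powR.
    apply: cmeasurableM; first by apply: cmeasurableB; [exact: cmeasurable_cst|exact: cmeasurable_cpt].
    apply: cmeasurableV; apply: cmeasurableB; first exact: cmeasurable_cst.
    by apply: cmeasurableM; [exact: cmeasurable_cst|exact: cmeasurable_cpt].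
  have -> : (W a * N)%:E = ((c0^-1)%:E * ((W a)%:E * (c0 * N)%:E))%E.
    by rewrite -!EFinM; congr EFin; field; rewrite gt_eqF.
  rewrite lee_wpmul2l ?lee_fin ?invr_ge0 ?(ltW c00)//.
  apply: (@le_trans _ _ ((W a)%:E * dint I)%E); first by rewrite lee_wpmul2l ?lee_fin.
  rewrite -(dintZl mI I0 (W_ge0 a)); apply: le_dint => v v1.
    by rewrite mule_ge0 ?lee_fin// -lee_fin; exact: I0.
  have t0 : 0 <= 1 - normc v by rewrite subr_ge0 ltW.
  have c10 : 0 <= C1 * (1 - normc v) ^+ 2 by rewrite mulr_ge0 ?sqr_ge0// ltW.
  have -> : dint (S a v) = ((C1 * (1 - normc v) ^+ 2)%:E * dint (fun u => (T p c ws a v u)%:E))%E.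
    have T0' (u : R[i]) : unit_disc u -> (0 <= (T p c ws a v u)%:E)%E by move=> _; rewrite lee_fin.
    rewrite -(dintZl (mTav a v) T0' c10).
    by apply: eq_dint => u _; rewrite /S -EFinM mulrA.
  have h1 := ws1 c ws a v a1 v1.
  have -> : ((C1 * (1 - normc v) ^+ 2)%:E * dint (fun u => (T p c ws a v u)%:E) =
     ((1 - normc v) ^+ 2)%:E * (C1%:E * dint (fun u => (T p c ws a v u)%:E)))%E.
    by rewrite mulrC EFinM muleA.
  apply: (@le_trans _ _ (((1 - normc v) ^+ 2)%:E * (W a * (1 - normc v) ^+ M * q v)%:E)%E); last first.
    by rewrite lee_wpmul2l// lee_fin sqr_ge0.
  rewrite -!EFinM lee_fin ger0_norm// ger0_norm ?normc_ge0//.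
  have -> : (1 - normc v) ^+ 2 * (W a * (1 - normc v) ^+ M * q v) = W a * ((1 - normc v) ^+ M.+2 * 1 * q v).
    by rewrite !exprS expr0; ring.
  rewrite ler_wpM2l// ler_wpM2r// ler_wpM2l ?exprn_ge0//.
  by rewrite exprn_ile1 ?normc_ge0// ltW.
rewrite dintZl ?invr_ge0 ?(ltW c00)//; last 2 first.
- by apply: dmeasT; apply: (measurable_dint (f := fun (a : PT) v => dint (S (cpt a) v))) => // a v; exact: dint_ge0.
- by move=> a _; apply: dint_ge0 => v _; apply: dint_ge0.
rewrite EFinM -muleA lee_wpmul2l ?lee_fin ?invr_ge0 ?(ltW c00)//.
rewrite dint_swap//; last by move=> a v; exact: dint_ge0.
apply: (@le_trans _ _ (dint (fun v => (C1 * (121 * K))%:E * dint (fun u => (F p c ws u)%:E))%E)).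
  apply: le_dint => v v1; first by apply: dint_ge0 => a _; exact: dint_ge0.
  have cE (z : R[i]) : cpt (complex.Re z, complex.Im z) = z by case: z.
  have mSv : measurable_fun setT (fun x : PT * PT => S (cpt x.1) v (cpt x.2)).
    have mk : measurable_fun setT (fun x : PT * PT => (x.1, (complex.Re v, complex.Im v), x.2) : (PT * PT) * PT).
      apply: measurable_fun_pair; last exact: measurable_snd.
      by apply: measurable_fun_pair; [exact: measurable_fst|exact: measurable_cst].
    have := measurableT_comp mS mk; congr measurable_fun; apply/funext => x /=; by rewrite cE.
  rewrite (dint_swap (f := fun a => S a v))//.
  have C0 : 0 <= C1 * (121 * K) by rewrite ltW// mulr_gt0// mulr_gt0.
  rewrite -dintZl//; first apply: le_dint => u u1.
  - by apply: dint_ge0 => a _.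
  - have U0 : 0 < 1 - normc u by rewrite subr_gt0.
    have V0 : 0 < 1 - normc v by rewrite subr_gt0.
    pose rr := 11 * (1 - normc u) / (1 - normc v).
    have rr0 : 0 < rr by rewrite divr_gt0// mulr_gt0.
    pose e := C1 * ((1 - normc v) ^+ 2 * (((1 - normc u) ^+ 2)^-1 * F p c ws u)).
    have e0 : 0 <= e by rewrite /e mulr_ge0 ?(ltW C10)// mulr_ge0 ?sqr_ge0// mulr_ge0 ?invr_ge0 ?sqr_ge0.
    have -> : dint (fun a => S a v u) = (e%:E * dint (fun a => if (normc (a - u) < rr)%R then 1 else 0))%E.
      rewrite -dintZl//.
      + apply: eq_dint => a _; rewrite /S /T /rr ltr_pdivlMr//.
        by case: ifP => _; rewrite ?mule1 ?mule0 ?mulr0.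
      + apply: dmeasT; apply: measurable_fun_ifT => //; apply: measurable_fun_ltr; last exact: measurable_cst.
        by apply: measurable_normc; apply: cmeasurableB; [exact: cmeasurable_cpt|exact: cmeasurable_cst].
      + by move=> a _; case: ifP.
    apply: le_trans (lee_wpmul2l _ (dint_ball_le u rr0)) _; first by rewrite lee_fin.
    rewrite -!EFinM lee_fin /e /rr le_eqVlt; apply/orP; left; apply/eqP.
    by field; rewrite !gt_eqF.
  - by apply: dmeasT; apply/measurable_EFinP; exact: mF.
  - by move=> u _; rewrite lee_fin.
have Fge0 : (0 <= dint (fun u => (F p c ws u)%:E))%E by apply: dint_ge0 => u _; rewrite lee_fin.
set X := dint (fun u => (F p c ws u)%:E) in Fge0 *.
have C0 : 0 < C1 * (121 * K * K) by rewrite !mulr_gt0.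
move: X Fge0 => [x x0| _ |//]; last by rewrite [leRHS]mulry gtr0_sg// mul1e leey.
have -> : (fun v : R[i] => (C1 * (121 * K))%:E * x%:E)%E = (fun=> (C1 * (121 * K) * x)%:E).
  by apply/funext => v; rewrite EFinM.
rewrite lee_fin in x0.
rewrite dint_cst ?mulr_ge0 ?(ltW C10) ?(ltW K0)// disc_area_fine -!EFinM lee_fin le_eqVlt.
by apply/orP; left; apply/eqP; ring.
Qed.
End InnerPenalty.

(** * Locally uniform limits of polynomials *)

Section LocallyPolynomial.
Variable R : realType.
Implicit Types (f g : R[i] -> R[i]) (z h c : R[i]).

(** By Runge's theorem these are all the analytic functions in the disc. The
    definition by approximation makes closure under sums, products and limits
    immediate and avoids contour integrals. *)
Definition locpoly f := forall r e : R, r < 1 -> 0 < e ->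
  exists P : {poly R[i]}, forall z, normc z <= r -> normc (f z - P.[z]) <= e.

Lemma locpoly_poly (P : {poly R[i]}) : locpoly (fun z => P.[z]).
Proof. by move=> r e _ e0; exists P => z _; rewrite subrr normc0 ltW. Qed.

Lemma locpoly_cst c : locpoly (fun=> c).
Proof. by move=> r e _ e0; exists c%:P => z _; rewrite hornerC subrr normc0 ltW. Qed.

Lemma locpoly_id : locpoly id.
Proof. by move=> r e _ e0; exists 'X => z _; rewrite hornerX subrr normc0 ltW. Qed.

Lemma locpoly_lim f : (forall r e : R, r < 1 -> 0 < e ->
    exists2 g, locpoly g & forall z, normc z <= r -> normc (f z - g z) <= e) -> locpoly f.
Proof.
move=> fg r e r1 e0; have e2 : 0 < e / 2 by rewrite divr_gt0.
have [g lg fge] := fg r _ r1 e2; have [P gP] := lg r _ r1 e2.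
exists P => z zr; rewrite -(subrKA (g z)).
by apply: le_trans (le_normcD _ _) _; rewrite [leRHS](splitr e) lerD ?fge ?gP.
Qed.

Lemma eq_locpoly f g : f =1 g -> locpoly f -> locpoly g.
Proof. by move=> /funext ->. Qed.

Lemma poly_bounded (P : {poly R[i]}) (r : R) : exists2 M, 0 <= M & forall z, normc z <= r -> normc P.[z] <= M.
Proof.
elim/poly_ind: P => [|P a [M M0 IH]].
  by exists 0 => // z _; rewrite horner0 normc0.
exists (M * `|r| + normc a) => [|z zr]; first by rewrite addr_ge0 ?mulr_ge0 ?normc_ge0.
rewrite !hornerE; apply: le_trans (le_normcD _ _) _; rewrite lerD2r normcM.
by rewrite ler_pM ?normc_ge0 ?IH// (le_trans zr)// ler_norm.
Qed.

Lemma locpoly_bounded f (r : R) : locpoly f -> r < 1 ->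
  exists2 M, 0 <= M & forall z, normc z <= r -> normc (f z) <= M.
Proof.
move=> lf r1; have [P fP] := lf r 1 r1 ltr01; have [M M0 PM] := poly_bounded P r.
exists (1 + M) => [|z zr]; first by rewrite addr_ge0.
by rewrite -[f z](subrK P.[z]); apply: le_trans (le_normcD _ _) _; rewrite lerD ?fP ?PM.
Qed.

Lemma locpolyD f g : locpoly f -> locpoly g -> locpoly (fun z => f z + g z).
Proof.
move=> lf lg r e r1 e0; have e2 : 0 < e / 2 by rewrite divr_gt0.
have [P fP] := lf r _ r1 e2; have [Q gQ] := lg r _ r1 e2.
exists (P + Q) => z zr; rewrite hornerD opprD addrACA.
by apply: le_trans (le_normcD _ _) _; rewrite [leRHS](splitr e) lerD ?fP ?gQ.
Qed.

Lemma locpolyM f g : locpoly f -> locpoly g -> locpoly (fun z => f z * g z).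
Proof.
move=> lf lg r e r1 e0; have [M M0 fM] := locpoly_bounded lf r1.
have eM : 0 < e / 2 / (M + 1) by rewrite !divr_gt0// ltr_wpDl.
have [Q gQ] := lg r _ r1 eM; have [N N0 QN] := poly_bounded Q r.
have eN : 0 < e / 2 / (N + 1) by rewrite !divr_gt0// ltr_wpDl.
have [P fP] := lf r _ r1 eN.
have aux (x y : R) : 0 <= y -> x * y <= e / 2 / (y + 1) * y -> x * y <= e / 2.
  move=> y0 /le_trans; apply; have y1 : 0 < y + 1 by rewrite ltr_wpDl.
  rewrite -[leLHS]mulrA; apply: ler_piMr; first by rewrite divr_ge0 ?ltW.
  by rewrite ler_pdivrMl// mulr1 lerDl.
exists (P * Q) => z zr; rewrite hornerM.
have -> : f z * g z - P.[z] * Q.[z] = (g z - Q.[z]) * f z + (f z - P.[z]) * Q.[z] by ring.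
apply: le_trans (le_normcD _ _) _; rewrite [leRHS](splitr e) !normcM; apply: lerD.
  apply: le_trans (_ : normc (g z - Q.[z]) * M <= _); first by rewrite ler_wpM2l ?normc_ge0 ?fM.
  by apply: aux => //; rewrite ler_wpM2r// gQ.
apply: le_trans (_ : normc (f z - P.[z]) * N <= _); first by rewrite ler_wpM2l ?normc_ge0 ?QN.
by apply: aux => //; rewrite ler_wpM2r// fP.
Qed.

Lemma locpolyX f n : locpoly f -> locpoly (fun z => f z ^+ n).
Proof.
move=> lf; elim: n => [|n IH]; first by apply: eq_locpoly (locpoly_cst 1) => z; rewrite expr0.
by apply: eq_locpoly (locpolyM lf IH) => z; rewrite exprS.
Qed.

(** Cauchy's estimate. The [k]-th coefficient times [d^k] is the mean of
    [T(d w) w^(N-k)] over the [N]-th roots of unity [w], for [N] larger than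
    the degree. *)
Lemma coef_bound (T : {poly R[i]}) (d M : R) k : 0 < d ->
  (forall z, normc z <= d -> normc T.[z] <= M) -> normc T`_k * d ^+ k <= M.
Proof.
(* N exceeds every index, so that no two exponents agree modulo N. *)
move=> d0 TM; pose N := (maxn (size T) k).+1.
have [z pz] := @prim_root_exists R N (ltn0Sn _).
have N0 : 0 < (N%:R : R) by rewrite ltr0n.
have kN : (k < N)%N by rewrite ltnS leq_maxr.
have nz j : normc (z ^+ j) = 1 by rewrite normcX (normc_prim_root pz) expr1n.
have e : N%:R * (T`_k * (d%:C)%C ^+ k) = \sum_(j < N) (z ^+ j) ^+ (N - k) * T.[(d%:C)%C * z ^+ j].
  transitivity (\sum_(j < N) \sum_(m < N) T`_m * (d%:C)%C ^+ m * (z ^+ j) ^+ (N - k + m)); last first.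
    apply: eq_bigr => j _; rewrite (@horner_coef_wide _ N); last by rewrite ltnW// ltnS leq_maxl.
    rewrite big_distrr/=; apply: eq_bigr => m _.
    by rewrite exprMn (exprD _ _ m) [RHS]mulrC -!mulrA; congr (_ * (_ * _)); exact: mulrC.
  rewrite exchange_big/= (bigD1 (Ordinal kN))//= [X in _ + X]big1 ?addr0; last first.
    move=> m; rewrite -val_eqE/= => mk; rewrite -big_distrr/=.
    have mN := ltn_ord m.
    have [lt|gt|/eqP] := ltngtP m k; last by rewrite (negbTE mk).
      rewrite sum_prim_root ?mulr0//; apply/andP; split; first by rewrite addn_gt0 subn_gt0 kN.
      by rewrite -[ltnRHS](subnK (ltnW kN)) ltn_add2l.
    have -> : (N - k + m = N + (m - k))%N by rewrite addnBAC ?addnBA// ltnW.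
    rewrite (eq_bigr (fun j : 'I_N => (z ^+ j) ^+ (m - k))); last first.
      by move=> j _; rewrite exprD exprAC (prim_expr_order pz) expr1n mul1r.
    by rewrite sum_prim_root ?mulr0// subn_gt0 gt/= (leq_ltn_trans _ mN)// leq_subr.
  rewrite -big_distrr/=; rewrite (eq_bigr (fun=> 1)); last first.
    by move=> j _; rewrite subnK ?(ltnW kN)// exprAC (prim_expr_order pz) expr1n.
  by rewrite sumr_const card_ord mulrC.
have /(congr1 (@normc R)) := e.
have -> : (N%:R : R[i]) = ((N%:R : R)%:C)%C by rewrite -[LHS](rmorph_nat (real_complex R)).
rewrite !normcM normc_real gtr0_norm// normcX normc_real gtr0_norm// => {}e.
rewrite -(ler_pM2l N0) e; apply: (@le_trans _ _ (\sum_(j < N) M)); last first.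
  by rewrite sumr_const card_ord mulr_natl.
have nsum (I : Type) (s : seq I) (F : I -> R[i]) : normc (\sum_(i <- s) F i) <= \sum_(i <- s) normc (F i).
  elim: s => [|i s IH]; first by rewrite !big_nil normc0.
  by rewrite !big_cons; apply: le_trans (le_normcD _ _) _; rewrite lerD2l.
apply: le_trans (nsum _ _ _) _; apply: ler_sum => j _.
rewrite normcM normcX nz expr1n mul1r TM// normcM nz mulr1 normc_real gtr0_norm//.
Qed.

(** The coefficients of [P] about [z0] decrease geometrically by [coef_bound], so
    the terms of degree at least two are dominated by twice the bound for the
    first of them. *)
Lemma poly_taylor (P : {poly R[i]}) z0 (d M : R) : 0 < d ->
  (forall h, normc h <= d -> normc P.[z0 + h] <= M) ->
  exists2 c, normc c <= M / d & forall h, normc h <= d / 2 ->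
    normc (P.[z0 + h] - P.[z0] - c * h) <= 2 * M * (normc h / d) ^+ 2.
Proof.
move=> d0 PM; pose T := P \Po (z0%:P + 'X).
have TE h : T.[h] = P.[z0 + h] by rewrite horner_comp !hornerE.
have TM h : normc h <= d -> normc T.[h] <= M by rewrite TE; exact: PM.
have M0 : 0 <= M by apply: le_trans (normc_ge0 _) (TM 0 _); rewrite normc0 ltW.
have cb k : normc T`_k <= M / d ^+ k by rewrite ler_pdivlMr ?exprn_gt0// coef_bound.
exists T`_1 => [|h hd]; first by have := cb 1%N; rewrite expr1.
have PT : P.[z0] = T`_0 by rewrite -[z0 in LHS]addr0 -TE -horner_coef0.
set t := normc h / d.
have t0 : 0 <= t by rewrite divr_ge0 ?normc_ge0 ?ltW.
have t2 : t <= 2^-1 by rewrite ler_pdivrMr// mulrC.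
rewrite -TE PT (@horner_coef_wide _ (size T).+2); last by rewrite ltnW// ltnW.
rewrite !big_ord_recl /= expr0 mulr1 expr1 /bump /= !add1n.
rewrite [X in normc X](_ : _ = \sum_(i < size T) T`_i.+2 * h ^+ i.+2); last by ring.
suff : normc (\sum_(i < size T) T`_i.+2 * h ^+ i.+2) <= M * t ^+ 2 * (2 * (1 - 2^-1 ^+ size T)).
  move/le_trans; apply; rewrite mulrAC ler_wpM2r ?sqr_ge0// mulrC ler_wpM2r//.
  by rewrite -[leRHS]mulr1 ler_wpM2l// gerBl exprn_ge0.
elim: (size T) => [|n IH].
  by rewrite big_ord0 normc0 expr0 subrr !mulr0.
rewrite big_ord_recr/=; apply: le_trans (le_normcD _ _) _.
have : normc (T`_n.+2 * h ^+ n.+2) <= M * t ^+ 2 * 2^-1 ^+ n.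
  rewrite normcM normcX; apply: (@le_trans _ _ (M / d ^+ n.+2 * normc h ^+ n.+2)).
    by rewrite ler_wpM2r ?exprn_ge0 ?normc_ge0.
  rewrite -mulrA [_^-1 * _]mulrC -expr_div_n -/t -mulrA ler_wpM2l// -[n.+2]addn2 addnC exprD.
  by rewrite ler_wpM2l ?sqr_ge0// lerXn2r// ?nnegrE.
move=> hn; apply: le_trans (lerD IH hn) _.
rewrite -mulrDr; apply: ler_wpM2l; first by apply: mulr_ge0 => //; exact: sqr_ge0.
rewrite exprS.
by rewrite le_eqVlt; apply/orP; left; apply/eqP; field.
Qed.

End LocallyPolynomial.

(** * Ultralimits and the theorem of Montel *)

Section UltraLimits.
Variable R : realType.
Variables (U : set_system nat).
Context {UU : UltraFilter U}.
Hypothesis Uoo : \oo `<=` U.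
Implicit Types (z h c : R[i]).

(** Along an ultrafilter every bounded sequence converges, by compactness of
    segments. This replaces extraction of subsequences. *)
Lemma real_ultralim (u : nat -> R) (M : R) : (forall n, `|u n| <= M) ->
  exists l, forall e : R, 0 < e -> \forall n \near U, `|u n - l| <= e.
Proof.
move=> uM.
have FU : ProperFilter (u @ U) by exact: fmap_proper_filter.
have UF : UltraFilter (u @ U).
  apply: Build_UltraFilter => G PG sG; apply/seteqP; split => // A GA.
  have [//|h] := in_ultra_setVsetC (u @^-1` A) UU.
  have : G (~` A) by apply: sG.
  move=> GnA; have FG : Filter G by exact: filter_filter.
  by have := filterI GA GnA; rewrite setICr => h0; case: (@filter_not_empty _ G PG (h0 FG)).
have cpt : compact `[- M, M]%classic by exact: segment_compact.
have := cpt; rewrite compact_ultra => /(_ (u @ U) UF) [].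
  by apply: nearW => n; rewrite /= in_itv/= -ler_norml.
move=> l [_ /= ul]; exists l => e e0.
by move/cvgrPdist_le: ul => /(_ e e0); apply: filterS => n; rewrite distrC.
Qed.

Lemma normc_le_re_im (x y a b : R) : normc ((x +i* y) - (a +i* b))%C <= `|x - a| + `|y - b|.
Proof.
rewrite /= -[leRHS]ger0_norm ?addr_ge0// -[leRHS]sqrtr_sqr ler_wsqrtr//.
rewrite [leRHS]sqrrD !real_normK ?num_real// -[leLHS]addr0 [leRHS]addrAC lerD2l.
by rewrite mulrn_wge0// mulr_ge0.
Qed.

Lemma ultralim (u : nat -> R[i]) (M : R) : (forall n, normc (u n) <= M) ->
  exists l, forall e : R, 0 < e -> \forall n \near U, normc (u n - l) <= e.
Proof.
move=> uM.
have reM n : `|complex.Re (u n)| <= M.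
  apply: le_trans (uM n); case: (u n) => x y /=.
  by rewrite -sqrtr_sqr ler_wsqrtr// lerDl sqr_ge0.
have imM n : `|complex.Im (u n)| <= M.
  apply: le_trans (uM n); case: (u n) => x y /=.
  by rewrite -sqrtr_sqr ler_wsqrtr// lerDr sqr_ge0.
have [a ua] := real_ultralim reM; have [b ub] := real_ultralim imM.
exists (a +i* b)%C => e e0.
near=> n.
have h1 : `|complex.Re (u n) - a| <= e / 2.
  by near: n; apply: ua; rewrite divr_gt0.
have h2 : `|complex.Im (u n) - b| <= e / 2.
  by near: n; apply: ub; rewrite divr_gt0.
rewrite [leRHS](splitr e); apply: le_trans (lerD h1 h2).
move: (u n) => [x y]; exact: normc_le_re_im.
Unshelve. all: by end_near.
Qed.

Lemma ultra_const (P : Prop) : (\forall n \near U, P) -> P.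
Proof. by case/(@filter_ex _ _ (ultra_proper (F := U))). Qed.

(** [poly_taylor] for approximating polynomials; their linear coefficients are
    bounded and have an ultralimit. *)
Lemma locpoly_taylor (f : R[i] -> R[i]) z0 (d M : R) : locpoly f -> 0 < d -> normc z0 + d < 1 ->
  (forall h, normc h <= d -> normc (f (z0 + h)) <= M) ->
  exists2 c, normc c <= (M + 1) / d & forall h, normc h <= d / 2 ->
    normc (f (z0 + h) - f z0 - c * h) <= 2 * (M + 1) * (normc h / d) ^+ 2.
Proof.
move=> lf d0 zd fM.
have n0 (n : nat) : 0 < n.+1%:R^-1 :> R by rewrite invr_gt0 ltr0n.
have n1 (n : nat) : n.+1%:R^-1 <= 1 :> R by rewrite invf_le1// ler1n.
have /choice[P fP] n := lf _ _ zd (n0 n).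
have dd (h : R[i]) : normc h <= d -> normc (z0 + h) <= normc z0 + d.
  by move=> hd; apply: le_trans (le_normcD _ _) _; rewrite lerD2l.
have PM n h : normc h <= d -> normc (P n).[z0 + h] <= M + 1.
  move=> hd; rewrite -[(P n).[_]](subrK (f (z0 + h))) addrC.
  apply: le_trans (le_normcD _ _) _; rewrite lerD ?fM// normcB.
  by apply: le_trans (n1 n); apply: fP; exact: dd.
have /choice[c cP] : forall n, exists c : R[i], normc c <= (M + 1) / d /\ forall h, normc h <= d / 2 ->
    normc ((P n).[z0 + h] - (P n).[z0] - c * h) <= 2 * (M + 1) * (normc h / d) ^+ 2.
  by move=> n; have [c] := poly_taylor d0 (PM n); exists c.
have [l ul] := ultralim (fun n => (cP n).1).
exists l.
  apply/ler_addgt0Pr => e e0; apply: ultra_const; near=> n.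
  rewrite -[l](subrK (c n)) addrC; apply: le_trans (le_normcD _ _) _.
  apply: lerD; first exact: (cP n).1.
  by rewrite normcB; near: n; exact: ul.
move=> h hd; apply/ler_addgt0Pr => e e0; apply: ultra_const.
have hd' : normc h <= d by lra.
have e3 : 0 < e / 3 by rewrite divr_gt0.
have e3' : 0 < e / 3 / (normc h + 1) by rewrite divr_gt0// ltr_wpDl ?normc_ge0.
near=> n.
have s1 : normc (f (z0 + h) - (P n).[z0 + h]) <= e / 3.
  apply: le_trans (fP n _ (dd _ hd')) _; apply: ltW; near: n; apply: Uoo.
  exact: near_infty_natSinv_lt (PosNum e3).
have s2 : normc (f z0 - (P n).[z0]) <= e / 3.
  have := fP n (z0 + 0); rewrite addr0 => /(_ _)/le_trans; apply.
    by rewrite lerDl ltW.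
  apply: ltW; near: n; apply: Uoo.
  exact: near_infty_natSinv_lt (PosNum e3).
have s3 : normc ((c n - l) * h) <= e / 3.
  rewrite normcM; apply: (@le_trans _ _ (e / 3 / (normc h + 1) * normc h)).
    by rewrite ler_wpM2r ?normc_ge0//; near: n; exact: ul.
  rewrite mulrAC ler_pdivrMr ?ltr_wpDl ?normc_ge0// ler_wpM2l// ?ltW//.
  by rewrite ltrDl.
rewrite (_ : f (z0 + h) - f z0 - l * h = (f (z0 + h) - (P n).[z0 + h]) - (f z0 - (P n).[z0]) +
  ((P n).[z0 + h] - (P n).[z0] - c n * h) + (c n - l) * h); last by ring.
have l1 := le_normcD (f (z0 + h) - (P n).[z0 + h] - (f z0 - (P n).[z0]) + ((P n).[z0 + h] - (P n).[z0] - c n * h)) ((c n - l) * h).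
have l2 := le_normcD (f (z0 + h) - (P n).[z0 + h] - (f z0 - (P n).[z0])) ((P n).[z0 + h] - (P n).[z0] - c n * h).
have l3 := ler_normcBD (f (z0 + h) - (P n).[z0 + h]) (f z0 - (P n).[z0]).
have l4 := (cP n).2 h hd; lra.
Unshelve. all: by end_near.
Qed.

Lemma locpoly_lip (f : R[i] -> R[i]) z0 (d M : R) : locpoly f -> 0 < d -> normc z0 + d < 1 ->
  (forall h, normc h <= d -> normc (f (z0 + h)) <= M) ->
  forall h, normc h <= d / 2 -> normc (f (z0 + h) - f z0) <= 2 * (M + 1) / d * normc h.
Proof.
move=> lf d0 zd fM h hd; have [c cM ct] := locpoly_taylor lf d0 zd fM.
have M0 : 0 <= M by apply: le_trans (normc_ge0 _) (fM 0 _); rewrite normc0 ltW.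
rewrite -[f (z0 + h) - f z0](subrK (c * h)).
apply: le_trans (le_normcD _ _) _; apply: le_trans (lerD (ct h hd) (lexx _)) _.
rewrite normcM; apply: (@le_trans _ _ (2 * (M + 1) * (normc h / d) ^+ 2 + (M + 1) / d * normc h)).
  by rewrite lerD2l ler_wpM2r ?normc_ge0.
set t := normc h / d; have t0 : 0 <= t by rewrite divr_ge0 ?normc_ge0 ?ltW.
have t2 : t <= 2^-1 by rewrite ler_pdivrMr// mulrC.
have -> : (M + 1) / d * normc h = (M + 1) * t by rewrite /t; ring.
have -> : 2 * (M + 1) / d * normc h = (M + 1) * (2 * t) by rewrite /t; ring.
have -> : 2 * (M + 1) * t ^+ 2 + (M + 1) * t = (M + 1) * (2 * t ^+ 2 + t) by ring.
by rewrite ler_wpM2l ?addr_ge0//; nra.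
Qed.

Lemma locpoly_analytic (f : R[i] -> R[i]) : locpoly f -> analytic_on_disc f.
Proof.
move=> lf z0; rewrite unit_discE => z1.
pose d := (1 - normc z0) / 2.
have d0 : 0 < d by rewrite divr_gt0// subr_gt0.
have zd : normc z0 + d < 1 by rewrite /d; lra.
have [M M0 fM] := locpoly_bounded lf zd.
have fM' h : normc h <= d -> normc (f (z0 + h)) <= M.
  by move=> hd; apply: fM; apply: le_trans (le_normcD _ _) _; rewrite lerD2l.
have [c _ ct] := locpoly_taylor lf d0 zd fM'.
apply/cvg_ex; exists c; apply/cvgrPdist_le => e e0 /=.
have eE : e = ((complex.Re e)%:C)%C.
  by move: e0; case: (e) => a b /=; rewrite ltcE/= => /andP[/eqP -> _].
have er0 : 0 < complex.Re e by move: e0; rewrite ltcE => /andP[].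
move: (complex.Re e) eE er0 => x -> x0 {e e0}.
pose A := 2 * (M + 1) / d ^+ 2.
have A0 : 0 < A by rewrite divr_gt0 ?exprn_gt0// mulr_gt0// ltr_wpDl.
pose y := Num.min (d / 2) (x / A).
have y0 : 0 < y by rewrite lt_min; apply/andP; split; rewrite divr_gt0.
have yC : 0 < (y%:C)%C by rewrite ltcR.
have n1 : \forall t \near (0 : R[i]^o)^', t != 0 by exact: nbhs_dnbhs_neq.
have n2 : \forall t \near (0 : R[i]^o)^', `|t| < (y%:C)%C by exact: dnbhs0_lt.
near=> t.
have t0 : t != 0 by near: t.
have ty : normc t < y.
  have : `|t : R[i]^o| < (y%:C)%C by near: t.
  by rewrite -[`|_|]/((normc t)%:C)%C ltcR.
have nt : 0 < normc t by rewrite normc_gt0.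
have [td tx] : normc t <= d / 2 /\ normc t <= x / A.
  by apply/andP; rewrite -le_min ltW.
have -> : c - t^-1 *: (f (t%:A + z0) - f z0) = - (t^-1 * (f (z0 + t) - f z0 - c * t)).
  rewrite [t%:A](_ : _ = t); last exact: mulr1.
  rewrite [X in c - X](_ : _ = t^-1 * (f (z0 + t) - f z0)); last by rewrite (addrC t).
  by field.
rewrite normrN -[`|_|]/((normc _)%:C)%C lecR normcM normcV ler_pdivrMl//.
apply: le_trans (ct t td) _.
have -> : 2 * (M + 1) * (normc t / d) ^+ 2 = normc t * (normc t * A) by rewrite /A; field; rewrite gt_eqF.
by rewrite ler_wpM2l ?normc_ge0// -ler_pdivlMr.
Unshelve. all: by end_near.
Qed.

(** The pointwise ultralimit [g] exists by boundedness. The functions are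
    equi-Lipschitz on smaller discs by [locpoly_lip], so convergence at the
    finitely many points of a fine grid gives uniform convergence. *)
Theorem montel (f : nat -> R[i] -> R[i]) : (forall n, locpoly (f n)) ->
  (forall r, r < 1 -> exists M, forall n z, normc z <= r -> normc (f n z) <= M) ->
  exists2 g, locpoly g & forall r e : R, r < 1 -> 0 < e ->
    \forall n \near U, forall z, normc z <= r -> normc (f n z - g z) <= e.
Proof.
move=> lf fM.
have /choice[g gP] : forall z, exists l, normc z < 1 -> forall e : R, 0 < e -> \forall n \near U, normc (f n z - l) <= e.
  move=> z; have [z1|z1] := ltP (normc z) 1; last by exists 0.
  have [M Mf] := fM _ z1; have [l ul] := ultralim (fun n => Mf n z (lexx _)).
  by exists l.
have main (r e : R) : r < 1 -> 0 < e -> \forall n \near U, forall z, normc z <= r -> normc (f n z - g z) <= e.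
  (* One d to leave room for grid points, another for the discs of the Lipschitz estimate. *)
  move=> r1 e0; pose d := (1 - r) / 4.
  have d0 : 0 < d by rewrite divr_gt0// subr_gt0.
  have rd : r + d + d < 1 by rewrite /d; lra.
  have [M Mf] := fM _ rd.
  pose L := 2 * (`|M| + 1) / d.
  have L0 : 0 < L by rewrite divr_gt0// mulr_gt0// ltr_wpDl.
  have lip n z h : normc z <= r + d -> normc h <= d / 2 -> normc (f n (z + h) - f n z) <= L * normc h.
    move=> zr hd; apply: locpoly_lip => //; first by apply: le_lt_trans rd; rewrite lerD2r.
    move=> k kd; apply: le_trans (ler_norm M); apply: Mf; apply: le_trans (le_normcD _ _) _.
    by apply: lerD.
  have [N N0 Ne] : exists2 N : nat, (0 < N)%N & 2 / N%:R <= Num.min (d / 2) (e / (3 * L)).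
    have m0 : 0 < Num.min (d / 2) (e / (3 * L)) / 2.
      by rewrite divr_gt0// lt_min; apply/andP; split; [rewrite divr_gt0|rewrite divr_gt0// mulr_gt0].
    have [N] := @filter_ex _ \oo _ _ (near_infty_natSinv_lt (PosNum m0)).
    by exists N.+1 => //; rewrite mulrC -ler_pdivlMr// ltW.
  pose pt (jk : 'I_(N.*2.+1) * 'I_(N.*2.+1)) : R[i] := ((jk.1%:R / N%:R - 1) +i* (jk.2%:R / N%:R - 1))%C.
  have grid z : normc z < 1 -> exists jk, normc (z - pt jk) <= 2 / N%:R.
    have NR : 0 < (N%:R : R) by rewrite ltr0n.
    have rnd (x : R) : `|x| < 1 -> exists j : 'I_(N.*2.+1), `|x - (j%:R / N%:R - 1)| <= N%:R^-1.
      rewrite ltr_norml => /andP[x0 x1].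
      have y0 : 0 <= (x + 1) * N%:R by rewrite mulr_ge0// -lerBlDr sub0r ltW.
      have /andP[jl jr] := truncn_itv y0.
      have jN : (Num.truncn ((x + 1) * N%:R)%R < N.*2.+1)%N.
        rewrite ltnS -(ler_nat R) (le_trans jl)// -muln2 natrM mulrC ler_wpM2l//.
        by lra.
      exists (Ordinal jN) => /=; set j := Num.truncn _ in jl jr *.
      have -> : x - (j%:R / N%:R - 1) = ((x + 1) * N%:R - j%:R) / N%:R by field; rewrite gt_eqF.
      rewrite normrM ger0_norm ?subr_ge0// gtr0_norm ?invr_gt0// ler_piMl ?invr_ge0//.
      by rewrite lerBlDl natr1 ltW.
    case: z => x y z1.
    have x1 : `|x| < 1.
      by apply: le_lt_trans z1; rewrite /= -sqrtr_sqr ler_wsqrtr// lerDl sqr_ge0.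
    have y1 : `|y| < 1.
      by apply: le_lt_trans z1; rewrite /= -sqrtr_sqr ler_wsqrtr// lerDr sqr_ge0.
    have [j jx] := rnd x x1; have [k ky] := rnd y y1; exists (j, k).
    have -> : 2 / N%:R = N%:R^-1 + N%:R^-1 :> R by rewrite mulrC mulrDr mulr1.
    apply: le_trans (lerD jx ky); rewrite /pt; exact: normc_le_re_im.
  have ex : \forall n \near U, forall jk, normc (pt jk) <= r + d -> normc (f n (pt jk) - g (pt jk)) <= e / 3.
    apply: filter_forall => jk; have [jr|jr] := leP (normc (pt jk)) (r + d); last exact: nearW.
    have j1 : normc (pt jk) < 1 by lra.
    have e3 : 0 < e / 3 by rewrite divr_gt0.
    by apply: filterS (gP _ j1 _ e3).
  apply: filterS ex => n ex z zr.
  have z1 : normc z < 1 by apply: le_lt_trans r1.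
  have [jk] := grid z z1; set w := pt jk => zw.
  have [zwd zwe] : normc (z - w) <= d / 2 /\ normc (z - w) <= e / (3 * L).
    by apply/andP; rewrite -le_min (le_trans zw).
  have wr : normc w <= r + d.
    have := ler_normcB w z; rewrite normcB; lra.
  have w1 : normc w < 1 by lra.
  have k1 m : normc (f m z - f m w) <= e / 3.
    rewrite -{1}[z](subrK w) (addrC (z - w) w); apply: le_trans (lip m _ _ wr zwd) _.
    apply: le_trans (ler_wpM2l (ltW L0) zwe) _.
    by rewrite le_eqVlt; apply/orP; left; apply/eqP; field; rewrite gt_eqF.
  have k2 : normc (g z - g w) <= e / 3.
    apply/ler_addgt0Pr => t t0; apply: ultra_const; have t2 : 0 < t / 2 by rewrite divr_gt0.
    near=> m.
    have a1 : normc (f m z - g z) <= t / 2 by near: m; exact: gP.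
    have a2 : normc (f m w - g w) <= t / 2 by near: m; exact: gP.
    rewrite (_ : g z - g w = (f m z - f m w) - (f m z - g z) + (f m w - g w)); last by ring.
    have l1 := le_normcD ((f m z - f m w) - (f m z - g z)) (f m w - g w).
    have l2 := ler_normcBD (f m z - f m w) (f m z - g z).
    have l3 := k1 m; lra.
  have k3 := ex jk wr; rewrite -/w in k3.
  rewrite (_ : f n z - g z = (f n z - f n w) + (f n w - g w) - (g z - g w)); last by ring.
  have l1 := ler_normcBD ((f n z - f n w) + (f n w - g w)) (g z - g w).
  have l2 := le_normcD (f n z - f n w) (f n w - g w).
  have l3 := k1 n; lra.
exists g => //; apply: locpoly_lim => r e r1 e0.
have [n fg] := @filter_ex _ _ (ultra_proper (F := U)) _ (main r e r1 e0).
by exists (f n) => // z zr; rewrite normcB fg.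
Unshelve. all: by end_near.
Qed.

End UltraLimits.

(** * Fractional powers of zero-free linear factors *)

Section FractionalPowers.
Variable R : realType.
Variables (U : set_system nat).
Context {UU : UltraFilter U}.
Hypothesis Uoo : \oo `<=` U.
Implicit Types (z w : R[i]).

Lemma locpoly_ext (f g : R[i] -> R[i]) : (forall z, unit_disc z -> f z = g z) ->
  locpoly f -> locpoly g.
Proof.
move=> fg lf r e r1 e0; have [P fP] := lf r e r1 e0; exists P => z zr.
by rewrite -fg ?fP// unit_discE (le_lt_trans zr).
Qed.

Lemma ultra_norm (u : nat -> R[i]) l (v : nat -> R) a :
  (forall e : R, 0 < e -> \forall n \near U, normc (u n - l) <= e) ->
  (forall n, normc (u n) = v n) -> v n @[n --> \oo] --> a -> normc l = a.
Proof.
move=> ul uv va.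
have : `|normc l - a| <= 0.
  apply/ler_addgt0Pr => e e0; rewrite add0r; apply: (ultra_const (U := U)).
  have e2 : 0 < e / 2 by rewrite divr_gt0.
  near=> n.
  have h1 : normc (u n - l) <= e / 2 by near: n; exact: ul.
  have h2 : `|a - v n| <= e / 2.
    by near: n; apply: Uoo; move/cvgrPdist_le: va; exact.
  have h3 := ler_normcB (u n) l; have h4 := ler_normcB l (u n); rewrite normcB in h4.
  rewrite -uv in h2; move: h2; rewrite !ler_norml => /andP[h5 h6]; apply/andP; split; lra.
by rewrite normr_le0 subr_eq0 => /eqP.
Unshelve. all: by end_near.
Qed.

Lemma ultra_mul (u v : nat -> R[i]) l m c :
  (forall e : R, 0 < e -> \forall n \near U, normc (u n - l) <= e) ->
  (forall e : R, 0 < e -> \forall n \near U, normc (v n - m) <= e) ->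
  (forall n, u n * v n = c) -> l * m = c.
Proof.
move=> ul vm uv; apply/eqP; rewrite -subr_eq0 -normc_eq0 eq_le normc_ge0 andbT.
apply/ler_addgt0Pr => e e0; rewrite add0r; apply: (ultra_const (U := U)).
have L0 : 0 < normc l + 1 by rewrite ltr_wpDl ?normc_ge0.
have M0 : 0 < normc m + 1 by rewrite ltr_wpDl ?normc_ge0.
have eL : 0 < e / 2 / (normc l + 1) by rewrite !divr_gt0.
have eM : 0 < e / 2 / (normc m + 1) by rewrite !divr_gt0.
near=> n.
have h1 : normc (v n - m) <= e / 2 / (normc l + 1) by near: n; exact: vm.
have h2 : normc (u n - l) <= e / 2 / (normc m + 1) by near: n; exact: ul.
have h3 : normc (v n - m) <= 1 by near: n; exact: vm.
rewrite -(uv n) (_ : l * m - u n * v n = - (l * (v n - m)) - (u n - l) * v n); last by ring.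
apply: le_trans (ler_normcBD _ _) _; rewrite normcN !normcM [leRHS](splitr e).
have vn : normc (v n) <= normc m + 1.
  by rewrite -[v n](subrK m) addrC; apply: le_trans (le_normcD _ _) _; rewrite lerD2l.
apply: lerD.
  apply: (@le_trans _ _ ((normc l + 1) * normc (v n - m))); first by rewrite ler_wpM2r ?normc_ge0// lerDl.
  by rewrite mulrC -ler_pdivlMr.
apply: (@le_trans _ _ (normc (u n - l) * (normc m + 1))); first by rewrite ler_wpM2l ?normc_ge0.
by rewrite -ler_pdivlMr.
Unshelve. all: by end_near.
Qed.

(** On compact subsets the values stay in a disc about 1 that avoids 0, which
    determines a branch of the square root of the same kind. *)
Definition locally_near_one (f : R[i] -> R[i]) := forall r : R, r < 1 -> exists rho, [/\ 0 <= rho, rho < 1 &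
  forall z, normc z <= r -> normc (1 - f z) <= rho].

(** The square root of [1 - x] is [1 - y] with [y = (x + y^2) / 2]. Iterating
    from [y = 0] stays within [1 - sqrt(1 - rho)], where the map is a
    contraction, and the iterates are polynomials in [x]. The limit along the
    ultrafilter comes from [montel] and is a fixed point because consecutive
    iterates approach each other. *)
Lemma locpoly_sqrt f : locpoly f -> locally_near_one f ->
  exists h, [/\ locpoly h, locally_near_one h & forall z, unit_disc z -> h z ^+ 2 = f z].
Proof.
move=> lf nf.
(* The iteration y -> (x + y^2) / 2 with x = 1 - f. *)
pose y := fix y n := if n is m.+1 then fun z => 2^-1 * ((1 - f z) + y m z * y m z) else fun z : R[i] => 0 : R[i].
have ly n : locpoly (y n).
  elim: n => [|n IH]; first exact: locpoly_cst.
  apply: locpolyM; first exact: locpoly_cst.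
  apply: locpolyD; last exact: locpolyM.
  apply: (@eq_locpoly _ (fun z => 1 + (-1) * f z)); first by move=> z; rewrite mulN1r.
  by apply: locpolyD; [exact: locpoly_cst|apply: locpolyM => //; exact: locpoly_cst].
have half : normc (2^-1 : R[i]) = 2^-1.
  have -> : (2^-1 : R[i]) = ((2^-1 : R)%:C)%C by rewrite fmorphV rmorph_nat.
  by rewrite normc_real gtr0_norm.
have bnd (r : R) : r < 1 -> exists Y, [/\ 0 <= Y, Y < 1, forall n z, normc z <= r -> normc (y n z) <= Y &
    forall n z, normc z <= r -> normc (y n.+1 z - y n z) <= Y ^+ n].
  move=> r1; have [rho [rho0 rho1 frho]] := nf r r1.
  pose Y := 1 - Num.sqrt (1 - rho).
  have s1 : Num.sqrt (1 - rho) <= 1 by rewrite -[leRHS]sqrtr1 ler_wsqrtr// gerBl.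
  have s0 : 0 < Num.sqrt (1 - rho) by rewrite sqrtr_gt0 subr_gt0.
  have s2 : Num.sqrt (1 - rho) ^+ 2 = 1 - rho by rewrite sqr_sqrtr// subr_ge0 ltW.
  have Y0 : 0 <= Y by rewrite subr_ge0.
  (* Y is the fixed point of the iteration for the bound rho. *)
  have YE : 2^-1 * (rho + Y * Y) = Y by rewrite /Y; lra.
  have yY n z : normc z <= r -> normc (y n z) <= Y.
    move=> zr; elim: n => [|n IH]; first by rewrite normc0.
    rewrite /= normcM half -[leRHS]YE ler_wpM2l//.
    apply: le_trans (le_normcD _ _) _; rewrite lerD ?frho// normcM.
    by rewrite ler_pM ?normc_ge0.
  exists Y; split => //; first by rewrite /Y; lra.
  elim=> [|n IH] z zr.
    rewrite expr0 subr0; apply: le_trans (yY 1%N z zr) _.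
    by rewrite /Y; lra.
  rewrite (_ : y n.+2 z - y n.+1 z = 2^-1 * ((y n.+1 z - y n z) * (y n.+1 z + y n z))); last by rewrite /=; ring.
  rewrite !normcM half exprS.
  have k1 : normc (y n.+1 z + y n z) <= 2 * Y.
    by rewrite mulr_natl mulr2n; apply: le_trans (le_normcD _ _) _; rewrite lerD ?yY.
  apply: (@le_trans _ _ (2^-1 * (Y ^+ n * (2 * Y)))); last by rewrite le_eqVlt; apply/orP; left; apply/eqP; field.
  by rewrite ler_wpM2l// ler_pM ?normc_ge0 ?IH.
have yM (r : R) : r < 1 -> exists M, forall n z, normc z <= r -> normc (y n z) <= M.
  by move=> /bnd[Y [_ _ yY _]]; exists Y.
have [g lg yg] := montel Uoo ly yM.
exists (fun z => 1 - g z); split.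
- apply: (@eq_locpoly _ (fun z => 1 + (-1) * g z)); first by move=> z; rewrite mulN1r.
  by apply: locpolyD; [exact: locpoly_cst|apply: locpolyM => //; exact: locpoly_cst].
- move=> r r1; have [Y [Y0 Y1 yY _]] := bnd r r1; exists Y; split => // z zr.
  rewrite opprB addrC subrK; apply/ler_addgt0Pr => e e0; apply: (ultra_const (U := U)); near=> n.
  rewrite -[g z](subrK (y n z)) addrC; apply: le_trans (le_normcD _ _) _; rewrite lerD ?yY//.
  rewrite normcB; move: z zr; near: n; exact: yg.
- move=> z; rewrite unit_discE => z1; have [Y [Y0 Y1 yY dY]] := bnd _ z1.
  suff h0 : g z - 2^-1 * (1 - f z + g z * g z) = 0.
    have -> : (1 - g z) ^+ 2 = f z - 2 * (g z - 2^-1 * (1 - f z + g z * g z)) by field.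
    by rewrite h0 mulr0 subr0.
  apply/eqP; rewrite -normc_eq0 eq_le normc_ge0 andbT.
  apply/ler_addgt0Pr => e e0; rewrite add0r; apply: (ultra_const (U := U)).
  pose e' := Num.min 1 (e / 4).
  have e'0 : 0 < e' by rewrite lt_min ltr01 divr_gt0.
  have yg' : \forall n \near U, normc (y n z - g z) <= e'.
    by apply: filterS (yg _ e' z1 e'0) => n; apply.
  near=> n.
  have k1 : normc (y n z - g z) <= e' by near: n.
  have k2 : Y ^+ n <= e / 4.
    near: n; apply: Uoo.
    have : (fun n : nat => Y ^+ n) @ \oo --> (0 : R) by apply: cvg_expr; rewrite ger0_norm.
    move/cvgrPdist_le => /(_ (e / 4)); rewrite divr_gt0// => /(_ isT).
    by apply: filterS => n; rewrite sub0r normrN ger0_norm ?exprn_ge0.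
  have k3 := dY n z (lexx _).
  have k1' : normc (y n z - g z) <= e / 4 by apply: le_trans k1 _; rewrite ge_min lexx orbT.
  have k1'' : normc (y n z - g z) <= 1 by apply: le_trans k1 _; rewrite ge_min lexx.
  have k4 : normc (y n z + g z) <= 3.
    have -> : y n z + g z = 2 * y n z - (y n z - g z) by ring.
    apply: le_trans (ler_normcBD _ _) _; rewrite normcM.
    have -> : normc (2 : R[i]) = 2 by rewrite -[2 in LHS](rmorph_nat (real_complex R)) normc_real ger0_norm.
    have := yY n z (lexx _); lra.
  rewrite (_ : g z - _ = - (y n z - g z) - (y n.+1 z - y n z) + 2^-1 * ((y n z - g z) * (y n z + g z))); last by rewrite /=; field.
  apply: le_trans (le_normcD _ _) _; apply: le_trans (lerD (ler_normcBD _ _) (lexx _)) _.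
  rewrite normcN !normcM half.
  have k5 : normc (y n z - g z) * normc (y n z + g z) <= e / 4 * 3 by rewrite ler_pM ?normc_ge0.
  have := le_trans k3 k2; lra.
Unshelve. all: by end_near.
Qed.

Lemma normc_linear_gt0 w z : normc w <= 1 -> unit_disc z -> 0 < normc (1 - w * z).
Proof.
rewrite unit_discE => w1 z1; apply: lt_le_trans (ler_normcB _ _).
by rewrite normc1 subr_gt0 normcM (le_lt_trans _ z1)// ler_piMl ?normc_ge0.
Qed.

Lemma locpoly_dyadic_root w n : normc w <= 1 ->
  exists2 h, locpoly h & forall z, unit_disc z -> h z ^+ (2 ^ n) = 1 - w * z.
Proof.
move=> w1; suff [h [lh _ hE]] : exists h, [/\ locpoly h, locally_near_one h &
    forall z, unit_disc z -> h z ^+ (2 ^ n) = 1 - w * z] by exists h.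
elim: n => [|n [h [lh nh hE]]].
  exists (fun z => 1 - w * z); split => [|r r1|z _]; last by rewrite expr1.
    apply: (@eq_locpoly _ (fun z => 1 + - w * z)); first by move=> z; rewrite mulNr.
    by apply: locpolyD; [exact: locpoly_cst|apply: locpolyM; [exact: locpoly_cst|exact: locpoly_id]].
  exists (Num.max 0 r); split; [by rewrite le_max lexx|by rewrite gt_max ltr01|].
  move=> z zr; rewrite opprB addrC subrK normcM le_max; apply/orP; right.
  by apply: le_trans zr; rewrite ler_piMl ?normc_ge0.
have [k [lk nk kE]] := locpoly_sqrt lh nh; exists k; split => // z z1.
by rewrite expnS exprM kE// hE.
Qed.

(** Dyadic exponents are powers of iterated square roots; general ones are
    limits of dyadic ones by [montel], the moduli being at most 2. Both factors
    are approximated simultaneously so that the product is preserved. *)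
Lemma locpoly_frac_pow w (s : R) : normc w <= 1 -> 0 <= s <= 1 ->
  exists G H, [/\ locpoly G, locpoly H & forall z, unit_disc z ->
    [/\ G z * H z = 1 - w * z, normc (G z) = normc (1 - w * z) `^ s &
        normc (H z) = normc (1 - w * z) `^ (1 - s)]].
Proof.
move=> w1 /andP[s0 s1].
have /choice[h hP] : forall n, exists h : R[i] -> R[i], locpoly h /\ forall z, unit_disc z -> h z ^+ (2 ^ n) = 1 - w * z.
  by move=> n; have [h] := locpoly_dyadic_root n w1; exists h.
pose m n := Num.truncn (s * (2 ^ n)%:R).
have pn0 n : 0 < ((2 ^ n)%:R : R) by rewrite ltr0n expn_gt0.
have mP n : (m n)%:R <= s * (2 ^ n)%:R < (m n).+1%:R by apply: truncn_itv; rewrite mulr_ge0// ltW.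
have m2 n : (m n <= 2 ^ n)%N.
  rewrite -(ler_nat R); have /andP[/le_trans + _] := mP n; apply.
  by rewrite ler_piMl// ltW.
pose t n : R := (m n)%:R / (2 ^ n)%:R.
have t0 n : 0 <= t n by rewrite divr_ge0// ltW.
have t1 n : t n <= 1 by rewrite ler_pdivrMr// mul1r ler_nat.
have ts : t n @[n --> \oo] --> s.
  apply/cvgrPdist_le => e e0; near=> n.
  have /andP[a b] := mP n.
  rewrite /t (_ : s - _ = (s * (2 ^ n)%:R - (m n)%:R) / (2 ^ n)%:R); last by field; rewrite gt_eqF.
  rewrite ger0_norm; last by rewrite divr_ge0 ?subr_ge0// ltW.
  apply: (@le_trans _ _ (1 / n.+1%:R)).
    apply: ler_pM; [by rewrite subr_ge0|by rewrite invr_ge0 ltW|by rewrite lerBlDl natr1 ltW|].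
    by rewrite lef_pV2 ?posrE ?ltr0n ?expn_gt0// ler_nat ltn_expl.
  by rewrite mul1r; apply: ltW; near: n; exact: near_infty_natSinv_lt (PosNum e0).
have powh n z k : unit_disc z -> (k <= 2 ^ n)%N -> normc (h n z ^+ k) = normc (1 - w * z) `^ (k%:R / (2 ^ n)%:R).
  move=> z1 k2; rewrite -((hP n).2 z z1) !normcX -!powR_mulrn ?normc_ge0// -powRrM.
  by rewrite mulrC divfK// gt_eqF.
have bnd n z k : unit_disc z -> (k <= 2 ^ n)%N -> normc (h n z ^+ k) <= 2.
  move=> z1 k2; rewrite powh//; apply: (@le_trans _ _ (2 `^ (k%:R / (2 ^ n)%:R))).
    apply: ge0_ler_powR; rewrite ?nnegrE ?normc_ge0 ?divr_ge0 ?(ltW (pn0 _))//.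
    apply: le_trans (ler_normcBD _ _) _; rewrite normc1 normcM -[leRHS]/(1 + 1) lerD2l.
    by rewrite mulr_ile1 ?normc_ge0// ltW.
  rewrite -[leRHS]powRr1//; apply: ler_powR; first by rewrite ler1n.
  by rewrite ler_pdivrMr// mul1r ler_nat.
have lX n k : locpoly (fun z => h n z ^+ k) by apply: locpolyX; exact: (hP n).1.
have bd (k : nat -> nat) : (forall n, (k n <= 2 ^ n)%N) -> forall r : R, r < 1 ->
    exists M, forall n z, normc z <= r -> normc (h n z ^+ k n) <= M.
  by move=> k2 r r1; exists 2 => n z zr; apply: bnd => //; rewrite unit_discE (le_lt_trans zr).
have m2' n : (2 ^ n - m n <= 2 ^ n)%N by rewrite leq_subr.
have [G lG GP] := montel Uoo (fun n => lX n (m n)) (bd _ m2).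
have [H lH HP] := montel Uoo (fun n => lX n (2 ^ n - m n)%N) (bd _ m2').
exists G, H; split => // z z1.
have x0 := normc_linear_gt0 w1 z1.
have Gz (e : R) : 0 < e -> \forall n \near U, normc (h n z ^+ m n - G z) <= e.
  by move=> e0; apply: filterS (GP _ e z1 e0) => n; apply.
have Hz (e : R) : 0 < e -> \forall n \near U, normc (h n z ^+ (2 ^ n - m n) - H z) <= e.
  by move=> e0; apply: filterS (HP _ e z1 e0) => n; apply.
have pc (v : nat -> R) l : v n @[n --> \oo] --> l -> normc (1 - w * z) `^ (v n) @[n --> \oo] --> normc (1 - w * z) `^ l.
  move=> vl; rewrite /powR gt_eqF//.
  apply: (@continuous_cvg _ _ _ _ _ _ (@expR R)); first exact: continuous_expR.
  by apply: cvgM => //; exact: cvg_cst.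
split.
- apply: (ultra_mul Gz Hz) => n; rewrite -exprD subnKC//; exact: (hP n).2.
- by apply: (ultra_norm Gz (v := fun n => normc (1 - w * z) `^ t n)) => [n|]; [exact: powh|exact: pc].
- apply: (ultra_norm Hz (v := fun n => normc (1 - w * z) `^ (1 - t n))) => [n|].
    by rewrite powh// natrB// /t; congr (_ `^ _); field; rewrite gt_eqF.
  by apply: pc; apply: cvgB => //; exact: cvg_cst.
Unshelve. all: by end_near.
Qed.

(** Geometric series. *)
Lemma locpoly_linear_inv w : normc w < 1 -> locpoly (fun z => (1 - w * z)^-1).
Proof.
move=> w1; apply: locpoly_lim => r e r1 e0.
have wr : 0 < 1 - normc w by rewrite subr_gt0.
have : (fun n : nat => normc w ^+ n) @ \oo --> (0 : R) by apply: cvg_expr; rewrite ger0_norm ?normc_ge0.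
move/cvgrPdist_le => /(_ (e * (1 - normc w))); rewrite mulr_gt0// => /(_ isT) /filter_ex[n].
rewrite sub0r normrN ger0_norm ?exprn_ge0 ?normc_ge0// => nE.
exists (fun z => (1 - (w * z) ^+ n) * (1 - w * z)^-1).
  apply: (@locpoly_ext (fun z => \sum_(i < n) (w * z) ^+ i)).
    move=> z z1; have -> : 1 - (w * z) ^+ n = (1 - w * z) * \sum_(i < n) (w * z) ^+ i.
      by rewrite -{1}(expr1n _ n) subrXX; congr (_ * _); apply: eq_bigr => i _; rewrite expr1n mul1r.
    by rewrite mulrAC mulfV ?mul1r// -normc_eq0 gt_eqF// normc_linear_gt0// ltW.
  elim: n {nE} => [|n IH]; first by apply: eq_locpoly (locpoly_cst 0) => z; rewrite big_ord0.
  apply: (@eq_locpoly _ (fun z => \sum_(i < n) (w * z) ^+ i + (w * z) ^+ n)).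
    by move=> z; rewrite big_ord_recr.
  apply: locpolyD => //; apply: locpolyX.
  by apply: locpolyM; [exact: locpoly_cst|exact: locpoly_id].
move=> z zr; have z1 : unit_disc z by rewrite unit_discE (le_lt_trans zr).
rewrite -{1}[(_)^-1]mul1r -mulrBl opprB addrC subrK normcM normcV ler_pdivrMr; last by apply: normc_linear_gt0 => //; exact: ltW.
have z1' := z1; rewrite unit_discE in z1'.
apply: (@le_trans _ _ (normc w ^+ n)).
  by rewrite normcX lerXn2r ?nnegrE ?normc_ge0// normcM ler_piMr ?normc_ge0// ltW.
apply: le_trans nE _; apply: ler_wpM2l; first exact: ltW.
apply: le_trans (ler_normcB _ _); by rewrite normc1 lerD2l lerN2 normcM ler_piMr ?normc_ge0// ltW.
Qed.

(** For [w] in the disc [b] is a Blaschke factor; for other [w] one writes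
    [z - w = - w (1 - z / w)] and [b] is trivial. *)
Lemma root_split w (s : R) : 0 <= s <= 1 -> exists G H b,
  [/\ locpoly G, locpoly H, locpoly b & forall z, unit_disc z ->
   [/\ G z * H z * b z = z - w, normc (G z) = outer_abs w z `^ s,
      normc (H z) = outer_abs w z `^ (1 - s) & normc (b z) = inner_abs w z]].
Proof.
move=> s01; rewrite /outer_abs /inner_abs; have [w1|w1] := ltP (normc w) 1.
  have cw1 : normc w^*%C <= 1 by rewrite normc_conj ltW.
  have [G [H [lG lH GH]]] := locpoly_frac_pow cw1 s01.
  exists G, H, (fun z => (z + - w) * (1 - w^*%C * z)^-1); split => //.
    apply: locpolyM; last by apply: locpoly_linear_inv; rewrite normc_conj.
    by apply: locpolyD; [exact: locpoly_id|exact: locpoly_cst].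
  move=> z z1; have [e1 e2 e3] := GH z z1; split => //.
    by rewrite e1 mulrC divfK// -normc_eq0 gt_eqF// normc_linear_gt0.
  by rewrite normcM normcV.
have w0 : 0 < normc w by apply: lt_le_trans w1.
have wn0 : w != 0 by rewrite -normc_gt0.
have cw1 : normc w^-1 <= 1 by rewrite normcV invf_le1.
have [G [H [lG lH GH]]] := locpoly_frac_pow cw1 s01.
pose a : R[i] := ((normc w `^ s)%:C)%C.
have a0 : 0 < normc w `^ s by rewrite powR_gt0.
have na : normc a = normc w `^ s by rewrite normc_real gtr0_norm.
have an0 : a != 0 by rewrite -normc_gt0 na.
exists (fun z => a * G z), (fun z => - w / a * H z), (fun=> 1); split.
- by apply: locpolyM => //; exact: locpoly_cst.
- by apply: locpolyM => //; exact: locpoly_cst.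
- exact: locpoly_cst.
move=> z z1; have [e1 e2 e3] := GH z z1.
have zE : normc (z - w) = normc w * normc (1 - w^-1 * z).
  by rewrite -normcM normcB; congr normc; field.
split; last by rewrite normc1.
- rewrite mulr1 (_ : a * G z * (- w / a * H z) = - w * (G z * H z)); last by field.
  by rewrite e1; field.
- by rewrite normcM na e2 zE powRM ?normc_ge0.
- rewrite !normcM normcN normcV na e3 zE powRM ?normc_ge0//; congr (_ * _).
  by rewrite powRD ?powRr1 ?normc_ge0 ?powRN//; apply/implyP => _; rewrite gt_eqF.
Qed.

End FractionalPowers.

(** * Factorization of polynomials *)

Section PolynomialFactorization.
Variable R : realType.
Variables (U : set_system nat).
Context {UU : UltraFilter U}.
Hypothesis Uoo : \oo `<=` U.
Local Notation PT := (measurableTypeR R * measurableTypeR R)%type.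
Implicit Types (z w c : R[i]).

(** A concave power lies below its tangent at 1; a case of Young's
    inequality. *)
Lemma powR_tangent (y t : R) : 0 <= y -> 0 < t < 1 -> y `^ t <= 1 - t * (1 - y).
Proof.
move=> y0 /andP[t0 t1].
have := @conjugate_powR R (y `^ t) 1 t^-1 (1 - t)^-1.
rewrite !powR_ge0 !invr_gt0 t0 subr_gt0 t1 !invrK subrKC => /(_ isT ler01 isT isT erefl).
by rewrite -powRrM mulfV ?gt_eqF// powRr1// powR1; lra.
Qed.

(** With [t = q / N < 1] and [y = x^N], [powR_tangent] bounds [x^q = y^t], and
    [1 + u <= exp u] does the rest. *)
Lemma bernoulli_weight (x p s q : R) (N : nat) : 0 <= x -> x <= 1 -> 0 < s -> s * q = p ->
  0 < q -> q < N%:R -> 1 - s + s * x `^ q <= expR (- (p * (1 - x ^+ N) / N%:R)).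
Proof.
move=> x0 x1 s0 sq q0 qN.
have N0 : 0 < (N%:R : R) by apply: lt_trans qN.
have xN0 : 0 <= x ^+ N by exact: exprn_ge0.
have t01 : 0 < q / N%:R < 1 by rewrite divr_gt0//= ltr_pdivrMr// mul1r.
have := powR_tangent xN0 t01.
rewrite -powR_mulrn// -powRrM mulrC divfK ?gt_eqF// => h.
apply: (@le_trans _ _ (1 + - (p * (1 - x `^ N%:R) / N%:R))); last exact: expR_ge1Dx.
rewrite -sq; have := ler_wpM2l (ltW s0) h.
set y := x `^ N%:R.
have -> : s * (1 - q / N%:R * (1 - y)) = s - s * q * (1 - y) / N%:R by field; rewrite gt_eqF.
by lra.
Qed.

Lemma measurable_outer_abs w : measurable_fun setT (fun u : PT => outer_abs w (cpt u)).
Proof.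
rewrite /outer_abs; case: (normc w < 1); apply: measurable_normc.
  apply: cmeasurableB; first exact: cmeasurable_cst.
  by apply: cmeasurableM; [exact: cmeasurable_cst|exact: cmeasurable_cpt].
by apply: cmeasurableB; [exact: cmeasurable_cpt|exact: cmeasurable_cst].
Qed.

Lemma measurable_inner_abs w : measurable_fun setT (fun u : PT => inner_abs w (cpt u)).
Proof.
rewrite /inner_abs; case: (normc w < 1); last exact: measurable_cst.
apply: measurable_funM.
  by apply: measurable_normc; apply: cmeasurableB; [exact: cmeasurable_cpt|exact: cmeasurable_cst].
apply: measurable_inv_ge0 => [u|]; first exact: normc_ge0.
apply: measurable_normc; apply: cmeasurableB; first exact: cmeasurable_cst.
by apply: cmeasurableM; [exact: cmeasurable_cst|exact: cmeasurable_cpt].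
Qed.

Lemma le_of_average (s : R) (a b c : \bar R) : (0 <= s <= 1)%R -> (0 <= a)%E -> (0 <= b)%E ->
  (s%:E * a + (1 - s)%:E * b <= c)%E -> (a <= c \/ b <= c)%E.
Proof.
move=> /andP[s0 s1] a0 b0 abc.
have s1' : (0 <= 1 - s)%R by rewrite subr_ge0.
have key (m : \bar R) : (0 <= m)%E -> (s%:E * m + (1 - s)%:E * m = m)%E.
  by move=> m0; rewrite -ge0_muleDl ?lee_fin// -EFinD subrKC mul1e.
have [ab|ba] := leP a b; [left|right].
  rewrite -[a]key//; apply: le_trans abc; apply: leeD => //.
  by apply: lee_wpmul2l; rewrite ?lee_fin.
rewrite -[b]key//; apply: le_trans abc; apply: leeD => //.
by apply: lee_wpmul2l; [rewrite lee_fin|exact: ltW].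
Qed.

Variables (p p1 p2 s : R).
Hypotheses (s01 : 0 < s < 1) (sp1 : s * p1 = p) (sp2 : (1 - s) * p2 = p).

Let fa w z := outer_abs w z `^ p * (1 - s + s * inner_abs w z `^ p1).
Let fb w z := outer_abs w z `^ p * (s + (1 - s) * inner_abs w z `^ p2).

Let wt (X : R[i] -> R) := measurable_fun setT (X \o @cpt R) /\ forall z, 0 <= X z.

Let s0 : 0 <= s. Proof. by case/andP: s01 => /ltW. Qed.
Let s1 : 0 <= 1 - s. Proof. by rewrite subr_ge0; case/andP: s01 => _ /ltW. Qed.

Let m_ell w q : measurable_fun setT (fun u : PT => outer_abs w (cpt u) `^ q).
Proof. by apply: measurable_powR_comp; exact: measurable_outer_abs. Qed.
Let m_bet w q : measurable_fun setT (fun u : PT => inner_abs w (cpt u) `^ q).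
Proof. by apply: measurable_powR_comp; exact: measurable_inner_abs. Qed.

Let wt_mul X (h : R[i] -> R) : wt X -> measurable_fun setT (fun u : PT => h (cpt u)) -> (forall z, 0 <= h z) ->
  wt (fun z => X z * h z).
Proof.
move=> [mX X0] mh h0; split => [|z]; last by rewrite mulr_ge0.
exact: (measurable_funM mX mh).
Qed.

Let fa0 w z : 0 <= fa w z.
Proof. by rewrite mulr_ge0 ?powR_ge0// addr_ge0// mulr_ge0// powR_ge0. Qed.
Let fb0 w z : 0 <= fb w z.
Proof. by rewrite mulr_ge0 ?powR_ge0// addr_ge0// mulr_ge0// powR_ge0. Qed.
Let mfa w : measurable_fun setT (fun u : PT => fa w (cpt u)).
Proof.
apply: measurable_funM; first exact: m_ell.
apply: measurable_funD; first exact: measurable_cst.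
by apply: measurable_funM; [exact: measurable_cst|exact: m_bet].
Qed.
Let mfb w : measurable_fun setT (fun u : PT => fb w (cpt u)).
Proof.
apply: measurable_funM; first exact: m_ell.
apply: measurable_funD; first exact: measurable_cst.
by apply: measurable_funM; [exact: measurable_cst|exact: m_bet].
Qed.

Let wt_prod X (f : R[i] -> R[i] -> R) ws : wt X -> (forall w, measurable_fun setT (fun u : PT => f w (cpt u))) ->
  (forall w z, 0 <= f w z) -> wt (fun z => X z * \prod_(w <- ws) f w z).
Proof.
move=> wX mf f0; apply: wt_mul => // [|z]; last by apply: prodr_ge0.
elim: ws => [|w ws IH].
  by under eq_fun do rewrite big_nil; exact: measurable_cst.
under eq_fun do rewrite big_cons.
exact: measurable_funM.
Qed.

Let wt_dmeas X : wt X -> dmeas (fun z => (X z)%:E).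
Proof. by move=> [mX _]; apply: dmeasT; exact/measurable_EFinP. Qed.

Let dcomb (a b : R) X Y : wt X -> wt Y -> 0 <= a -> 0 <= b ->
  (dint (fun z => (a * X z + b * Y z)%:E) = a%:E * dint (fun z => (X z)%:E) + b%:E * dint (fun z => (Y z)%:E))%E.
Proof.
move=> wX wY a0 b0; rewrite -(dintZl (wt_dmeas wX)) -?(dintZl (wt_dmeas wY))//; last 2 first.
- by move=> z _; rewrite lee_fin; case: wY.
- by move=> z _; rewrite lee_fin; case: wX.
rewrite -dintD//.
- by apply: measurable_funeM; exact: wt_dmeas.
- by apply: measurable_funeM; exact: wt_dmeas.
- by move=> z _; rewrite -EFinM lee_fin mulr_ge0//; case: wX.
- by move=> z _; rewrite -EFinM lee_fin mulr_ge0//; case: wY.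
Qed.

(** Method of conditional expectations. The Blaschke factor of the first zero
    goes either to [G] or to [H]; the bounds which the induction hypothesis gives
    in the two cases average, with weights [s] and [1 - s], to the bound to be
    proved, so one of the cases works. The weights [X] and [Y] are general in
    order to absorb the factors already distributed. *)
Lemma distribute_zeros ws X Y : wt X -> wt Y -> exists G H, [/\ locpoly G, locpoly H,
  forall z, unit_disc z -> G z * H z = \prod_(w <- ws) (z - w) &
  (s%:E * wint p1 X G + (1 - s)%:E * wint p2 Y H <=
   s%:E * dint (fun z => (X z * \prod_(w <- ws) fa w z)%:E) + (1 - s)%:E * dint (fun z => (Y z * \prod_(w <- ws) fb w z)%:E))%E].
Proof.
elim: ws X Y => [|w ws IH] X Y wX wY.
  exists (fun=> 1), (fun=> 1); split; try exact: locpoly_cst.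
    by move=> z _; rewrite big_nil mulr1.
  rewrite le_eqVlt; apply/orP; left; apply/eqP; congr (_ * _ + _ * _)%E; apply: eq_dint => z _;
    by rewrite big_nil normc1 powR1 mulr1 mul1r.
have s01' : 0 <= s <= 1 by rewrite s0/= -subr_ge0.
have [G0 [H0 [b [lG lH lb GHb]]]] := root_split Uoo w s01'.
pose XA z := X z * (outer_abs w z `^ p * inner_abs w z `^ p1).
pose XB z := X z * outer_abs w z `^ p.
pose YA z := Y z * outer_abs w z `^ p.
pose YB z := Y z * (outer_abs w z `^ p * inner_abs w z `^ p2).
have pp0 a q z : 0 <= outer_abs a z `^ q by exact: powR_ge0.
have wXA : wt XA by apply: wt_mul => // [|z]; [exact: measurable_funM|rewrite mulr_ge0 ?powR_ge0].
have wYB : wt YB by apply: wt_mul => // [|z]; [exact: measurable_funM|rewrite mulr_ge0 ?powR_ge0].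
have wXB : wt XB by exact: wt_mul.
have wYA : wt YA by exact: wt_mul.
have [GA [HA [lGA lHA GHA leA]]] := IH _ _ wXA wYA.
have [GB [HB [lGB lHB GHB leB]]] := IH _ _ wXB wYB.
set RA := (X in (_ <= X)%E) in leA; set RB := (X in (_ <= X)%E) in leB.
set RR := (X in exists G H, [/\ _, _, _ & (_ <= X)%E]).
have wpa X' : wt X' -> wt (fun z => X' z * \prod_(j <- ws) fa j z) by move=> ?; exact: wt_prod.
have wpb X' : wt X' -> wt (fun z => X' z * \prod_(j <- ws) fb j z) by move=> ?; exact: wt_prod.
have di0 X' : wt X' -> (0 <= dint (fun z => (X' z)%:E))%E.
  by move=> [_ X0]; apply: dint_ge0 => z _; rewrite lee_fin.
have avg : (s%:E * RA + (1 - s)%:E * RB = RR)%E.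
  have eX : dint (fun z => (X z * \prod_(j <- w :: ws) fa j z)%:E) =
     (s%:E * dint (fun z => (XA z * \prod_(j <- ws) fa j z)%:E) +
     (1 - s)%:E * dint (fun z => (XB z * \prod_(j <- ws) fa j z)%:E))%E.
    rewrite -(dcomb (wpa _ wXA) (wpa _ wXB))//; apply: eq_dint => z _; congr EFin.
    by rewrite big_cons /XA /XB {1}/fa; ring.
  have eY : dint (fun z => (Y z * \prod_(j <- w :: ws) fb j z)%:E) =
     (s%:E * dint (fun z => (YA z * \prod_(j <- ws) fb j z)%:E) +
     (1 - s)%:E * dint (fun z => (YB z * \prod_(j <- ws) fb j z)%:E))%E.
    rewrite -(dcomb (wpb _ wYA) (wpb _ wYB))//; apply: eq_dint => z _; congr EFin.
    by rewrite big_cons /YA /YB {1}/fb; ring.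
  rewrite /RR eX eY /RA /RB.
  have := (di0 _ (wpa _ wXA), di0 _ (wpa _ wXB), di0 _ (wpb _ wYA), di0 _ (wpb _ wYB)).
  move: (dint _) (dint _) (dint _) (dint _) => x1 x2 y1 y2 [[[x10 x20] y10] y20].
  have m0 (t : R) (x : \bar R) : 0 <= t -> (0 <= x)%E -> (0 <= t%:E * x)%E by move=> ? ?; rewrite mule_ge0.
  rewrite !ge0_muleDr ?m0// !muleA -!EFinM [(1 - s)%R * s]mulrC.
  by rewrite addeACA.
have [leR|leR] : ((s%:E * wint p1 XA GA + (1 - s)%:E * wint p2 YA HA <= RR) \/
   (s%:E * wint p1 XB GB + (1 - s)%:E * wint p2 YB HB <= RR))%E.
  apply: (@le_of_average s) => //.
  - by rewrite adde_ge0// mule_ge0// dint_ge0// => z _; rewrite lee_fin mulr_ge0 ?powR_ge0//; [case: wXA|case: wYA].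
  - by rewrite adde_ge0// mule_ge0// dint_ge0// => z _; rewrite lee_fin mulr_ge0 ?powR_ge0//; [case: wXB|case: wYB].
  - by rewrite -avg; apply: leeD; apply: lee_wpmul2l; rewrite ?lee_fin.
- exists (fun z => GA z * (G0 z * b z)), (fun z => HA z * H0 z); split.
  + by apply: locpolyM => //; exact: locpolyM.
  + exact: locpolyM.
  + by move=> z z1; rewrite big_cons -GHA//; have [<- _ _ _] := GHb z z1; ring.
  + apply: le_trans leR; rewrite le_eqVlt; apply/orP; left; apply/eqP.
    congr (_ * _ + _ * _)%E; apply: eq_dint => z z1; have [_ e1 e2 e3] := GHb z z1; congr EFin.
      rewrite !normcM !powRM ?mulr_ge0 ?normc_ge0// e1 e3 -powRrM sp1 /XA; ring.
    rewrite !normcM !powRM ?mulr_ge0 ?normc_ge0// e2 -powRrM sp2 /YA; ring.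
- exists (fun z => GB z * G0 z), (fun z => HB z * (H0 z * b z)); split.
  + exact: locpolyM.
  + by apply: locpolyM => //; exact: locpolyM.
  + by move=> z z1; rewrite big_cons -GHB//; have [<- _ _ _] := GHb z z1; ring.
  + apply: le_trans leR; rewrite le_eqVlt; apply/orP; left; apply/eqP.
    congr (_ * _ + _ * _)%E; apply: eq_dint => z z1; have [_ e1 e2 e3] := GHb z z1; congr EFin.
      rewrite !normcM !powRM ?mulr_ge0 ?normc_ge0// e1 -powRrM sp1 /XB; ring.
    rewrite !normcM !powRM ?mulr_ge0 ?normc_ge0// e2 e3 -powRrM sp2 /YB; ring.
Qed.

End PolynomialFactorization.

Section PolynomialFactorizationBound.
Variable R : realType.
Variables (U : set_system nat).
Context {UU : UltraFilter U}.
Hypothesis Uoo : \oo `<=` U.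
Variables (W : R[i] -> R) (Kw : R).
Hypothesis W_gt0 : forall z, unit_disc z -> 0 < W z.
Hypothesis W_ge0 : forall z, 0 <= W z.
Hypothesis mW : measurable_fun setT (W \o @cpt R).
Hypothesis Kw1 : 1 <= Kw.
Hypothesis W_inv : forall a z, unit_disc a -> unit_disc z ->
  normc (mobius a z) < 2^-1 -> W a <= Kw * W z.

(** [distribute_zeros], [bernoulli_weight] and [inner_penalty_bound]
    together; the leading coefficient is split into powers of its modulus. *)
Theorem poly_factor (p p1 p2 s : R) : 0 < p -> 0 < p1 -> 0 < p2 -> 0 < s < 1 ->
  s * p1 = p -> (1 - s) * p2 = p ->
  exists2 C : R, 0 < C & forall q : {poly R[i]}, exists G H : R[i] -> R[i],
    [/\ locpoly G, locpoly H, forall z, unit_disc z -> G z * H z = q.[z] &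
     (s%:E * wint p1 W G +
      (1 - s)%:E * wint p2 W H <=
      C%:E * dint (fun z => (normc q.[z] `^ p * W z)%:E))%E].
Proof.
move=> p0 p10 p20 s01 sp1 sp2; have /andP[s0 s1] := s01.
have s1' : 0 < 1 - s by rewrite subr_gt0.
(* The exponent N = k + 2 has to exceed both p1 and p2. *)
pose k := (Num.truncn (p1 + p2)).+2.
have kp : p1 + p2 < k.+2%:R.
  have /andP[_ /lt_trans] := truncn_itv (ltW (addr_gt0 p10 p20)); apply.
  by rewrite ltr_nat /k !ltnS leqW// leqW.
have [C C0 zc] := @inner_penalty_bound R W Kw W_gt0 W_ge0 mW Kw1 W_inv k p isT p0.
exists C => // q; have [c [ws qE]] := poly_root_prod q.
pose X z := normc c `^ p * W z.
have wX : measurable_fun setT (X \o @cpt R) /\ forall z, 0 <= X z.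
  by split => [|z]; [apply: measurable_funM => //; exact: measurable_cst|rewrite mulr_ge0 ?powR_ge0].
have [G [H [lG lH GH le]]] := distribute_zeros Uoo s01 sp1 sp2 ws wX wX.
pose c1 : R[i] := ((normc c `^ s)%:C)%C.
have nc1 : normc c1 = normc c `^ s by rewrite normc_real ger0_norm ?powR_ge0.
have c12 : c1 * (c / c1) = c.
  have [->|c0] := eqVneq c 0; first by rewrite mul0r mulr0.
  rewrite mulrC divfK// -normc_gt0 nc1 powR_gt0// normc_gt0//.
have nc2 : normc (c / c1) = normc c `^ (1 - s).
  rewrite normcM normcV nc1; have [->|c0] := eqVneq c 0.
    by rewrite normc0 mul0r powR0// gt_eqF.
  by rewrite powRD ?powRr1 ?normc_ge0 ?powRN//; apply/implyP => _; rewrite normc_eq0.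
exists (fun z => c1 * G z), (fun z => c / c1 * H z); split.
- by apply: locpolyM => //; exact: locpoly_cst.
- by apply: locpolyM => //; exact: locpoly_cst.
- move=> z z1; rewrite qE /root_prod -GH//.
  by rewrite -[in RHS]c12; ring.
have := zc c ws; set I := dint _; set J := dint _ => IJ.
have -> : dint (fun z => (normc q.[z] `^ p * W z)%:E) = J by apply: eq_dint => z _; rewrite qE.
apply: le_trans IJ.
have m0 x : 0 <= expR x :> R by exact: expR_ge0.
apply: (@le_trans _ _ (s%:E * I + (1 - s)%:E * I)%E); last first.
  rewrite -ge0_muleDl ?lee_fin ?(ltW s0) ?(ltW s1')// -EFinD subrKC mul1e//.
apply: le_trans (le_trans _ le) _.
  rewrite le_eqVlt; apply/orP; left; apply/eqP; congr (_ * _ + _ * _)%E; apply: eq_dint => z _; congr EFin.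
    by rewrite normcM powRM ?normc_ge0// nc1 -powRrM sp1 /X; ring.
  by rewrite normcM powRM ?normc_ge0// nc2 -powRrM sp2 /X; ring.
have fin (f : R[i] -> R[i] -> R) z : (forall w, unit_disc z -> 0 <= f w z) -> unit_disc z ->
   (forall w, f w z <= expR (- (p * (1 - inner_abs w z ^+ k.+2) / k.+2%:R))) ->
   ((X z * \prod_(w <- ws) (outer_abs w z `^ p * f w z))%:E <= (W z * (normc c `^ p * \prod_(w <- ws)
             (outer_abs w z `^ p * expR (- (p * (1 - inner_abs w z ^+ k.+2) / k.+2%:R)))))%:E)%E.
  move=> f0 z1 fe; rewrite lee_fin /X [normc c `^ p * W z]mulrC -mulrA.
  apply: ler_wpM2l => //; apply: ler_wpM2l; first exact: powR_ge0.
  apply: ler_prod => w _; rewrite mulr_ge0 ?powR_ge0 ?f0//=.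
  by rewrite ler_wpM2l ?powR_ge0.
have X0 := wX.2.
apply: leeD; apply: lee_wpmul2l; rewrite ?lee_fin ?(ltW s0) ?(ltW s1')//; apply: le_dint => z z1.
- rewrite lee_fin mulr_ge0// prodr_ge0// => w _; rewrite mulr_ge0 ?powR_ge0// addr_ge0 ?(ltW s1')// mulr_ge0 ?powR_ge0// ltW//.
- apply: (fin (fun w z => 1 - s + s * inner_abs w z `^ p1)) => // w.
    by move=> _; rewrite addr_ge0 ?(ltW s1')// mulr_ge0 ?powR_ge0// ltW.
  apply: bernoulli_weight => //; [exact: inner_abs_ge0|exact: inner_abs_le1|].
  by apply: lt_trans kp; rewrite ltrDl.
- rewrite lee_fin mulr_ge0// prodr_ge0// => w _; rewrite mulr_ge0 ?powR_ge0// addr_ge0 ?(ltW s0)// mulr_ge0 ?powR_ge0// ltW//.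
- apply: (fin (fun w z => s + (1 - s) * inner_abs w z `^ p2)) => // w.
    by move=> _; rewrite addr_ge0 ?(ltW s0)// mulr_ge0 ?powR_ge0// ltW.
  rewrite -{1}[s](subKr 1) ; apply: bernoulli_weight => //; [exact: inner_abs_ge0|exact: inner_abs_le1|].
  by apply: lt_trans kp; rewrite ltrDr.
Qed.
End PolynomialFactorizationBound.

(** * Borel measurability in the plane *)

Section PlaneTopology.
Variable R : realType.
Local Notation PT := (measurableTypeR R * measurableTypeR R)%type.
Local Notation Dp := (@cpt R @^-1` unit_disc).
Implicit Types (A : set R[i]) (z w : R[i]).

(** Openness for the modulus, stated by hand since the plane of the measure is
    [R * R]. *)
Definition open_plane A := forall z, A z -> exists2 d : R, 0 < d & forall w, normc (w - z) < d -> A w.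

Lemma rational_point_near z (d : R) : 0 < d -> exists q : rat * rat,
  normc (z - (ratr q.1 +i* ratr q.2)%C) < d.
Proof.
case: z => x y d0; have near (t : R) : exists q : rat, `|t - ratr q| < d / 2.
  have td : t - d / 2 < t + d / 2 by lra.
  have [q] := rat_in_itvoo td; rewrite inE /= => /itvP q12; exists q.
  by rewrite distrC ltr_distl !q12.
have [q1 h1] := near x; have [q2 h2] := near y; exists (q1, q2).
by apply: le_lt_trans (normc_le_re_im _ _ _ _) _; rewrite [ltRHS](splitr d) ltrD.
Qed.

(** An open set is the union of the balls with rational centre and radius [1/m]
    which it contains. *)
Lemma open_plane_measurable A : open_plane A -> measurable (@cpt R @^-1` A).
Proof.
move=> oA; pose ball (q : rat * rat * nat) := [set z : R[i] | normc (z - (ratr q.1.1 +i* ratr q.1.2)%C) < q.2.+1%:R^-1].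
pose F q := if `[< ball q `<=` A >] then ball q else set0.
have -> : @cpt R @^-1` A = \bigcup_q (@cpt R @^-1` F q).
  apply/seteqP; split => [u Au|u [q _]].
    have [d d0 dA] := oA _ Au; have d2 : 0 < d / 2 by rewrite divr_gt0.
    have [m /= md] := @filter_ex _ \oo _ _ (near_infty_natSinv_lt (PosNum d2)).
    have m0 : 0 < m.+1%:R^-1 :> R by rewrite invr_gt0 ltr0n.
    have [q qu] := rational_point_near (cpt u) m0.
    exists (q, m); first by [].
    rewrite /preimage /mkset /F asboolT//.
    move=> w; rewrite /ball /mkset => wq; apply: dA.
    rewrite -(subrKA (ratr q.1 +i* ratr q.2)%C); apply: le_lt_trans (le_normcD _ _) _.
    by rewrite [ltRHS](splitr d) (normcB _ (cpt u)) ltrD// (lt_trans _ md).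
  by rewrite /preimage /mkset /F; case: asboolP => // bA /bA.
apply: countable_bigcupT_measurable => [|q]; first exact: countableP.
rewrite /F.
case: ifP => _; last exact: measurable0.
have mb : measurable_fun setT (fun u : PT => normc (cpt u - (ratr q.1.1 +i* ratr q.1.2)%C)).
  by apply: measurable_normc; apply: cmeasurableB; [exact: cmeasurable_cpt|exact: cmeasurable_cst].
have := mb measurableT _ (measurable_itv `]-oo, (q.2.+1%:R^-1 : R)[); rewrite setTI.
by congr measurable; apply/seteqP; split => u /=; rewrite in_itv.
Qed.

Lemma dmeas_of_open (h : R[i] -> R) : (forall t, open_plane [set z | unit_disc z /\ t < h z]) ->
  measurable_fun Dp (h \o @cpt R).
Proof.
move=> oh mD; apply: (measurability _ (RGenOInfty.measurableE R)) => //.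
move=> /= _ [_ [t ->]] <-; have := open_plane_measurable (oh t).
by congr measurable; apply/seteqP; split => u /=; rewrite in_itv/= andbT.
Qed.

Definition disc_continuous (h : R[i] -> R[i]) := forall z, unit_disc z -> forall e : R, 0 < e ->
  exists2 d : R, 0 < d & forall w, normc (w - z) < d -> normc (h w - h z) <= e.

Lemma open_unit_disc z : unit_disc z -> exists2 d : R, 0 < d & forall w, normc (w - z) < d -> unit_disc w.
Proof.
rewrite unit_discE => z1; exists (1 - normc z); first by rewrite subr_gt0.
by move=> w wz; rewrite unit_discE; have := ler_normcB w z; lra.
Qed.

Lemma measurable_disc_normc (f : R[i] -> R[i]) : disc_continuous f ->
  measurable_fun Dp (fun u => normc (f (cpt u))).
Proof.
move=> cf; apply: (@dmeas_of_open (fun z => normc (f z))) => t z [z1 tz].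
have e0 : 0 < (normc (f z) - t) / 2 by rewrite divr_gt0// subr_gt0.
have [d d0 df] := cf z z1 _ e0; have [d' d'0 d'D] := open_unit_disc z1.
exists (Num.min d d'); first by rewrite lt_min d0.
move=> w; rewrite lt_min => /andP[wd wd']; split; first exact: d'D.
have := df w wd; have := ler_normcB (f z) (f w); rewrite normcB; lra.
Qed.

Lemma analytic_continuous (f : R[i] -> R[i]) : analytic_on_disc f -> disc_continuous f.
Proof.
move=> af z z1 e e0; have /derivable1_diffP /differentiable_continuous cf := af z z1.
have eC : 0 < (e%:C)%C by rewrite ltcR.
move/cvgrPdist_le : cf => /(_ _ eC); rewrite /= => /nbhs_ballP[d d0 H].
have dE : d = ((complex.Re d)%:C)%C.
  by move: d0; case: (d) => a b /=; rewrite ltcE/= => /andP[/eqP -> _].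
have dr0 : 0 < complex.Re d.
  have d0' : (0 : R[i]) < d by exact: d0.
  by move: d0'; rewrite ltcE => /andP[].
exists (complex.Re d) => // w wz; have := H w.
rewrite /ball /= -[`|z - w|]/((normc _)%:C)%C dE ltcR normcB => /(_ wz).
by rewrite -[`|f z - f w|]/((normc _)%:C)%C lecR normcB.
Qed.

End PlaneTopology.

(** * The regularized weight and local bounds *)

Section Envelope.
Variable R : realType.
Variables (w : R[i] -> R) (Kw : R).
Hypothesis w_gt0 : forall z, unit_disc z -> 0 < w z.
Hypothesis Kw1 : 1 <= Kw.
Hypothesis w_inv : forall a z, unit_disc a -> unit_disc z ->
  normc (mobius a z) < 2^-1 -> w a <= Kw * w z.

Let near_values z := [set w a | a in [set a | unit_disc a /\ normc (mobius a z) < 2^-1]].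
(** A supremum over a neighbourhood, so that the superlevel sets are open. By
    invariance it is comparable to [w]. *)
Definition envelope z := if normc z < 1 then sup (near_values z) else 0.

Let self z : unit_disc z -> near_values z (w z).
Proof. by move=> z1; exists z => //; split => //; rewrite /mobius subrr mul0r normc0 invr_gt0. Qed.

Let ubnd z : unit_disc z -> ubound (near_values z) (Kw * w z).
Proof. by move=> z1 _ [a [a1 az] <-]; exact: w_inv. Qed.

Let hsup z : unit_disc z -> has_sup (near_values z).
Proof. by move=> z1; split; [exists (w z); exact: self|exists (Kw * w z); exact: ubnd]. Qed.

Lemma le_envelope z : unit_disc z -> w z <= envelope z.
Proof. by move=> z1; rewrite /envelope (z1 : normc z < 1); apply: sup_upper_bound; [exact: hsup|exact: self]. Qed.

Lemma envelope_le z : unit_disc z -> envelope z <= Kw * w z.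
Proof.
move=> z1; rewrite /envelope (z1 : normc z < 1); apply: ge_sup; last exact: ubnd.
by exists (w z); exact: self.
Qed.

Lemma envelope_gt0 z : unit_disc z -> 0 < envelope z.
Proof. by move=> z1; apply: lt_le_trans (le_envelope z1); exact: w_gt0. Qed.

Lemma envelope_ge0 z : 0 <= envelope z.
Proof.
have [z1|z1] := ltP (normc z) 1; first by apply/ltW/envelope_gt0.
by rewrite /envelope ltNge z1.
Qed.

Lemma envelope_inv a z : unit_disc a -> unit_disc z ->
  normc (mobius a z) < 2^-1 -> envelope a <= Kw ^+ 2 * envelope z.
Proof.
move=> a1 z1 az; have K0 : 0 <= Kw by apply: le_trans Kw1.
apply: le_trans (envelope_le a1) _; rewrite expr2 -mulrA ler_wpM2l//.
by apply: le_trans (w_inv a1 z1 az) _; rewrite ler_wpM2l// le_envelope.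
Qed.

(** [z] can move a little while the point [a] at which [w] exceeds [t] is kept,
    the condition [|mobius a z| < 1/2] being open. *)
Lemma measurable_envelope : measurable_fun setT (envelope \o @cpt R).
Proof.
move=> _; apply: (measurability _ (RGenOInfty.measurableE R)) => //.
move=> /= _ [_ [t ->]] <-.
suff /open_plane_measurable : open_plane [set z | t < envelope z].
  by rewrite setTI; congr measurable; apply/seteqP; split => u /=; rewrite in_itv/= andbT.
move=> z /=; have [t0 tz|t0] := ltP t 0.
  by exists 1 => // v _; apply: lt_le_trans t0 (envelope_ge0 v).
rewrite {1}/envelope; case: ifPn => [z1|_]; last by rewrite ltNge t0.
move=> /(sup_gt _)[|_ [a [a1 az] <-] ta]; first by exists (w z); exact: self.
have a1' : normc a <= 1 by apply: ltW.
have den v : unit_disc v -> 0 < normc (1 - a^*%C * v) by move=> v1; exact: mobius_den_gt0.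
have az' : normc (a - z) < normc (1 - a^*%C * z) / 2.
  by move: az; rewrite normcM normcV ltr_pdivrMr ?den// mulrC.
have [d d0 dD] := open_unit_disc z1.
pose g := normc (1 - a^*%C * z) / 2 - normc (a - z).
have g0 : 0 < g by rewrite subr_gt0.
exists (Num.min d (g / 2)); first by rewrite lt_min d0 divr_gt0.
move=> v; rewrite lt_min => /andP[vd vg]; have v1 := dD v vd.
rewrite /envelope (v1 : normc v < 1); apply: lt_le_trans ta _.
apply: sup_upper_bound; [exact: hsup|exists a => //; split => //].
rewrite normcM normcV ltr_pdivrMr ?den// mulrC.
have h1 : normc (a - v) <= normc (a - z) + normc (v - z).
  by rewrite -(subrKA z) (normcB v) le_normcD.
have h2 : normc (1 - a^*%C * z) - normc (v - z) <= normc (1 - a^*%C * v).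
  rewrite lerBlDr (_ : 1 - a^*%C * z = (1 - a^*%C * v) + a^*%C * (v - z)); last by ring.
  apply: le_trans (le_normcD _ _) _; rewrite lerD2l normcM normc_conj ler_piMl ?normc_ge0//.
by rewrite /g in vg; lra.
Qed.

(** [weight_mobius_lower] with [a = 0]. *)
Lemma weight_lower_bound (r : R) : r < 1 -> exists2 m, 0 < m & forall z, normc z <= r -> m <= w z.
Proof.
move=> r1; have [M [C [C0 ch]]] := weight_mobius_lower w_gt0 Kw1 w_inv.
have D0 : unit_disc (0 : R[i]) by rewrite unit_discE normc0.
exists (C^-1 * (w 0 * (1 - r) ^+ M)).
  by rewrite !mulr_gt0 ?invr_gt0 ?w_gt0// exprn_gt0// subr_gt0.
move=> z zr; have z1 : unit_disc (- z) by rewrite unit_discE normcN (le_lt_trans zr).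
have := ch 0 (- z) D0 z1; rewrite normcN /mobius conjc0 mul0r subr0 divr1 sub0r opprK => h.
rewrite ler_pdivrMl//; apply: le_trans h; rewrite ler_wpM2l ?(ltW (w_gt0 _))//.
by rewrite lerXn2r ?nnegrE ?subr_ge0 ?(ltW r1)// ?lerD2l ?lerN2// (le_trans zr)// ltW.
Qed.

End Envelope.

Section LocalBound.
Variable R : realType.
Local Notation Dp := (@cpt R @^-1` unit_disc).
Local Notation K := (fine (disc_area R)).
Variables (W : R[i] -> R).
Hypothesis W_ge0 : forall z, 0 <= W z.
Hypothesis mW : measurable_fun setT (W \o @cpt R).
Hypothesis W_low : forall r : R, r < 1 -> exists2 m, 0 < m & forall z, normc z <= r -> m <= W z.

Lemma powR_add_le (x y s : R) : 0 <= x -> 0 <= y -> 0 < s ->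
  (x + y) `^ s <= 2 `^ s * (x `^ s + y `^ s).
Proof.
move=> x0 y0 s0; wlog xy : x y x0 y0 / x <= y.
  move=> h; have [/h|/ltW /h] := leP x y; first by apply.
  by rewrite addrC [_ `^ _ + _]addrC; apply.
apply: (@le_trans _ _ ((2 * y) `^ s)).
  apply: ge0_ler_powR; rewrite ?nnegrE ?addr_ge0 ?mulr_ge0 ?(ltW s0)//.
  by rewrite mulr_natl mulr2n lerD2r.
by rewrite powRM// ler_wpM2l ?powR_ge0// lerDr powR_ge0.
Qed.

Lemma dmeas_powR_weight (f : R[i] -> R[i]) s : measurable_fun Dp (fun u => normc (f (cpt u))) ->
  dmeas (fun z => (normc (f z) `^ s * W z)%:E).
Proof.
move=> mf; apply/measurable_EFinP; apply: measurable_funM; last exact: measurable_funTS.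
by apply: (@measurableT_comp _ _ _ _ _ _ (@powR R ^~ s)).
Qed.

Lemma locpoly_measurable (U : set_system nat) (UU : UltraFilter U) (Uoo : \oo `<=` U) (f : R[i] -> R[i]) :
  locpoly f -> measurable_fun Dp (fun u => normc (f (cpt u))).
Proof. by move=> lf; apply: measurable_disc_normc; apply: analytic_continuous; exact: (locpoly_analytic Uoo). Qed.

(** [submean] for a polynomial within distance 1 of [G]; the weight is bounded
    below on compact sets. *)
Lemma locpoly_local_bound (U : set_system nat) (UU : UltraFilter U) (Uoo : \oo `<=` U) (s r K0 : R) : 0 < s -> r < 1 -> 0 <= K0 ->
  exists M, forall G : R[i] -> R[i], locpoly G -> (wint s W G <= K0%:E)%E ->
   forall z, normc z <= r -> normc (G z) <= M.
Proof.
move=> s0 r1 K00; pose d := (1 - r) / 2.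
have d0 : 0 < d by rewrite divr_gt0// subr_gt0.
have rd : r + d < 1 by rewrite /d; lra.
have [m m0 Wm] := W_low rd.
have Kp := fine_disc_area_gt0 R.
pose B := (d ^+ 2 * K)^-1 * (2 `^ s / m * K0 + 2 `^ s * K).
exists (B `^ s^-1 + 1) => G lG GK b br.
have [P GP] := lG _ _ rd ltr01.
have P1 u : normc u <= r + d -> normc P.[u] <= normc (G u) + 1.
  move=> ur; rewrite -[P.[u]](subrK (G u)) addrC; apply: le_trans (le_normcD _ _) _.
  by rewrite lerD2l normcB GP.
have [c [ws PE]] := poly_root_prod P.
have bD v : normc v < 1 -> unit_disc (b + d%:C%C * v).
  move=> v1; rewrite unit_discE; apply: le_lt_trans (le_normcD _ _) _.
  rewrite normcM normc_real gtr0_norm//; apply: le_lt_trans rd; rewrite lerD//.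
  by rewrite ler_piMr// ltW.
have := @submean R c ws b d s s0 d0 bD; rewrite -PE => sm.
have mG := dmeas_powR_weight s (locpoly_measurable UU Uoo lG).
have G0 (z : R[i]) : unit_disc z -> (0 <= (normc (G z) `^ s * W z)%:E)%E.
  by rewrite lee_fin mulr_ge0 ?powR_ge0.
have sm2 : ((d ^+ 2 * K * normc P.[b] `^ s)%:E <= (2 `^ s / m * K0 + 2 `^ s * K)%:E)%E.
  apply: le_trans sm _.
  apply: (@le_trans _ _ (dint (fun u => (2 `^ s / m)%:E * (normc (G u) `^ s * W u)%:E + (2 `^ s)%:E)%E)).
    apply: le_dint => u u1; first by case: ifP => // _; rewrite lee_fin powR_ge0.
    have sm0 : 0 <= 2 `^ s / m by rewrite divr_ge0 ?powR_ge0 ?ltW.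
    case: ifPn => ub; last first.
      rewrite -EFinM -EFinD lee_fin; apply: addr_ge0; last exact: powR_ge0.
      by apply: mulr_ge0 => //; rewrite mulr_ge0 ?powR_ge0.
    have ur : normc u <= r + d.
      by have := ler_normcB u b; lra.
    rewrite -PE -EFinM -EFinD lee_fin; apply: (@le_trans _ _ ((normc (G u) + 1) `^ s)).
      by apply: ge0_ler_powR; rewrite ?nnegrE ?addr_ge0 ?normc_ge0 ?(ltW s0)// P1.
    apply: le_trans (powR_add_le _ _ s0) _; rewrite ?normc_ge0// powR1 mulrDr mulr1 lerD2r.
    rewrite -mulrA ler_wpM2l ?powR_ge0// ler_pdivlMl// mulrC ler_wpM2l ?powR_ge0//.
    exact: Wm.
  have s20 : 0 <= 2 `^ s :> R by rewrite powR_ge0.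
  have sm0 : 0 <= 2 `^ s / m by rewrite divr_ge0 ?powR_ge0 ?ltW.
  rewrite dintD.
  - rewrite dintZl// dint_cst// disc_area_fine -EFinM [leRHS]EFinD.
    apply: leeD => //; rewrite (EFinM (2 `^ s / m) K0).
    by apply: lee_wpmul2l; rewrite ?lee_fin.
  - exact: measurable_funeM.
  - exact: measurable_cst.
  - by move=> z z1; rewrite mule_ge0 ?lee_fin// -lee_fin G0.
  - by move=> z z1; rewrite lee_fin.
have PB : normc P.[b] <= B `^ s^-1.
  have sn0 : s != 0 by rewrite gt_eqF.
  rewrite -[leLHS]powRr1 ?normc_ge0// -(mulfV sn0) powRrM.
  apply: ge0_ler_powR; rewrite ?nnegrE ?powR_ge0 ?invr_ge0 ?(ltW s0)//.
    apply: mulr_ge0; first by rewrite invr_ge0; apply: mulr_ge0; [exact: sqr_ge0|exact: ltW].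
    by apply: addr_ge0; apply: mulr_ge0 => //; [apply: divr_ge0; [exact: powR_ge0|exact: ltW]|exact: ltW].
  by rewrite /B ler_pdivlMl; [rewrite lee_fin in sm2|rewrite mulr_gt0// exprn_gt0].
rewrite -[G b](subrK P.[b]) addrC; apply: le_trans (le_normcD _ _) _; rewrite lerD// GP//.
by apply: le_trans br _; rewrite lerDl ltW.
Qed.

End LocalBound.

(** * Passage to the limit *)

Section LimitFactorization.
Variable R : realType.
Local Notation Dp := (@cpt R @^-1` unit_disc).
Local Notation K := (fine (disc_area R)).
Variables (U : set_system nat).
Context {UU : UltraFilter U}.
Hypothesis Uoo : \oo `<=` U.
Variables (W : R[i] -> R) (Kw : R).
Hypothesis W_gt0 : forall z, unit_disc z -> 0 < W z.
Hypothesis W_ge0 : forall z, 0 <= W z.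
Hypothesis mW : measurable_fun setT (W \o @cpt R).
Hypothesis Kw1 : 1 <= Kw.
Hypothesis W_inv : forall a z, unit_disc a -> unit_disc z ->
  normc (mobius a z) < 2^-1 -> W a <= Kw * W z.

Let W_low (r : R) : r < 1 -> exists2 m, 0 < m & forall z, normc z <= r -> m <= W z.
Proof. exact: weight_lower_bound W_gt0 Kw1 W_inv r. Qed.

Lemma analyticB (f g : R[i] -> R[i]) : analytic_on_disc f -> analytic_on_disc g ->
  analytic_on_disc (fun z => f z - g z).
Proof. by move=> af ag z z1; apply: derivableB; [exact: af|exact: ag]. Qed.

Lemma analytic_measurable (f : R[i] -> R[i]) : analytic_on_disc f ->
  measurable_fun Dp (fun u => normc (f (cpt u))).
Proof. by move=> af; apply: measurable_disc_normc; exact: analytic_continuous. Qed.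

(** If [g] did not vanish at a point, [|g|^p W] would be bounded below on a
    disc about it. *)
Lemma integral0_eq0 (g : R[i] -> R[i]) (p : R) : 0 < p -> analytic_on_disc g ->
  (wint p W g <= 0)%E -> forall z, unit_disc z -> g z = 0.
Proof.
move=> p0 ag I0 z0 z1; apply/eqP; apply: contraT => gz.
have e0 : 0 < normc (g z0) / 2 by rewrite divr_gt0// normc_gt0.
have [d d0 dg] := analytic_continuous ag z1 e0; rewrite unit_discE in z1.
pose r := Num.min d ((1 - normc z0) / 2).
have r0 : 0 < r by rewrite lt_min d0 divr_gt0// subr_gt0.
have rd : r <= d by rewrite ge_min lexx.
have rz : r <= (1 - normc z0) / 2 by rewrite ge_min lexx orbT.
have zr : normc z0 + r < 1 by lra.
have [m m0 Wm] := W_low zr.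
pose c := (normc (g z0) / 2) `^ p * m.
have c0 : 0 < c by rewrite mulr_gt0// powR_gt0.
have bD v : normc v < 1 -> unit_disc (z0 + r%:C%C * v).
  move=> v1; rewrite unit_discE; apply: le_lt_trans (le_normcD _ _) _.
  rewrite normcM normc_real gtr0_norm//; apply: le_lt_trans zr; rewrite lerD2l.
  by rewrite ler_piMr// ltW.
have c0E (z : R[i]) : unit_disc z -> (0 <= c%:E)%E by rewrite lee_fin ltW.
have := @dint_affine R z0 r (fun=> c%:E) r0 bD (@measurable_cst _ _ _ _ _ _) c0E.
rewrite dint_cst ?(ltW c0)// disc_area_fine -!EFinM => e.
suff : ((r ^+ 2 * (c * K))%:E <= 0)%E.
  have P0 : 0 < r ^+ 2 * (c * K).
    by apply: mulr_gt0; [exact: exprn_gt0|apply: mulr_gt0 => //; exact: fine_disc_area_gt0].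
  by rewrite lee_fin leNgt P0.
rewrite -e; apply: le_trans I0; apply: le_dint => u u1; first by case: ifP => // _; rewrite lee_fin ltW.
case: ifPn => uz; last by rewrite lee_fin mulr_ge0 ?powR_ge0.
rewrite lee_fin; apply: ler_pM => //; [exact: powR_ge0|exact: ltW| |].
  apply: ge0_ler_powR; rewrite ?nnegrE ?normc_ge0 ?(ltW p0) ?(ltW e0)//.
  have := dg u (lt_le_trans uz rd); have := ler_normcB (g z0) (g u); rewrite normcB; lra.
by apply: Wm; have := ler_normcB u z0; lra.
Qed.

Lemma cvg_normc_powR (x : nat -> R[i]) (l : R[i]) (q : R) : 0 < q ->
  (forall e : R, 0 < e -> \forall n \near \oo, normc (x n - l) <= e) ->
  normc (x n) `^ q @[n --> \oo] --> normc l `^ q.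
Proof.
move=> q0 xl.
have nl : normc (x n) @[n --> \oo] --> normc l.
  apply/cvgrPdist_le => e e0; have := xl e e0; apply: filterS => n h.
  have h1 := ler_normcB (x n) l; have h2 := ler_normcB l (x n); rewrite normcB in h2.
  by rewrite ler_norml; apply/andP; split; lra.
have [l0|l0] := eqVneq (normc l) 0.
  rewrite l0 powR0 ?gt_eqF//; apply/cvgrPdist_le => e e0.
  have e'0 : 0 < e `^ q^-1 by rewrite powR_gt0.
  move/cvgrPdist_le : nl => /(_ _ e'0); apply: filterS => n.
  rewrite l0 !sub0r !normrN !ger0_norm ?normc_ge0 ?powR_ge0// => h.
  rewrite -[e]powRr1 ?(ltW e0)// -[X in e `^ X](mulVf (_ : q != 0)) ?gt_eqF// powRrM.
  by apply: ge0_ler_powR; rewrite ?nnegrE ?normc_ge0 ?powR_ge0 ?(ltW q0).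
have lp : 0 < normc l by rewrite lt_def l0 normc_ge0.
have -> : normc l `^ q = expR (q * ln (normc l)) by rewrite /powR (negbTE l0).
have : expR (q * ln (normc (x n))) @[n --> \oo] --> expR (q * ln (normc l)).
  apply: (@continuous_cvg _ _ _ _ _ _ (@expR R)); first exact: continuous_expR.
  apply: cvgM; first exact: cvg_cst.
  by apply: (@continuous_cvg _ _ _ _ _ _ (@ln R)) => //; exact: continuous_ln.
apply: cvg_trans; apply: near_eq_cvg.
have l2 : 0 < normc l / 2 by rewrite divr_gt0.
move/cvgrPdist_le : nl => /(_ _ l2); apply: filterS => n.
rewrite ler_norml => /andP[_ h]; rewrite /powR gt_eqF//; lra.
Qed.

(** The factors of approximating polynomials are locally bounded by
    [locpoly_local_bound], so [montel] applies to both along the same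
    ultrafilter; a sequence converging on all compact sets is then extracted for
    Fatou's lemma. Fatou's lemma also shows that [|f - G H|^p W] has integral
    zero, which identifies the product. *)
Theorem limit_factor (p p1 p2 s : R) : 0 < p -> 0 < p1 -> 0 < p2 -> 0 < s < 1 ->
  s * p1 = p -> (1 - s) * p2 = p ->
  exists2 C : R, 0 < C & forall f : R[i] -> R[i], analytic_on_disc f ->
    (wint p W f < +oo)%E ->
    (forall e : R, 0 < e -> exists q : {poly R[i]}, (dint (fun z => (normc (f z - q.[z]) `^ p * W z)%:E) <= e%:E)%E) ->
    exists G H : R[i] -> R[i],
    [/\ locpoly G, locpoly H, forall z, unit_disc z -> f z = G z * H z &
     (s%:E * wint p1 W G +
      (1 - s)%:E * wint p2 W H <=
      C%:E * wint p W f)%E].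
Proof.
move=> p0 p10 p20 s01 sp1 sp2; have /andP[s0 s1] := s01.
have s1' : 0 < 1 - s by rewrite subr_gt0.
have [C0 C00 fac] := @poly_factor R U UU Uoo W Kw W_gt0 W_ge0 mW Kw1 W_inv p p1 p2 s p0 p10 p20 s01 sp1 sp2.
have pw0 : 0 < 2 `^ p :> R by rewrite powR_gt0.
exists (C0 * 2 `^ p); first by rewrite mulr_gt0.
move=> f af If dens.
have di0 (g : R[i] -> R[i]) q : (0 <= wint q W g)%E.
  by apply: dint_ge0 => z _; rewrite lee_fin mulr_ge0 ?powR_ge0.
have i0 (g : R[i] -> R[i]) q (z : R[i]) : unit_disc z -> (0 <= (normc (g z) `^ q * W z)%:E)%E.
  by rewrite lee_fin mulr_ge0 ?powR_ge0.
have mes (g : R[i] -> R[i]) q : analytic_on_disc g -> dmeas (fun z => (normc (g z) `^ q * W z)%:E).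
  by move=> ag; apply: (dmeas_powR_weight mW); exact: analytic_measurable.
have la (g : R[i] -> R[i]) : locpoly g -> analytic_on_disc g by exact: locpoly_analytic.
have mes2 (g : R[i] -> R[i]) q : locpoly g -> dmeas (fun z => (normc (g z) `^ q * W z)%:E) by move=> lg; apply: mes; exact: la.
have IE : (wint p W f = (fine (wint p W f))%:E)%E.
  by rewrite fineK// ge0_fin_numE.
set I := fine _ in IE; have I0 : 0 <= I by rewrite -lee_fin -IE.
rewrite IE.
have n0 (n : nat) : 0 < n.+1%:R^-1 :> R by rewrite invr_gt0 ltr0n.
have /choice[q qf] n := dens _ (n0 n).
have qI n : (dint (fun z => (normc (q n).[z] `^ p * W z)%:E) <= (2 `^ p * (I + n.+1%:R^-1))%:E)%E.
  have aq : analytic_on_disc (fun z => f z - (q n).[z]).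
    have lq : locpoly (fun z => (q n).[z]) by exact: locpoly_poly.
    have := analyticB af (la _ lq). exact.
  rewrite EFinM EFinD; apply: (@le_trans _ _ ((2 `^ p)%:E * (wint p W f +
      dint (fun z => (normc (f z - (q n).[z]) `^ p * W z)%:E)))%E); last first.
    by apply: lee_wpmul2l; rewrite ?lee_fin ?(ltW pw0)// IE leeD.
  rewrite -(dintD (mes _ _ af) (mes _ _ aq) (i0 _ _) (i0 _ _)).
  rewrite -dintZl ?(ltW pw0)//; last 2 first.
  - by apply: emeasurable_funD; [exact: (mes _ _ af)|exact: (mes _ _ aq)].
  - by move=> z z1; rewrite adde_ge0 ?i0//; exact: (i0 (fun z => f z - (q n).[z])).
  apply: le_dint => z z1; first exact: (i0 (fun z => (q n).[z])).
  rewrite -EFinD -EFinM lee_fin -mulrDl mulrA ler_wpM2r//.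
  apply: le_trans (powR_add_le _ _ p0); rewrite ?normc_ge0//.
  apply: ge0_ler_powR; rewrite ?nnegrE ?addr_ge0 ?normc_ge0 ?(ltW p0)//.
  by rewrite -{1}[(q n).[z]](subKr (f z)); exact: ler_normcBD.
have /choice[GH GHP] : forall n, exists GH : (R[i] -> R[i]) * (R[i] -> R[i]),
    [/\ locpoly GH.1, locpoly GH.2, forall z, unit_disc z -> GH.1 z * GH.2 z = (q n).[z] &
     (s%:E * wint p1 W GH.1 +
      (1 - s)%:E * wint p2 W GH.2 <=
      (C0 * 2 `^ p * (I + n.+1%:R^-1))%:E)%E].
  move=> n; have [G [H [lG lH e b]]] := fac (q n); exists (G, H); split => //=.
  by apply: le_trans b _; rewrite -mulrA (EFinM C0) lee_wpmul2l ?lee_fin ?(ltW C00)// qI.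
pose A := C0 * 2 `^ p * (I + 1).
have A0 : 0 <= A by rewrite mulr_ge0 ?addr_ge0// mulr_ge0 ?(ltW C00) ?(ltW pw0).
have C2 : 0 <= C0 * 2 `^ p by rewrite mulr_ge0 ?(ltW C00) ?(ltW pw0).
have An n : C0 * 2 `^ p * (I + n.+1%:R^-1) <= A.
  by rewrite ler_wpM2l// lerD2l invf_le1// ler1n.
have key (t : R) (x : \bar R) : 0 < t -> (0 <= x)%E -> (t%:E * x <= A%:E)%E -> (x <= (A / t)%:E)%E.
  by move=> t0 x0; rewrite (mulrC A) (EFinM t^-1) lee_pdivlMl.
have bG n : (wint p1 W (GH n).1 <= (A / s)%:E)%E.
  have [_ _ _ b] := GHP n; apply: key => //.
  apply: (@le_trans _ _ (C0 * 2 `^ p * (I + n.+1%:R^-1))%:E); last by rewrite lee_fin.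
  by apply: le_trans b; rewrite leeDl// mule_ge0// lee_fin ltW.
have bH n : (wint p2 W (GH n).2 <= (A / (1 - s))%:E)%E.
  have [_ _ _ b] := GHP n; apply: key => //.
  apply: (@le_trans _ _ (C0 * 2 `^ p * (I + n.+1%:R^-1))%:E); last by rewrite lee_fin.
  by apply: le_trans b; rewrite leeDr// mule_ge0// lee_fin ltW.
have lGn n : locpoly (GH n).1 by case: (GHP n).
have lHn n : locpoly (GH n).2 by case: (GHP n).
have As : 0 <= A / s by rewrite divr_ge0// ltW.
have As' : 0 <= A / (1 - s) by rewrite divr_ge0// ltW.
have [G lG GP] : exists2 g, locpoly g & forall r e : R, r < 1 -> 0 < e ->
    \forall n \near U, forall z, normc z <= r -> normc ((GH n).1 z - g z) <= e.
  apply: montel => // r r1.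
  have [M MP] := @locpoly_local_bound R W W_ge0 mW W_low U UU Uoo p1 r _ p10 r1 As.
  by exists M => n; exact: MP.
have [H lH HP] : exists2 g, locpoly g & forall r e : R, r < 1 -> 0 < e ->
    \forall n \near U, forall z, normc z <= r -> normc ((GH n).2 z - g z) <= e.
  apply: montel => // r r1.
  have [M MP] := @locpoly_local_bound R W W_ge0 mW W_low U UU Uoo p2 r _ p20 r1 As'.
  by exists M => n; exact: MP.
(* The k-th set of indices is in the ultrafilter, hence contains some n >= k. *)
have /choice[nu nuP] : forall k, exists n, [/\ (k <= n)%N,
   forall z, normc z <= 1 - k.+1%:R^-1 -> normc ((GH n).1 z - G z) <= k.+1%:R^-1 &
   forall z, normc z <= 1 - k.+1%:R^-1 -> normc ((GH n).2 z - H z) <= k.+1%:R^-1].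
  move=> k; have k1 : 1 - k.+1%:R^-1 < 1 :> R by rewrite gtrBl.
  apply: (@filter_ex _ U _); near=> n; split.
  - by near: n; apply: Uoo; exact: nbhs_infty_ge.
  - by near: n; exact: GP.
  - by near: n; exact: HP.
have ev (z : R[i]) (e : R) : unit_disc z -> 0 < e -> \forall k \near \oo, normc z <= 1 - k.+1%:R^-1 /\ (k.+1%:R^-1 <= e).
  rewrite unit_discE => z1 e0; have z10 : 0 < 1 - normc z by rewrite subr_gt0.
  near=> k; split; last by apply: ltW; near: k; exact: near_infty_natSinv_lt (PosNum e0).
  rewrite lerBrDl -lerBrDr; apply: ltW; near: k; exact: near_infty_natSinv_lt (PosNum z10).
have cG (z : R[i]) (e : R) : unit_disc z -> 0 < e -> \forall k \near \oo, normc ((GH (nu k)).1 z - G z) <= e.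
  move=> z1 e0; have := ev z e z1 e0; apply: filterS => k [zk ke].
  by have [_ h _] := nuP k; apply: le_trans (h z zk) ke.
have cH (z : R[i]) (e : R) : unit_disc z -> 0 < e -> \forall k \near \oo, normc ((GH (nu k)).2 z - H z) <= e.
  move=> z1 e0; have := ev z e z1 e0; apply: filterS => k [zk ke].
  by have [_ _ h] := nuP k; apply: le_trans (h z zk) ke.
have nuk k : (nu k).+1%:R^-1 <= k.+1%:R^-1 :> R.
  by rewrite lef_pV2 ?posrE ?ltr0n// ler_nat ltnS; have [] := nuP k.
have sh (u : nat -> R) l N : u n @[n --> \oo] --> l -> (fun n => (u (n + N)%N)%:E) @ \oo --> l%:E.
  by move=> ul; apply: cvg_EFin; [exact: nearW|rewrite /=; have := ul; rewrite -(cvg_shiftn N)].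
have cmb (g h : R[i] -> R[i]) : locpoly g -> locpoly h ->
   (s%:E * wint p1 W g + (1 - s)%:E * wint p2 W h =
   dint (fun z => (s * (normc (g z) `^ p1 * W z) + (1 - s) * (normc (h z) `^ p2 * W z))%:E))%E.
  move=> lg lh; rewrite -(dintZl (mes2 _ _ lg) (i0 _ _) (ltW s0)) -(dintZl (mes2 _ _ lh) (i0 _ _) (ltW s1')) -dintD//.
  - by apply: measurable_funeM; exact: mes2.
  - by apply: measurable_funeM; exact: mes2.
  - by move=> z z1; apply: mule_ge0; [rewrite lee_fin ltW|exact: i0].
  - by move=> z z1; apply: mule_ge0; [rewrite lee_fin ltW|exact: i0].
have mcmb (g h : R[i] -> R[i]) : locpoly g -> locpoly h ->
   dmeas (fun z => (s * (normc (g z) `^ p1 * W z) + (1 - s) * (normc (h z) `^ p2 * W z))%:E).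
  move=> lg lh; apply/measurable_EFinP; apply: measurable_funD; apply: measurable_funM; try exact: measurable_cst.
    by apply/measurable_EFinP; exact: (mes2 _ p1 lg).
  by apply/measurable_EFinP; exact: (mes2 _ p2 lh).
have cmb0 (g h : R[i] -> R[i]) z : (0 <= (s * (normc (g z) `^ p1 * W z) + (1 - s) * (normc (h z) `^ p2 * W z))%:E)%E.
  by rewrite lee_fin; apply: addr_ge0; apply: mulr_ge0; rewrite ?(ltW s0) ?(ltW s1')// mulr_ge0 ?powR_ge0.
exists G, H; split => //.
  have aGH : analytic_on_disc (fun z => f z - G z * H z) := analyticB af (la _ (locpolyM lG lH)).
  suff I00 : (dint (fun z => (normc (f z - G z * H z) `^ p * W z)%:E) <= 0)%E.
    by move=> z z1; apply/eqP; rewrite -subr_eq0; apply/eqP; exact: (integral0_eq0 p0 aGH I00).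
  apply/lee_addgt0Pr => e e0; rewrite add0e.
  have [N /= /ltW Ne] := @filter_ex _ \oo _ _ (near_infty_natSinv_lt (PosNum e0)).
  have aq n : analytic_on_disc (fun z => f z - (q n).[z]).
    have lq : locpoly (fun z => (q n).[z]) by exact: locpoly_poly.
    exact: (analyticB af (la _ lq)).
  apply: (@dint_fatou R [::] (fun k z => (normc (f z - (q (nu (k + N)%N)).[z]) `^ p * W z)%:E)).
  - by move=> k; exact: (mes _ p (aq _)).
  - by move=> k z z1; exact: (i0 (fun z => f z - (q (nu (k + N)%N)).[z]) p).
  - exact: (mes _ p aGH).
  - by move=> z z1; exact: (i0 (fun z => f z - G z * H z) p).
  - move=> z z1 _; eexists; first by move=> n; exact: lexx.
    apply: (sh (fun k => normc (f z - (q (nu k)).[z]) `^ p * W z)).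
    apply: cvgM; last exact: cvg_cst.
    apply: cvg_normc_powR => // t t0.
    pose d := Num.min 1 (t / (normc (G z) + normc (H z) + 1)).
    have S0 : 0 < normc (G z) + normc (H z) + 1 by rewrite ltr_wpDl// addr_ge0 ?normc_ge0.
    have d0 : 0 < d by rewrite lt_min ltr01 divr_gt0.
    near=> k.
    have h1 : normc ((GH (nu k)).1 z - G z) <= d by near: k; exact: cG.
    have h2 : normc ((GH (nu k)).2 z - H z) <= d by near: k; exact: cH.
    have d1 : d <= 1 by rewrite ge_min lexx.
    have dt : d * (normc (G z) + normc (H z) + 1) <= t by rewrite -ler_pdivlMr// ge_min lexx orbT.
    have [_ _ e2 _] := GHP (nu k); rewrite -e2//.
    set x := (GH (nu k)).1 z in h1 *; set y := (GH (nu k)).2 z in h2 *.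
    rewrite (_ : f z - x * y - (f z - G z * H z) = - ((x - G z) * (y - H z) + (x - G z) * H z + (y - H z) * G z)); last by ring.
    rewrite normcN; apply: le_trans dt; apply: le_trans (le_normcD _ _) _.
    apply: le_trans (lerD (le_normcD _ _) (lexx _)) _; rewrite !normcM.
    rewrite (_ : d * _ = d * 1 + d * normc (H z) + d * normc (G z)); last by ring.
    apply: lerD; last by rewrite ler_wpM2r ?normc_ge0.
    apply: lerD; last by rewrite ler_wpM2r ?normc_ge0.
    by rewrite ler_pM ?normc_ge0// (le_trans h2).
  - move=> k; apply: le_trans (qf _) _; rewrite lee_fin; apply: le_trans (nuk _) _; apply: le_trans Ne.
    by rewrite lef_pV2 ?posrE ?ltr0n// ler_nat ltnS leq_addl.
apply/lee_addgt0Pr => e e0.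
have CC : 0 < C0 * 2 `^ p by rewrite mulr_gt0.
have eC : 0 < e / (C0 * 2 `^ p) by rewrite divr_gt0.
have [N /= /ltW Ne] := @filter_ex _ \oo _ _ (near_infty_natSinv_lt (PosNum eC)).
rewrite cmb//.
apply: (@dint_fatou R [::] (fun k z => (s * (normc ((GH (nu (k + N)%N)).1 z) `^ p1 * W z) + (1 - s) * (normc ((GH (nu (k + N)%N)).2 z) `^ p2 * W z))%:E)).
- by move=> k; apply: mcmb.
- by move=> k z _; exact: (cmb0 (GH (nu (k + N)%N)).1 (GH (nu (k + N)%N)).2).
- exact: mcmb.
- by move=> z _; exact: cmb0.
- move=> z z1 _; eexists; first by move=> n; exact: lexx.
  apply: (sh (fun k => s * (normc ((GH (nu k)).1 z) `^ p1 * W z) + (1 - s) * (normc ((GH (nu k)).2 z) `^ p2 * W z))).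
  apply: cvgD; apply: cvgM; try exact: cvg_cst; apply: cvgM; try exact: cvg_cst; apply: cvg_normc_powR => // t t0.
    exact: cG.
  exact: cH.
- move=> k; rewrite -cmb//; have [_ _ _ b] := GHP (nu (k + N)%N).
  apply: le_trans b _; rewrite -EFinM -EFinD lee_fin mulrDr lerD2l.
  rewrite mulrC -ler_pdivlMr//; apply: le_trans (nuk _) _; apply: le_trans Ne.
  by rewrite lef_pV2 ?posrE ?ltr0n// ler_nat ltnS leq_addl.
Unshelve. all: by end_near.
Qed.

End LimitFactorization.

(** * Norm estimates and the factorization theorem *)

Section BergmanTranslation.
Variable R : realType.
Implicit Types (f g w : R[i] -> R[i]).

Lemma bergman_integralE (q : R) (w : R[i] -> R) (g : R[i] -> R[i]) :
  bergman_integral q w g = ((pi^-1)%:E * wint q w g)%E.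
Proof. by []. Qed.

Lemma bergman_norm_fin (q : R) (w : R[i] -> R) (g : R[i] -> R[i]) (b : R) :
  wint q w g = b%:E ->
  bergman_norm q w g = ((pi^-1 * b) `^ q^-1)%:E.
Proof. by move=> gb; rewrite /bergman_norm bergman_integralE gb -EFinM. Qed.

(** Young's inequality with exponents [p1 / p] and [p2 / p]. *)
Lemma young_powR (a b p p1 p2 : R) : 0 <= a -> 0 <= b -> 0 < p -> 0 < p1 -> 0 < p2 ->
  p^-1 = p1^-1 + p2^-1 ->
  (a `^ p1^-1) `^ p * (b `^ p2^-1) `^ p <= p / p1 * a + p / p2 * b.
Proof.
move=> a0 b0 p0 p10 p20 pE.
have cancel (x t : R) : 0 <= x -> 0 < t -> ((x `^ t^-1) `^ p) `^ (t / p) / (t / p) <= p / t * x.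
  move=> x0 t0; rewrite -!powRrM (_ : t^-1 * (p * (t / p)) = 1) ?powRr1// ?invf_div 1?mulrC//.
  by field; rewrite !gt_eqF.
have q0 t : 0 < t -> 0 < t / p by move=> t0; exact: divr_gt0.
have conj : (p1 / p)^-1 + (p2 / p)^-1 = 1 by rewrite !invf_div -mulrDr -pE mulfV// gt_eqF.
apply: le_trans (conjugate_powR (powR_ge0 _ p) (powR_ge0 _ p) (q0 _ p10) (q0 _ p20) conj) _.
exact: lerD (cancel _ _ a0 p10) (cancel _ _ b0 p20).
Qed.

Lemma norm_estimates (p p1 p2 a b c C : R) (x y z : \bar R) : 0 < p -> 0 < p1 -> 0 < p2 ->
  p^-1 = p1^-1 + p2^-1 -> 0 <= a -> 0 <= b -> 0 <= c ->
  x = (a `^ p1^-1)%:E -> y = (b `^ p2^-1)%:E -> z = (c `^ p^-1)%:E ->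
  p / p1 * a + p / p2 * b <= C * c ->
  (x `^ p * y `^ p <= (p / p1)%:E * x `^ p1 + (p / p2)%:E * y `^ p2 /\
   (p / p1)%:E * x `^ p1 + (p / p2)%:E * y `^ p2 <= C%:E * z `^ p)%E.
Proof.
move=> p0 p10 p20 pE a0 b0 c0 -> -> ->.
have cancel (u t : R) : 0 <= u -> 0 < t -> (u `^ t^-1) `^ t = u.
  by move=> u0 t0; rewrite -powRrM mulVf ?gt_eqF// powRr1.
rewrite !poweR_EFin -!EFinM (cancel a p1 a0 p10) (cancel b p2 b0 p20) (cancel c p c0 p0) -!EFinD !lee_fin.
by move=> abc; split => //; exact: young_powR.
Qed.

(** As [w] may fail to be measurable, the constant is moved to the side of [W]
    before the integrals are compared. *)
Lemma wint_le_of_le (W w : R[i] -> R) (k q : R) (g : R[i] -> R[i]) : 0 < k ->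
  dmeas (fun z => (normc (g z) `^ q * W z)%:E) -> (forall z, 0 <= W z) ->
  (forall z, unit_disc z -> W z <= k * w z) ->
  (wint q W g <= k%:E * wint q w g)%E.
Proof.
move=> k0 mg W0 Wk; rewrite -lee_pdivrMl//.
rewrite -dintZl ?invr_ge0 ?(ltW k0)//; last by move=> z _; rewrite lee_fin mulr_ge0 ?powR_ge0.
apply: le_dint => z z1.
  by rewrite -EFinM lee_fin !mulr_ge0 ?powR_ge0// invr_ge0 ltW.
by rewrite -EFinM lee_fin mulrCA ler_wpM2l ?powR_ge0// ler_pdivrMl// Wk.
Qed.

Lemma polynomials_dense_wint (p : R) (w : R[i] -> R) (f : R[i] -> R[i]) : 0 < p ->
  (forall z, unit_disc z -> 0 <= w z) ->
  (forall e : R, 0 < e -> exists q : {poly R[i]}, (bergman_norm p w (fun z => f z - q.[z])%R < e%:E)%E) ->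
  forall e : R, 0 < e -> exists q : {poly R[i]}, (dint (fun z => (normc (f z - q.[z]) `^ p * w z)%:E) <= e%:E)%E.
Proof.
move=> p0 w0 dens e e0.
have pe0 : 0 < pi^-1 * e by rewrite mulr_gt0// invr_gt0 pi_gt0.
have [q qe] := dens ((pi^-1 * e) `^ p^-1) (powR_gt0 _ pe0).
exists q; rewrite leNgt; apply/negP => h; move: qe; apply/negP; rewrite -leNgt.
rewrite /bergman_norm bergman_integralE -poweR_EFin.
have pe0' : (0 <= (pi^-1 * e)%:E)%E by rewrite lee_fin ltW.
have le : ((pi^-1 * e)%:E <= (pi^-1)%:E * dint (fun z => (normc (f z - q.[z]) `^ p * w z)%:E))%E.
  rewrite (EFinM pi^-1); apply: lee_wpmul2l; last exact: ltW.
  by rewrite lee_fin invr_ge0 pi_ge0.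
have p0' : 0 <= p^-1 by rewrite invr_ge0 ltW.
by apply: (gt0_ler_poweR p0') => //; rewrite in_itv/= leey andbT// (le_trans pe0' le).
Qed.

End BergmanTranslation.

Theorem theorem4p3 (R : realType) (p p1 p2 : R) (w : R[i] -> R)
    (p_gt0 : 0 < p) (p1_gt0 : 0 < p1) (p2_gt0 : 0 < p2)
    (pE : p^-1 = p1^-1 + p2^-1)
    (w_invariant : invariant_weight w)
    (w_dense : polynomials_dense p w) :
  exists2 C : R, 0 < C &
    forall f : R[i] -> R[i], bergman_space p w f ->
      exists f1 f2 : R[i] -> R[i],
        [/\ bergman_space p1 w f1, bergman_space p2 w f2,
            forall z, unit_disc z -> f z = f1 z * f2 z,
            (bergman_norm p1 w f1 `^ p * bergman_norm p2 w f2 `^ p <=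
             (p / p1)%:E * bergman_norm p1 w f1 `^ p1 +
             (p / p2)%:E * bergman_norm p2 w f2 `^ p2)%E
          & ((p / p1)%:E * bergman_norm p1 w f1 `^ p1 +
             (p / p2)%:E * bergman_norm p2 w f2 `^ p2 <=
             C%:E * bergman_norm p w f `^ p)%E].
Proof.
have [w_weight w_inv] := w_invariant; have [w_ge0 _] := w_weight.
have pi0 : 0 < pi^-1 :> R by rewrite invr_gt0 pi_gt0.
have [U [UU Uoo]] := ultraFilterLemma (eventually_filter : ProperFilter \oo).
have D0 : unit_disc (0 : R[i]) by rewrite unit_discE normc0.
have m0 (z : R[i]) : normc (mobius 0 z) = normc z.
  by rewrite normc_mobius conjc0 mul0r subr0 normc1 divr1 sub0r normcN.
have comparable0 z : unit_disc z -> exists2 C, 1 <= C & C^-1 * w 0 <= w z <= C * w 0.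
  rewrite unit_discE => z1; have r01 : 0 < (1 + normc z) / 2 < 1 by have := normc_ge0 z; lra.
  have [C C1 CP] := w_inv _ r01; exists C => //; apply: CP => //; split; first by rewrite unit_discE.
  by rewrite m0; lra.
have la (g : R[i] -> R[i]) : locpoly g -> analytic_on_disc g by exact: (locpoly_analytic Uoo).
(* A weight vanishing at one point vanishes identically, and every integral is zero. *)
have [w00|w0N0] := eqVneq (w 0) 0.
  have wz z : unit_disc z -> w z = 0.
    by move=> z1; have [C _] := comparable0 z z1; rewrite w00 !mulr0 -eq_le => /eqP.
  have d0 (q : R) (g : R[i] -> R[i]) : wint q w g = 0%:E.
    rewrite -[RHS](@integral0 _ _ _ (@lebesgue_measure R \x @lebesgue_measure R)%E (@cpt R @^-1` unit_disc)).
    by apply: eq_integral => u; rewrite inE => /wz ->; rewrite mulr0.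
  exists 1 => // f [af _]; exists f, (fun=> 1).
  have b0 (q : R) (g : R[i] -> R[i]) : (bergman_integral q w g < +oo)%E.
    by rewrite bergman_integralE d0 -EFinM ltry.
  have nn : 0 <= pi^-1 * 0 :> R by rewrite mulr0.
  have le0 : p / p1 * (pi^-1 * 0) + p / p2 * (pi^-1 * 0) <= 1 * (pi^-1 * 0) by rewrite !mulr0 addr0.
  have [e1 e2] := norm_estimates p_gt0 p1_gt0 p2_gt0 pE nn nn nn (bergman_norm_fin (d0 p1 f))
    (bergman_norm_fin (d0 p2 (fun=> 1))) (bergman_norm_fin (d0 p f)) le0.
  split; [by split| | |exact: e1|exact: e2].
  - have l1 : locpoly (fun=> 1 : R[i]) := locpoly_cst 1.
    by split; [exact: (la _ l1)|exact: b0].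
  - by move=> z _; rewrite mulr1.
have w_gt0 z : unit_disc z -> 0 < w z.
  move=> z1; have [C C1 /andP[h _]] := comparable0 z z1; apply: lt_le_trans h.
  by rewrite mulr_gt0 ?invr_gt0 ?(lt_le_trans _ C1)// lt_def w0N0 w_ge0.
have h01 : 0 < (2^-1 : R) < 1 by rewrite invr_gt0 ltr0n/= invf_lt1// ltr1n.
have [Kw Kw1 KwP] := w_inv _ h01.
have Kw0 : 0 < Kw by apply: lt_le_trans Kw1.
have w_half a z : unit_disc a -> unit_disc z -> normc (mobius a z) < 2^-1 -> w a <= Kw * w z.
  move=> a1 z1 az; have /andP[h _] := KwP a z a1 (conj z1 az).
  by rewrite -ler_pdivrMl.
pose W := envelope w.
have W_gt0 := @envelope_gt0 R w Kw w_gt0 w_half.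
have W_ge0 := @envelope_ge0 R w Kw w_gt0 w_half.
have mW := @measurable_envelope R w Kw w_gt0 w_half.
have W_inv := @envelope_inv R w Kw Kw1 w_half.
have wW := @le_envelope R w Kw w_half.
have Ww := @envelope_le R w Kw w_half.
rewrite -/W in W_gt0 W_ge0 mW W_inv wW Ww.
have K21 : 1 <= Kw ^+ 2 by rewrite exprn_ege1.
pose s := p / p1.
have s2 : 1 - s = p / p2.
  by rewrite /s -(mulfV (_ : p != 0)) ?gt_eqF// pE; ring.
have s0 : 0 < s by rewrite divr_gt0.
have s1' : 0 < 1 - s by rewrite s2 divr_gt0.
have s01 : 0 < s < 1 by rewrite s0/= -subr_gt0.
have sp1 : s * p1 = p by rewrite divfK// gt_eqF.
have sp2 : (1 - s) * p2 = p by rewrite s2 divfK// gt_eqF.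
have [C C0 fac] := @limit_factor R U UU Uoo W (Kw ^+ 2) W_gt0 W_ge0 mW K21 W_inv p p1 p2 s p_gt0 p1_gt0 p2_gt0 s01 sp1 sp2.
exists (C * Kw); first by rewrite mulr_gt0.
move=> f [af If].
have mes (q : R) (g : R[i] -> R[i]) : analytic_on_disc g -> dmeas (fun z => (normc (g z) `^ q * W z)%:E).
  by move=> ag; apply: (dmeas_powR_weight mW); exact: analytic_measurable.
have Wbound (q : R) (g : R[i] -> R[i]) : analytic_on_disc g -> (wint q W g <= Kw%:E * wint q w g)%E.
  by move=> ag; apply: wint_le_of_le => //; exact: mes.
have ge0w (q : R) (g : R[i] -> R[i]) : (0 <= wint q w g)%E.
  by apply: dint_ge0 => z z1; rewrite lee_fin mulr_ge0 ?powR_ge0// w_ge0.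
have ge0W (q : R) (g : R[i] -> R[i]) : (0 <= wint q W g)%E.
  by apply: dint_ge0 => z z1; rewrite lee_fin mulr_ge0 ?powR_ge0.
have wleW (q : R) (g : R[i] -> R[i]) : (wint q w g <= wint q W g)%E.
  apply: le_dint => z z1; first by rewrite lee_fin mulr_ge0 ?powR_ge0// w_ge0.
  by rewrite lee_fin ler_wpM2l ?powR_ge0// wW.
have Jf : (wint p w f < +oo)%E.
  move: If; rewrite bergman_integralE; move: (ge0w p f).
  by case: (dint _) => [x _ _|_|//]; [rewrite ltry|rewrite mulry gtr0_sg// mul1e].
have finE (x : \bar R) : (0 <= x)%E -> (x < +oo)%E -> x = (fine x)%:E.
  by move=> x0 xoo; rewrite fineK// ge0_fin_numE.
have fE := finE _ (ge0w p f) Jf.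
set I := fine _ in fE; have I0 : 0 <= I by rewrite -lee_fin -fE.
have JfW := Wbound p f af; rewrite fE -EFinM in JfW.
have densW (e : R) : 0 < e -> exists q : {poly R[i]}, (dint (fun z => (normc (f z - q.[z]) `^ p * W z)%:E) <= e%:E)%E.
  move=> e0; have eK : 0 < Kw^-1 * e by rewrite mulr_gt0 ?invr_gt0.
  have [q qe] := polynomials_dense_wint p_gt0 w_ge0 (w_dense f (conj af If)) eK.
  exists q; apply: le_trans (Wbound p (fun z => f z - q.[z]) _) _.
    have lq : locpoly (fun z => q.[z]) by exact: locpoly_poly.
    exact: (analyticB af (la _ lq)).
  by rewrite -lee_pdivlMl.
have [G [H [lG lH fGH le]]] := fac f af (le_lt_trans JfW (ltry _)) densW.
have {le} le : (s%:E * wint p1 w G +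
    (1 - s)%:E * wint p2 w H <= (C * Kw * I)%:E)%E.
  apply: le_trans (le_trans le _).
    by apply: leeD; apply: lee_wpmul2l; rewrite ?lee_fin ?(ltW s0) ?(ltW s1').
  by rewrite -mulrA (EFinM C); apply: lee_wpmul2l; rewrite ?lee_fin ?(ltW C0).
have fin (t : R) (x y : \bar R) : 0 < t -> (0 <= x)%E -> (0 <= y)%E -> (t%:E * x + y <= (C * Kw * I)%:E)%E -> (x < +oo)%E.
  move=> t0; case: x => [x _ _ _|_ y0|//]; first by rewrite ltry.
  have yN : y != -oo%E by apply: contraTneq y0 => ->.
  by rewrite mulry gtr0_sg// mul1e addye// leye_eq.
have Gfin : (wint p1 w G < +oo)%E.
  by apply: fin le => //; rewrite mule_ge0// lee_fin ltW.
have Hfin : (wint p2 w H < +oo)%E.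
  by rewrite addeC in le; apply: fin le => //; rewrite mule_ge0// lee_fin ltW.
have gE := finE _ (ge0w p1 G) Gfin; have hE := finE _ (ge0w p2 H) Hfin.
set a := fine _ in gE; set b := fine _ in hE.
have a0 : 0 <= a by rewrite -lee_fin -gE.
have b0 : 0 <= b by rewrite -lee_fin -hE.
rewrite gE hE -!EFinM -EFinD lee_fin in le.
have [e1 e2] : (bergman_norm p1 w G `^ p * bergman_norm p2 w H `^ p <=
     (p / p1)%:E * bergman_norm p1 w G `^ p1 + (p / p2)%:E * bergman_norm p2 w H `^ p2 /\
   (p / p1)%:E * bergman_norm p1 w G `^ p1 + (p / p2)%:E * bergman_norm p2 w H `^ p2 <=
     (C * Kw)%:E * bergman_norm p w f `^ p)%E.
  have sc (u : R) : 0 <= u -> 0 <= pi^-1 * u by move=> u0; apply: mulr_ge0 => //; exact: ltW.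
  have le' : p / p1 * (pi^-1 * a) + p / p2 * (pi^-1 * b) <= C * Kw * (pi^-1 * I).
    rewrite (mulrCA (C * Kw)) (mulrCA (p / p1)) (mulrCA (p / p2)) -mulrDr -s2.
    by apply: ler_wpM2l => //; exact: ltW.
  exact: (norm_estimates p_gt0 p1_gt0 p2_gt0 pE (sc a a0) (sc b b0) (sc I I0)
    (bergman_norm_fin gE) (bergman_norm_fin hE) (bergman_norm_fin fE) le').
exists G, H; split; [| |exact: fGH|exact: e1|exact: e2].
- by split; [exact: la|rewrite bergman_integralE gE -EFinM ltry].
- by split; [exact: la|rewrite bergman_integralE hE -EFinM ltry].
Qed.
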